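(* There is an absolute constant $c_1>0$ such that the following holds. Let $n\ge2$ and let $M=A\circ X+B$ be an $n\times n$ structured random matrix with standard deviation profile $A=(a_{ij})$, mean profile $B$ and $\kappa_0$-spread atom variable $\xi$, where $\kappa_0\ge1$. Assume that $A(\sigma_0)=(a_{ij}1_{a_{ij}\ge\sigma_0})$ is $(\delta,\varepsilon)$-super-regular for some $\delta,\sigma_0\in(0,1)$ and $0<\varepsilon<c_1\delta\sigma_0^2$. For any $\gamma\ge1/2$ there exists $\beta=O(\gamma^2)$ (with absolute implied constant) such that \[ \mathbb{P}\big(s_n(M)\le n^{-\beta},\ \|M\|\le n^\gamma\big)\ \le\ C\sqrt{\frac{\log n}{n}}, \] where $C<\infty$ depends only on $\gamma,\delta,\sigma_0,\kappa_0$.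
   Context: Structured random matrix: $A=(a_{ij})$ and $B=(b_{ij})$ are deterministic $n\times n$ matrices with $a_{ij}\in[0,1]$ and $b_{ij}\in\mathbb{C}$; $X=(\xi_{ij})$ is an $n\times n$ matrix with independent entries, all distributed as a complex random variable $\xi$ (the atom variable) with $\mathbb{E}\xi=0$ and $\mathbb{E}|\xi|^2=1$; $M=A\circ X+B=(a_{ij}\xi_{ij}+b_{ij})$. A complex random variable $\xi$ is $\kappa$-spread ($\kappa\ge1$) if $\mathrm{Var}\big[\xi 1(|\xi-\mathbb{E}\xi|\le\kappa)\big]\ge1/\kappa$. $s_1(M)\ge\dots\ge s_n(M)\ge0$ are the singular values of $M$, and $\|M\|=s_1(M)$ is the $\ell_2\to\ell_2$ operator norm. For an $n\times m$ matrix $A=(a_{ij})$ with non-negative entries, $\mathcal{N}_A(i)=\{j\in[m]:a_{ij}>0\}$, $\mathcal{N}_{A^{T}}(j)=\{i\in[n]:a_{ij}>0\}$, and for $I\subset[n]$, $J\subset[m]$, $e_A(I,J)=|\{(i,j)\in I\times J:a_{ij}>0\}|$. For $\delta,\varepsilon\in(0,1)$, $A$ is $(\delta,\varepsilon)$-super-regular if: (1) $|\mathcal{N}_A(i)|\ge\delta m$ for all $i\in[n]$; (2) $|\mathcal{N}_{A^{T}}(j)|\ge\delta n$ for all $j\in[m]$; (3) $e_A(I,J)\ge\delta|I||J|$ for all $I\subset[n]$, $J\subset[m]$ with $|I|\ge\varepsilon n$ and $|J|\ge\varepsilon m$. The exponent $\beta$ depends only on $\gamma$ (it does not depend on $n$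 or $M$). *)

(* Defs.v *)
From HB Require Import structures.
From mathcomp Require Export all_boot all_order all_algebra.
From mathcomp Require Export spectral sesquilinear.
From mathcomp Require Export all_classical all_reals all_analysis.
From mathcomp Require Export complex.

Set Implicit Arguments.
Unset Strict Implicit.
Unset Printing Implicit Defensive.

Import Order.TTheory GRing.Theory Num.Theory.
Import numFieldNormedType.Exports.

Local Open Scope classical_set_scope.
Local Open Scope ring_scope.
Local Open Scope complex_scope.
Local Open Scope sesquilinear_scope.

(** ** Complex-valued random variables *)

(* The norm of [R[i]] takes its values in [R[i]]; this is the same number
   seen in [R]. *)
Definition cabs (R : realType) (z : R[i]) : R := complex.Re `|z|.

(* [R[i]] carries no sigma-algebra in the library: its Borel sets are
   described through the identification with [R * R]. *)
Definition cpair (R : realType) (z : R[i]) : R * R :=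
  (complex.Re z, complex.Im z).

Definition complex_rv d (T : measurableType d) (R : realType)
    (X : T -> R[i]) : Prop :=
  measurable_fun [set: T] (@cpair R \o X).

Definition cevent (T : Type) (R : realType) (X : T -> R[i])
    (E : set (R * R)) : set T :=
  X @^-1` (@cpair R @^-1` E).

(* Only meaningful when the real and imaginary parts are integrable. *)
Definition cexpectation d (T : measurableType d) (R : realType)
    (P : probability T R) (X : T -> R[i]) : R[i] :=
  fine ('E_P[fun w => complex.Re (X w)])%E
    +i* fine ('E_P[fun w => complex.Im (X w)])%E.

Definition cvariance d (T : measurableType d) (R : realType)
    (P : probability T R) (X : T -> R[i]) : \bar R :=
  ('E_P[fun w => (cabs (X w - cexpectation P X) ^+ 2)%R])%E.

Definition same_law d1 (T1 : measurableType d1) d2 (T2 : measurableType d2)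
    (R : realType) (P1 : probability T1 R) (P2 : probability T2 R)
    (X1 : T1 -> R[i]) (X2 : T2 -> R[i]) : Prop :=
  forall E : set (R * R), measurable E -> P1 (cevent X1 E) = P2 (cevent X2 E).

Definition mutually_independent d (T : measurableType d) (R : realType)
    (P : probability T R) (I : finType) (X : I -> T -> R[i]) : Prop :=
  forall (J : {set I}) (E : I -> set (R * R)),
    (forall i, measurable (E i)) ->
    P [set w | forall i, i \in J -> cevent (X i) (E i) w]
    = (\prod_(i in J) P (cevent (X i) (E i)))%E.

Definition truncation (T : Type) (R : realType) (c : R[i]) (kappa : R)
    (X : T -> R[i]) : T -> R[i] :=
  fun w => if cabs (X w - c) <= kappa then X w else 0.

Definition spread d (T : measurableType d) (R : realType)
    (P : probability T R) (kappa : R) (xi : T -> R[i]) : Prop :=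
  1 <= kappa /\
  ((kappa^-1)%:E
     <= cvariance P (truncation (cexpectation P xi) kappa xi))%E.

(** ** Singular values *)

(* [M ^t* *m M] is normal, so that [spectral_diag] lists its eigenvalues with
   multiplicity; they are real and non-negative. *)
Definition singular_values (R : realType) n (M : 'M[R[i]]_n) : seq R :=
  sort (fun x y : R => y <= x)
    [seq Num.sqrt (complex.Re (spectral_diag (M ^t* *m M) 0 i)) | i : 'I_n].

(* Numbered from 1, as in s_1 >= ... >= s_n. *)
Definition singular_value (R : realType) n (M : 'M[R[i]]_n) (k : nat) : R :=
  nth 0 (singular_values M) k.-1.

(* The l2 -> l2 operator norm, as the largest singular value. *)
Definition opnorm (R : realType) n (M : 'M[R[i]]_n) : R := singular_value M 1.

(** ** Super-regular matrices *)

Definition row_nbhd (R : realType) n m (A : 'M[R]_(n, m)) (i : 'I_n) :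
  {set 'I_m} := [set j | 0 < A i j].

Definition edge_count (R : realType) n m (A : 'M[R]_(n, m))
    (I : {set 'I_n}) (J : {set 'I_m}) : nat :=
  #|[set p : 'I_n * 'I_m | [&& p.1 \in I, p.2 \in J & 0 < A p.1 p.2]]|.

Definition super_regular (R : realType) (delta eps : R) n m
    (A : 'M[R]_(n, m)) : Prop :=
  [/\ 0 < delta < 1, 0 < eps < 1,
      forall i : 'I_n, delta * m%:R <= #|row_nbhd A i|%:R,
      forall j : 'I_m, delta * n%:R <= #|row_nbhd A^T j|%:R &
      forall (I : {set 'I_n}) (J : {set 'I_m}),
        eps * n%:R <= #|I|%:R -> eps * m%:R <= #|J|%:R ->
        delta * #|I|%:R * #|J|%:R <= (edge_count A I J)%:R].

(** ** Structured random matrices *)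

Definition cutoff (R : realType) n m (A : 'M[R]_(n, m)) (sigma : R) :
  'M[R]_(n, m) := \matrix_(i, j) (if sigma <= A i j then A i j else 0).

Definition structured_matrix (T : Type) (R : realType) n (A : 'M[R]_n)
    (B : 'M[R[i]]_n) (X : 'I_n * 'I_n -> T -> R[i]) (w : T) : 'M[R[i]]_n :=
  \matrix_(i, j) ((A i j)%:C * X (i, j) w + B i j).

Definition atom_variable d (T : measurableType d) (R : realType)
    (P : probability T R) (xi : T -> R[i]) : Prop :=
  [/\ complex_rv xi,
      cexpectation P xi = 0 &
      ('E_P[fun w => (cabs (xi w) ^+ 2)%R] = 1)%E].

Definition iid_entries d (T : measurableType d) d' (T' : measurableType d')
    (R : realType) (P : probability T R) (P' : probability T' R) n
    (X : 'I_n * 'I_n -> T -> R[i]) (xi : T' -> R[i]) : Prop :=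
  [/\ forall p, complex_rv (X p),
      mutually_independent P X &
      forall p, same_law P P' (X p) xi].

(* Main.v *)
Require Import Defs.
From mathcomp Require Import ring lra zify measurable_realfun.

(** The argument works with sup norms and loses powers of [n] freely, which is
    what allows it to do without nets.

    Call a matrix robust at scales [tau], [rho] with parameter [m] when every
    nonzero vector whose image is smaller than [tau] (relative to the vector)
    has at least [m] coordinates of relative size at least [rho]. Every matrix
    is robust with [m = 1]. The heart of the proof is that robustness improves
    at finer scales, with overwhelming probability. Suppose that it fails at a
    finer scale: some almost null vector is, after truncation, supported on a
    set [J] with few elements. Cramer's rule applied to a maximal minor of the
    columns [J] then gives a set [S] of fewer than [#|J|] rows and an almost
    null vector [y] that spans the kernel of the rows [S] among the vectors
    supported on [J], or on a subset of [J] ([thin_kernel]). Up to scaling, [y]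
    depends on the rows [S] alone, so that a union bound over pairs of small
    sets suffices, and the other rows are independent of [y]. By robustness at
    the coarser scale [y] has [m] large coordinates, hence many rows have many
    nonzero entries among these, and each such row is almost orthogonal to
    [y] with probability at most a small ball probability [p]
    ([robust_step]).

    Super-regularity provides the rich rows. Starting from [m = 1], three steps
    lead to [m] of order [n], then to [m > delta n / 4], then to
    [m > (1 - delta / 2) n] ([rich_one], [rich_many], [rich_most]), at which
    point every row is rich because each row has at least [delta n] nonzero
    entries ([rich_all]).
    The small ball probability is then [O (1 / sqrt n)], by the
    Littlewood-Offord inequality: Kleitman's induction proves it in the complex
    plane ([littlewood_offord]), and exchanging random coordinates between two
    copies reduces a general linear form to a random subset sum
    ([small_ball_many]).

    If now the matrix is almost singular, its transpose has an almost null
    vector too, and the first step applied to the transpose shows that a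
    positive proportion of its coordinates are large. For each of these, the
    normal to the other rows is almost annihilated by the remaining row, an
    event of probability [O (1 / sqrt n)] since this normal is independent of that
    row. Averaging over the rows gives a failure probability [O (1 / sqrt n)]
    ([averaging], [fixed_size], [finite_model]).

    Each step costs a factor of order [n ^ 5 T] in the scales, where
    [T = n ^ gamma + 1] bounds the entries, and four steps account for the
    exponent [4 gamma + O(1)]. For [gamma >= 1 / 2] this is [O (gamma ^ 2)].

    All this takes place in a finite product space: the atom is rounded to a
    grid whose mesh is far below the scales in play and whose size makes the
    points off the grid negligible by Chebyshev's inequality
    ([law_transfer], [discretized_bound]). The spread hypothesis enters only
    through [anti_concentration]: an atom concentrated in a tiny disc would,
    having mean zero, have that disc near the origin, and its truncation would have
    almost no variance. *)

Set Implicit Arguments.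
Unset Strict Implicit.
Unset Printing Implicit Defensive.

Import Order.TTheory GRing.Theory Num.Theory.
Import numFieldNormedType.Exports.

Local Open Scope ring_scope.

(** * Finite product probability spaces *)

Section FiniteProduct.
Variables (R : realFieldType) (I V : finType) (mu : V -> R).
Hypothesis mu_ge0 : forall v, 0 <= mu v.
Hypothesis mu_sum1 : \sum_v mu v = 1.

Notation Om := {ffun I -> V}.
Implicit Types E : Om -> bool.

Definition wt (w : Om) : R := \prod_p mu (w p).
Definition Ex (F : Om -> R) : R := \sum_w wt w * F w.
Definition Pr (E : Om -> bool) : R := Ex (fun w => (E w)%:R).
Definition resample (S : {set I}) (w w' : Om) : Om :=
  [ffun p => if p \in S then w p else w' p].

Lemma wt_ge0 w : 0 <= wt w.
Proof. by apply: prodr_ge0 => p _. Qed.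

Lemma Ex_prod (f : I -> V -> R) :
  Ex (fun w => \prod_p f p (w p)) = \prod_p \sum_v mu v * f p v.
Proof.
rewrite bigA_distr_bigA; apply: eq_bigr => w _.
by rewrite /wt -big_split.
Qed.

Lemma Ex_cst c : Ex (fun=> c) = c.
Proof.
have -> : Ex (fun=> c) = Ex (fun=> 1) * c.
  by rewrite /Ex big_distrl /=; apply: eq_bigr => w _; rewrite mulr1.
have -> : Ex (fun=> 1) = Ex (fun w => \prod_(p : I) (fun _ _ => 1) p (w p)).
  by apply: eq_bigr => w _; rewrite big1.
rewrite (Ex_prod (fun _ _ => 1)) big1 ?mul1r// => p _.
by rewrite -[RHS]mu_sum1; apply: eq_bigr => v _; rewrite mulr1.
Qed.

Lemma Ex_le F G : (forall w, F w <= G w) -> Ex F <= Ex G.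
Proof. by move=> FG; apply: ler_sum => w _; rewrite ler_wpM2l ?wt_ge0. Qed.

(** Replacing the coordinates outside [S] by those of an independent copy does
    not change the law. Both conditioning on the coordinates in [S] and the
    independence of events living on disjoint sets of coordinates follow. *)
Lemma Ex_resample S F : Ex F = Ex (fun w => Ex (fun w' => F (resample S w w'))).
Proof.
have -> : Ex (fun w => Ex (fun w' => F (resample S w w')))
  = \sum_(u : Om * Om) wt u.1 * wt u.2 * F (resample S u.1 u.2).
  rewrite -(pair_bigA _ (fun u v => wt u * wt v * F (resample S u v))) /=.
  apply: eq_bigr => w _; rewrite big_distrr /=.
  by apply: eq_bigr => w' _; rewrite mulrA.
pose h (u : Om * Om) := (resample S u.1 u.2, resample S u.2 u.1).
have hK : involutive h.
  move=> [u v]; apply: (f_equal2 pair); apply/ffunP => p; rewrite !ffunE /=.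
    by case: (p \in S).
  by case: (p \in S).
rewrite (reindex_inj (inv_inj hK)) /=.
transitivity (\sum_(u : Om * Om) wt u.1 * wt u.2 * F u.1).
  rewrite -(pair_bigA _ (fun u v => wt u * wt v * F u)) /=.
  apply: eq_bigr => u _; under eq_bigr do rewrite mulrAC.
  rewrite -big_distrr /= -[LHS]mulr1; congr (_ * _).
  by rewrite -[LHS](Ex_cst 1); apply: eq_bigr => v _; rewrite mulr1.
apply: eq_bigr => u _; congr (_ * F _).
  rewrite /wt -!big_split /=; apply: eq_bigr => p _.
  by rewrite !ffunE; case: ifP => // _; rewrite mulrC.
by have := hK u; rewrite {2}[u]surjective_pairing => -[].
Qed.

Lemma Pr_ge0 E : 0 <= Pr E.
Proof. by apply: sumr_ge0 => w _; rewrite mulr_ge0 ?wt_ge0 ?ler0n. Qed.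

Lemma Pr_le E E' : (forall w, E w -> E' w) -> Pr E <= Pr E'.
Proof.
by move=> EE'; apply: Ex_le => w; rewrite ler_nat; case: (E w) (EE' w) => // ->.
Qed.

Lemma Pr_le1 E : Pr E <= 1.
Proof. by rewrite -[leRHS]Ex_cst; apply: Ex_le => w; case: (E w). Qed.

Lemma Pr_or E E' : Pr (fun w => E w || E' w) <= Pr E + Pr E'.
Proof.
rewrite /Pr /Ex -big_split; apply: ler_sum => w _ /=.
rewrite -mulrDr ler_wpM2l ?wt_ge0//.
by case: (E w); case: (E' w); rewrite ?addr0 ?add0r// lerDl.
Qed.

Lemma Pr_exists (J : finType) (P : pred J) (E : J -> Om -> bool) :
  Pr (fun w => [exists (j | P j), E j w]) <= \sum_(j | P j) Pr (E j).
Proof.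
rewrite /Pr /Ex exchange_big /=; apply: ler_sum => w _.
rewrite -mulr_sumr ler_wpM2l ?wt_ge0//.
case: existsP => [[j /andP[Pj Ej]]|_]; last by apply: sumr_ge0.
by rewrite (bigD1 j) //= Ej lerDl sumr_ge0.
Qed.

Lemma Pr_cond S E p : (forall w, Pr (fun w' => E (resample S w w')) <= p) -> Pr E <= p.
Proof.
by move=> Ep; rewrite /Pr (Ex_resample S) -[leRHS]Ex_cst; apply: Ex_le.
Qed.

Lemma Pr_indep S E E' :
  (forall w w', E (resample S w w') = E w) ->
  (forall w w', E' (resample S w w') = E' w') ->
  Pr (fun w => E w && E' w) = Pr E * Pr E'.
Proof.
move=> Ed Ed'; rewrite {1}/Pr (Ex_resample S) /Pr /Ex big_distrl /=.
apply: eq_bigr => w _; rewrite -mulrA; congr (_ * _).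
rewrite big_distrr /=; apply: eq_bigr => w' _.
by rewrite Ed Ed' -mulnb natrM mulrCA.
Qed.

(** Labelling the coordinates by [J] makes independence iterable: an event
    depending on the coordinates labelled [j] alone is split off from the
    others by [Pr_indep]. *)
Lemma Pr_blocks (J : finType) (blk : I -> J) (G : {set J})
    (E : J -> Om -> bool) (p : R) :
  0 <= p ->
  (forall j (w w' : Om), j \in G -> (forall i, blk i = j -> w i = w' i) -> E j w = E j w') ->
  (forall j, j \in G -> Pr (E j) <= p) ->
  Pr (fun w => [forall (j | j \in G), E j w]) <= p ^+ #|G|.
Proof.
move=> p0; have [m] := ubnP #|G|; elim: m G => // m IH G Gm Edep Ep.
case: (set_0Vmem G) => [->|[j jG]]; first by rewrite cards0 expr0 Pr_le1.
have cG : #|G| = #|G :\ j|.+1 by rewrite (cardsD1 j) jG.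
pose E' w := [forall (k | k \in G :\ j), E k w].
apply: (@le_trans _ _ (Pr (fun w => E j w && E' w))).
  apply: Pr_le => w /forallP H; apply/andP; split.
    by have /implyP := H j; apply.
  apply/forallP => k; apply/implyP => /setD1P[_ kG].
  by have /implyP := H k; apply.
rewrite (@Pr_indep [set i | blk i == j]).
- rewrite cG exprS ler_pM ?Pr_ge0 ?Ep//.
  apply: IH; first by rewrite -ltnS -cG.
    by move=> k w w' /setD1P[_ kG]; apply: Edep.
  by move=> k /setD1P[_ kG]; apply: Ep.
- by move=> w w'; apply: Edep => // i ij; rewrite ffunE inE ij eqxx.
- move=> w w'; apply: eq_forallb => k; case kG: (k \in G :\ j) => //=.
  have /setD1P[kj kG'] := kG; apply: Edep => // i ik.
  by rewrite ffunE inE ik (negbTE kj).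
Qed.

End FiniteProduct.

(** * Moduli of complex numbers *)

Section Modulus.
Variable R : realType.
Implicit Types z w : R[i].

Lemma cabsE z : cabs z = Num.sqrt (complex.Re z ^+ 2 + complex.Im z ^+ 2).
Proof. by rewrite /cabs normc_def. Qed.

Lemma cabs_ge0 z : 0 <= cabs z.
Proof. by rewrite cabsE sqrtr_ge0. Qed.

Lemma cabs_normr z : `|z| = (cabs z)%:C%C.
Proof. by rewrite cabsE normc_def. Qed.

Lemma cabsM z w : cabs (z * w) = cabs z * cabs w.
Proof. by apply: complexI; rewrite rmorphM /= -!cabs_normr normrM. Qed.

Lemma cabsD z w : cabs (z + w) <= cabs z + cabs w.
Proof. by rewrite -lecR rmorphD /= -!cabs_normr ler_normD. Qed.

Lemma cabsN z : cabs (- z) = cabs z.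
Proof. by apply: complexI; rewrite -!cabs_normr normrN. Qed.

Lemma cabs_eq0 z : (cabs z == 0) = (z == 0).
Proof. by rewrite -(inj_eq (@complexI R)) -cabs_normr normr_eq0. Qed.

Lemma cabs0 : cabs (0 : R[i]) = 0.
Proof. by apply/eqP; rewrite cabs_eq0. Qed.

Lemma cabs1 : cabs (1 : R[i]) = 1.
Proof. by apply: complexI; rewrite -cabs_normr normr1. Qed.

Lemma cabs_gt0 z : (0 < cabs z) = (z != 0).
Proof. by rewrite lt0r cabs_ge0 andbT cabs_eq0. Qed.

Lemma cabs_real (x : R) : cabs (x%:C)%C = `|x|.
Proof. by rewrite cabsE /= expr0n addr0 sqrtr_sqr. Qed.

Lemma cabsB z w : cabs (z - w) = cabs (w - z).
Proof. by rewrite -cabsN opprB. Qed.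

Lemma cabs_sum (J : Type) (r : seq J) (P : pred J) (F : J -> R[i]) :
  cabs (\sum_(j <- r | P j) F j) <= \sum_(j <- r | P j) cabs (F j).
Proof.
elim/big_ind2: _ => [|x1 x2 y1 y2 h1 h2|//]; first by rewrite cabs0.
by rewrite (le_trans (cabsD _ _))// lerD.
Qed.

Lemma cabs_sqr z : cabs z ^+ 2 = complex.Re z ^+ 2 + complex.Im z ^+ 2.
Proof. by rewrite cabsE sqr_sqrtr// addr_ge0// sqr_ge0. Qed.

Lemma Re_le_cabs z : `|complex.Re z| <= cabs z.
Proof. by rewrite cabsE -sqrtr_sqr ler_wsqrtr// lerDl sqr_ge0. Qed.

Lemma Im_le_cabs z : `|complex.Im z| <= cabs z.
Proof. by rewrite cabsE -sqrtr_sqr ler_wsqrtr// lerDr sqr_ge0. Qed.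

Lemma cabs_le_ReIm z : cabs z <= `|complex.Re z| + `|complex.Im z|.
Proof.
rewrite cabsE -[leRHS]ger0_norm ?addr_ge0// -sqrtr_sqr ler_wsqrtr//.
by rewrite sqrrD !real_normK ?num_real// lerD2r lerDl mulrn_wge0// mulr_ge0.
Qed.

(** The component of [s + d - t] along [d] is at least as long as [d]. In
    Kleitman's argument [s] is the point of a finite set that is extreme in the
    direction [d], so that moving it by [d] leads away from the whole set. *)
Lemma cabs_extreme (s t d : R[i]) :
  complex.Re (t * d^*)%C <= complex.Re (s * d^*)%C -> cabs d <= cabs (s + d - t).
Proof.
move=> st; case: (eqVneq d 0) => [->|d0]; first by rewrite cabs0 cabs_ge0.
have dp : 0 < cabs d by rewrite cabs_gt0.
have cJ : cabs (d^*)%C = cabs d by case: d {st d0 dp} => a b; rewrite !cabsE /= sqrrN.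
rewrite -(ler_pM2r dp) -{3}cJ -[leRHS]cabsM.
apply: le_trans (Re_le_cabs _); apply: le_trans (ler_norm _).
rewrite -expr2 cabs_sqr.
move: st; case: s => s1 s2; case: t => t1 t2; case: d {d0 dp cJ} => d1 d2 /=.
nra.
Qed.

End Modulus.

(** * Middle layers of the cube *)

Section CentralBinomial.

(** The number of points of a cube of dimension [g] lying in its [k] largest
    layers. The recursion is the one that Kleitman's induction produces:
    adding a dimension turns one set of [k] points into two sets, of [k + 1]
    and [k - 1] points. *)
Fixpoint chainsum (g k : nat) : nat :=
  match g, k with
  | _, 0 => 0
  | 0, _ => 1
  | g'.+1, k'.+1 => chainsum g' k'.+2 + chainsum g' k'
  end.

Lemma chainsum_layers g k :
  chainsum g k =
  (\sum_(i < g.+1) 'C(g, i) * ((g < i.*2 + k) && (i.*2 <= g + k)))%N.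
Proof.
elim: g k => [|g IH] [|k].
- by rewrite big_ord_recl big_ord0.
- by rewrite big_ord_recl big_ord0 /= bin0.
- rewrite big1// => i _; rewrite !addn0; case: andP => [[h1 h2]|_]; lia.
rewrite /= !IH -big_split /=.
pose P (i : nat) := ((g.+1 < i.*2 + k.+1) && (i.*2 <= g.+1 + k.+1))%N.
transitivity (\sum_(i < g.+1) 'C(g, i) * (P i + P i.+1))%N.
  apply: eq_bigr => i _; rewrite -mulnDr; congr muln.
  by rewrite /P; case: andP; case: andP; case: andP; case: andP; lia.
rewrite [RHS]big_ord_recl /= bin0 mul1n.
under [in RHS]eq_bigr => i _ do rewrite /bump /= add1n binS mulnDl.
rewrite big_split /= addnA.
have -> : (P 0 + \sum_(i < g.+1) 'C(g, i.+1) * P i.+1 =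
    \sum_(i < g.+1) 'C(g, i) * P i)%N.
  rewrite [RHS]big_ord_recl /= bin0 mul1n; congr addn.
  rewrite [LHS]big_ord_recr /= bin_small// mul0n addn0.
  by apply: eq_bigr => i _; rewrite /bump /= add1n.
by rewrite -big_split /=; apply: eq_bigr => i _; rewrite mulnDr.
Qed.

(** The classical bound for the central binomial coefficient, squared to avoid
    square roots; it is what makes the error term of order the inverse square
    root of [n]. *)
Lemma central_binomial_sq h : ('C(h.*2, h) ^ 2 * h.*2.+1 <= 16 ^ h)%N.
Proof.
elim: h => [|h IH]//.
have rec : (h.+1 * 'C(h.+1.*2, h.+1) = 2 * h.*2.+1 * 'C(h.*2, h))%N.
  have e1 := mul_bin_diag h.*2.+1 h.
  have e2 := mul_bin_left h.*2.+1 h.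
  have e3 : 'C(h.*2.+1, h.+1) = 'C(h.*2.+1, h).
    by rewrite -bin_sub; [congr binomial|]; lia.
  have e4 := mul_bin_down h.*2.+1 h.
  rewrite doubleS binS e3.
  move: e1 e4; rewrite /= e3.
  have -> : (h.*2.+1 - h = h.+1)%N by lia.
  by nia.
rewrite -(@leq_pmul2l (h.+1 ^ 2)) ?expn_gt0//.
rewrite mulnA -expnMn rec expnMn (expnS 16).
set c := ('C(h.*2, h) ^ 2)%N in IH *.
have h1 : ((2 * h.*2.+1) ^ 2 * h.+1.*2.+1 <= h.+1 ^ 2 * 16 * h.*2.+1)%N.
  by rewrite -!muln2; nia.
apply: (@leq_trans (h.+1 ^ 2 * 16 * h.*2.+1 * c)%N).
  by rewrite [leqLHS]mulnAC leq_mul2r h1 orbT.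
rewrite -mulnA (mulnC _ c) (mulnA _ 16%N); exact: leq_mul.
Qed.

Lemma chainsum1_sq g : (chainsum g 1 ^ 2 * g.+1 <= 4 ^ g)%N.
Proof.
have -> : chainsum g 1 = 'C(g, uphalf g).
  rewrite chainsum_layers.
  have ltu : (uphalf g < g.+1)%N by lia.
  rewrite (bigD1 (Ordinal ltu)) //= big1 ?addn0.
    by case: andP; [rewrite muln1|lia].
  move=> i; rewrite -val_eqE /= => ne; case: andP; last by rewrite muln0.
  by move=> [h1 h2]; exfalso; move/eqP: ne; apply; lia.
rewrite -[in X in (_ <= X)%N](odd_double_half g) uphalf_half.
case: (odd g) (odd_double_half g) => /= <-; last first.
  by rewrite !add0n doubleK (leq_trans (central_binomial_sq _))// -muln2 mulnC expnM.
set h := g./2; rewrite !add1n /=.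
have e : (2 * 'C(h.*2.+1, h.+1) = 'C(h.+1.*2, h.+1))%N.
  have e3 : 'C(h.*2.+1, h.+1) = 'C(h.*2.+1, h).
    by rewrite -bin_sub; [congr binomial|]; lia.
  by rewrite doubleS [RHS]binS e3; lia.
have := central_binomial_sq h.+1; rewrite -e expnMn doubleS.
have -> : (16 ^ h.+1 = 4 * 4 ^ h.*2.+1)%N.
  by rewrite -(expnM 4 2) -!expnS; congr expn; lia.
rewrite uphalf_double; nia.
Qed.

End CentralBinomial.

(** * The complex Littlewood-Offord inequality *)

Section LittlewoodOfford.
Import mathcomp.boot.finset.
Variables (R : realType) (I : finType) (d : I -> R[i]) (sep r : R).
Hypothesis sep_r : 2 * r < sep.

Notation apart := (fun a b : R[i] => sep <= cabs (a - b)).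
Notation inball := (fun z : R[i] => cabs z <= r).
Notation bigs := [set p | sep <= cabs (d p)].

Lemma powerset_split (A : {set I}) p (F : {set I} -> nat) : p \in A ->
  (\sum_(S : {set I} | S \subset A) F S =
   \sum_(S : {set I} | S \subset A :\ p) (F S + F (p |: S)))%N.
Proof.
move=> pA; rewrite big_split /= (bigID (fun S : {set I} => p \in S)) /= addnC.
congr addn; first by apply: eq_bigl => S; rewrite subsetD1.
rewrite (reindex_onto (fun S => p |: S) (fun S => S :\ p)) /=; last first.
  by move=> S /andP[_ pS]; rewrite setD1K.
apply: eq_bigl => S; rewrite subUset sub1set pA /= setU11 andbT subsetD1.
congr andb; apply/eqP/idP => [<-|pS]; first by rewrite !inE eqxx.
by rewrite setU1K.
Qed.

Lemma seq_argmax (f : R[i] -> R) (D : seq R[i]) : D != [::] ->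
  exists2 s, s \in D & forall t, t \in D -> f t <= f s.
Proof.
elim: D => // a D IH _; case: (eqVneq D [::]) => [->|/IH[s sD smax]].
  by exists a; rewrite ?mem_head// => t; rewrite inE => /eqP->.
case: (leP (f a) (f s)) => as_.
  by exists s; [rewrite inE sD orbT|move=> t; rewrite inE => /orP[/eqP->//|/smax]].
exists a; first exact: mem_head.
by move=> t; rewrite inE => /orP[/eqP->//|/smax h]; rewrite (le_trans h)// ltW.
Qed.

Lemma pairwise_to_front (s : R[i]) (D1 D2 : seq R[i]) :
  pairwise apart (D1 ++ s :: D2) -> pairwise apart (s :: D1 ++ D2).
Proof.
rewrite !pairwise_cat !pairwise_cons pairwise_cat allrel_consr all_cat.
move=> /and3P[/andP[a1 a2] p1] /andP[a3 p2]; rewrite a2 p1 p2 a3 !andbT.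
by apply: sub_all a1 => z; rewrite -cabsN opprB.
Qed.

Lemma count_ball (D : seq R[i]) : pairwise apart D -> (count inball D <= 1)%N.
Proof.
elim: D => //= a D IH /andP[/allP aD /IH {}IH].
case: (leP (cabs a) r) => [ar|_]; last by rewrite add0n.
rewrite (_ : count _ D = 0%N)//; apply/eqP; rewrite -leqn0 leqNgt -has_count.
apply/hasPn => b /aD; rewrite -ltNge => ab.
by have := cabsD a (- b); rewrite cabsN; move: ab ar sep_r; lra.
Qed.

(** Kleitman's argument.  A set [D] of pairwise distant points splits, together
    with its translate by a long vector [d p], into two sets of pairwise distant
    points with one point more and one point less than [D]: the extreme point of
    the translate changes sides. *)
Lemma subset_sums_in_ball (A : {set I}) (D : seq R[i]) : pairwise apart D ->
  (\sum_(S : {set I} | S \subset A)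
     count inball [seq (z + \sum_(p in S) d p)%R | z <- D]
   <= 2 ^ #|A :\: bigs| * chainsum #|A :&: bigs| (size D))%N.
Proof.
have [m] := ubnP #|A|; elim: m A D => // m IH A D Am sepD.
have [->|[p pA]] := set_0Vmem A.
  rewrite (big_pred1 set0) => [|S]; last by rewrite subset0.
  rewrite set0D set0I cards0 expn0 mul1n big_set0.
  under eq_map do rewrite addr0.
  by rewrite map_id; case: D sepD => // a D /count_ball.
have Ap : (#|A :\ p| < m)%N by rewrite -ltnS (leq_trans _ Am)// ltnS [in X in (_ <= X)%N](cardsD1 p) pA.
rewrite (powerset_split _ pA).
have sumU (S : {set I}) : S \subset A :\ p -> \sum_(x in p |: S) d x = d p + \sum_(x in S) d x.
  by rewrite subsetD1 => /andP[_ pS]; rewrite big_setU1.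
case: (boolP (p \in bigs)) => pb.
- have -> : A :\: bigs = (A :\ p) :\: bigs.
    by apply/setP => x; rewrite !inE; case: eqP => // ->; move: pb; rewrite inE => ->.
  have -> : #|A :&: bigs| = #|(A :\ p) :&: bigs|.+1.
    by rewrite (cardsD1 p) !inE pA; move: pb; rewrite inE => ->; congr (_.+1); apply: eq_card => x; rewrite !inE andbA.
  case: (eqVneq D [::]) => [->|D0]; first by rewrite big1.
  have [s sD smax] := seq_argmax (fun z => complex.Re (z * (d p)^*)%C) D0.
  have [D' pD sD'] : exists2 D', perm_eq D (s :: D') & pairwise apart (s :: D').
    move: sepD; case/splitPr: sD => D1 D2 sepD; exists (D1 ++ D2).
      by rewrite -cat1s perm_catCA.
    exact: pairwise_to_front.
  have sz : size D = (size D').+1 by rewrite (perm_size pD).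
  pose D1 := s + d p :: s :: D'; pose D2 := [seq z + d p | z <- D'].
  have sD1 : pairwise apart D1.
    rewrite /D1 pairwise_cons sD' andbT; apply/allP => t tD.
    move: pb; rewrite inE => /le_trans; apply; apply: cabs_extreme; apply: smax.
    by rewrite (perm_mem pD).
  have sD2 : pairwise apart D2.
    move: sD'; rewrite /= => /andP[_]; rewrite /D2 pairwise_map.
    by apply: sub_pairwise => a b /=; rewrite opprD addrACA subrr addr0.
  rewrite sz /= mulnDr.
  have := leq_add (IH _ _ Ap sD1) (IH _ _ Ap sD2).
  rewrite /D2 size_map /= -/D2; apply: leq_trans.
  rewrite -big_split /=; apply: leq_sum => S SA; rewrite sumU//.
  rewrite !(permP (perm_map _ pD)) /= -map_comp.
  set c1 := count _ _; set c2 := count _ _; set c3 := count _ _.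
  have -> : c3 = c2.
    by congr count; apply: eq_map => z /=; rewrite addrA.
  rewrite !addrA.
  set b1 : nat := (_ <= r)%R; set b2 : nat := (cabs (s + _ + _) <= r)%R.
  clearbody b1 b2 c1 c2; clear; lia.
- have -> : A :&: bigs = (A :\ p) :&: bigs.
    by apply/setP => x; rewrite !inE; case: eqP => // ->; move: pb; rewrite inE => /negbTE->; rewrite !andbF.
  have -> : #|A :\: bigs| = #|(A :\ p) :\: bigs|.+1.
    by rewrite (cardsD1 p) !inE pA; move: pb; rewrite inE => ->; congr (_.+1); apply: eq_card => x; rewrite !inE andbCA.
  rewrite big_split /= expnS -mulnA mul2n -addnn leq_add ?IH//.
  rewrite -[size D](size_map (fun z => z + d p)).
  apply: leq_trans (IH _ _ Ap _); last first.
    rewrite pairwise_map; apply: sub_pairwise sepD => a b /=.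
    by rewrite opprD addrACA subrr addr0.
  apply: leq_sum => S SA; rewrite sumU// -map_comp.
  by rewrite (@eq_map _ _ _ ((fun z => z + \sum_(x in S) d x) \o (fun z => z + d p)))// => z /=; rewrite addrA.
Qed.

(** The count is over all subset sums: with [D] reduced to one point in
    [subset_sums_in_ball], at most as many of them lie in a ball as there are
    points in the middle layer of the cube spanned by the long vectors, times
    the number of choices for the short ones. *)
Lemma littlewood_offord (z : R[i]) :
  (\sum_(S : {set I}) (cabs (z + \sum_(p in S) d p) <= r)%R)%:R
  <= 2 ^+ #|I| / Num.sqrt (#|bigs|.+1)%:R :> R.
Proof.
have := @subset_sums_in_ball [set: I] [:: z] isT.
rewrite /= setTD setTI.
under eq_bigl do rewrite subsetT.
under eq_bigr do rewrite addn0.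
set N := (\sum_S _)%N; set g := #|bigs| => H.
rewrite ler_pdivlMr ?sqrtr_gt0 ?ltr0n//.
rewrite -(@ler_pXn2r _ 2) ?nnegrE ?mulr_ge0 ?exprn_ge0 ?sqrtr_ge0//.
rewrite exprMn sqr_sqrtr ?ler0n// (_ : 2 ^+ #|I| = (2 ^ #|I|)%:R); last by rewrite natrX.
rewrite -!natrX -natrM ler_nat.
have e : (#|I| = #|~: bigs| + g)%N by rewrite addnC -(cardsC bigs).
have := chainsum1_sq g; rewrite e expnD; move: H.
rewrite -setTD; set a := (2 ^ #|_ :\: _|)%N; set c := chainsum g 1 => H H2.
rewrite (leq_trans (leq_mul (leq_mul H H) (leqnn _)))// [leqLHS](_ : _ = a ^ 2 * (c ^ 2 * g.+1))%N; last by ring.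
by rewrite expnMn -(expnM 2 g 2) (mulnC g) (expnM 2 2); apply: leq_mul.
Qed.

End LittlewoodOfford.

(** * Small ball probabilities of linear forms *)

Section SmallBall.
Import mathcomp.boot.finset.
Variables (R : realType) (I V : finType) (mu : V -> R) (val : V -> R[i]).
Hypothesis mu_ge0 : forall v, 0 <= mu v.
Hypothesis mu_sum1 : \sum_v mu v = 1.
Variables (c q : R).
Hypothesis q01 : 0 < q <= 1.
Hypothesis spread_val :
  forall z, \sum_v mu v * (cabs (val v - z) < c)%R%:R <= 1 - q.
Variables (w : I -> R[i]) (L : {set I}) (r0 r : R).
Hypothesis r0_gt0 : 0 < r0.
Hypothesis wL : forall p, p \in L -> r0 <= cabs (w p).
Hypothesis r_small : 2 * r < c * r0.
Hypothesis r_ge0 : 0 <= r.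

Notation Om := {ffun I -> V}.
Notation Pr := (Pr mu).
Notation Ex := (Ex mu).
Notation form z := (fun om : Om => cabs (z + \sum_p w p * val (om p)) <= r).

Lemma Pr_coord (p0 : I) (E : V -> bool) :
  Pr (fun om => E (om p0)) = \sum_v mu v * (E v)%:R.
Proof.
pose f (p : I) (v : V) : R := if p == p0 then (E v)%:R else 1.
have -> : Pr (fun om => E (om p0)) = Ex (fun om => \prod_p f p (om p)).
  apply: eq_bigr => om _; congr (_ * _).
  rewrite (bigD1 p0) //= big1 ?mulr1 /f.
    by rewrite eqxx.
  by move=> p /negbTE->.
rewrite (Ex_prod mu f) /f.
rewrite (bigD1 p0) //= [X in _ * X]big1 ?mulr1; first by apply: eq_bigr => v _; rewrite eqxx.
move=> p /negbTE->; rewrite -[RHS]mu_sum1; by apply: eq_bigr => v _; rewrite mulr1.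
Qed.

(** All coordinates are frozen but one with a large weight, which then has to
    fall into a small disc. *)
Lemma small_ball_one z : L != set0 -> Pr (form z) <= 1 - q.
Proof.
case/set0Pn => p0 /wL wp0.
have wn0 : w p0 != 0 by rewrite -cabs_gt0 (lt_le_trans r0_gt0).
apply: (Pr_cond mu_ge0 mu_sum1 (S := ~: [set p0])) => om.
pose z' := z + \sum_(p | p != p0) w p * val (om p).
apply: (le_trans _ (spread_val (- z' / w p0))).
rewrite -(Pr_coord p0 (fun v => cabs (val v - _) < c)).
apply: Pr_le => // om'; rewrite (bigD1 p0) //= ffunE !inE eqxx /=.
rewrite (eq_bigr (fun p => w p * val (om p))); last first.
  by move=> p pp0; rewrite ffunE !inE pp0.
rewrite addrCA -/z' => H.
have e : w p0 * val (om' p0) + z' = w p0 * (val (om' p0) - - z' / w p0).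
  by rewrite mulrBr mulrCA divff// mulr1 opprK.
move: H; rewrite e cabsM => H.
rewrite -(ltr_pM2l r0_gt0) (le_lt_trans (ler_wpM2r (cabs_ge0 _) wp0))//.
by rewrite (le_lt_trans H)//; move: r_small r_ge0; lra.
Qed.

(** A coordinate in [L] moves far from its value in [om'] with probability at
    least [q], by the spread of the atom. The exponential moment of the number
    of such long steps factors over the coordinates, each one in [L]
    contributing at most [1 - q / 2]. *)
Lemma few_long_steps (om' : Om) :
  Ex (fun om => ((1 / 2) ^+ #|[set p | c * r0 <= cabs (w p * (val (om p) - val (om' p)))]|))
  <= (1 - q / 2) ^+ #|L|.
Proof.
pose long p v := c * r0 <= cabs (w p * (val v - val (om' p))).
pose f p v : R := if long p v then 1 / 2 else 1.
have -> : Ex (fun om => (1 / 2) ^+ #|[set p | long p (om p)]|)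
    = Ex (fun om => \prod_p f p (om p)).
  apply: eq_bigr => om _; congr (_ * _); rewrite /f -big_mkcond /= prodr_const.
  by congr (_ ^+ _); apply: eq_card => p; rewrite inE.
rewrite (Ex_prod mu f) -prodr_const [leRHS]big_mkcond /=; apply: ler_prod => p _.
have f01 v : 0 <= f p v <= 1 by rewrite /f; case: ifP; lra.
rewrite sumr_ge0 => [|v _]; last by rewrite mulr_ge0//; have /andP[] := f01 v.
case: ifP => [pL|_]; last first.
  by rewrite -mu_sum1; apply: ler_sum => v _; rewrite ler_piMr//; have /andP[] := f01 v.
apply: (@le_trans _ _ (\sum_v (mu v * (1/2) + mu v * (cabs (val v - val (om' p)) < c)%R%:R * (1/2)))).
  apply: ler_sum => v _; rewrite /f /long cabsM.
  case: (ltP (cabs (val v - val (om' p))) c) => h.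
    by case: ifP => _; rewrite /= ?mulr1n ?mulr1; have := mu_ge0 v; lra.
  have c0 : 0 <= c by move: r_small r_ge0 r0_gt0; nra.
  rewrite ifT /= ?mulr0 ?mul0r ?addr0//.
  by rewrite [leLHS]mulrC; apply: ler_pM; rewrite ?wL ?(ltW r0_gt0).
rewrite big_split /= -!mulr_suml mu_sum1.
by have := spread_val (val (om' p)); lra.
Qed.

(** Exchanging a random set of coordinates between two independent copies
    does not change the law of the form. Given the copies, the form becomes a
    random subset sum, to which [littlewood_offord] applies with the number of
    long steps; this number is below [q #|L| / 4] only with exponentially small
    probability, by [few_long_steps]. *)
Lemma small_ball_many z : L != set0 -> Pr (form z) <= 6 / Num.sqrt (q * #|L|%:R).
Proof.
rewrite -card_gt0 => L0; set m : R := q * _.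
have [q0 q1] := andP q01.
have m0 : 0 < m by rewrite mulr_gt0// ltr0n.
have sm0 : 0 < Num.sqrt m by rewrite sqrtr_gt0.
have [m1|m1] := ltP m 1.
  rewrite (le_trans (Pr_le1 mu_ge0 mu_sum1 _))// ler_pdivlMr// mul1r.
  by apply: (@le_trans _ _ (Num.sqrt 1)); rewrite ?ler_wsqrtr ?(ltW m1)// sqrtr1; lra.
pose d om om' p := w p * (val (om p) - val (om' p)) : R[i].
pose g om om' := #|[set p | c * r0 <= cabs (d om om' p)]|.
(* All sets of exchanged coordinates give the same probability: average. *)
have avg : Pr (form z) <= Ex (fun om' => Ex (fun om => (Num.sqrt (g om om').+1%:R)^-1)).
  have e : Pr (form z) = (2 ^+ #|I|)^-1 * \sum_(S : {set I}) Pr (form z).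
    have cS : #|{: {set I}}| = (2 ^ #|I|)%N.
      rewrite -[in RHS]cardsT -card_powerset -cardsT; apply: eq_card => S.
      by rewrite !inE subsetT.
    rewrite sumr_const cS -(mulr_natl (Pr _)) natrX mulrA mulVf ?mul1r//.
  pose hit (S : {set I}) om om' : nat :=
    (cabs (z + \sum_p w p * val (resample S om om' p)) <= r)%R.
  have {}e : Pr (form z) = Ex (fun om' => Ex (fun om =>
      (2 ^+ #|I|)^-1 * (\sum_(S : {set I}) hit S om om')%:R)).
    rewrite e.
    under eq_bigr => S _ do rewrite /Pr (Ex_resample mu_sum1 S).
    rewrite /Ex mulr_sumr; under eq_bigr do rewrite mulr_sumr.
    rewrite exchange_big /=.
    under eq_bigr do under eq_bigr do rewrite !mulr_sumr.
    under eq_bigr do rewrite exchange_big.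
    rewrite exchange_big /=.
    apply: eq_bigr => om' _; rewrite mulr_sumr; apply: eq_bigr => om _.
    rewrite natr_sum !mulr_sumr; apply: eq_bigr => S _.
    by rewrite /hit; ring.
  rewrite e; apply: Ex_le => // om'; apply: Ex_le => // om.
  rewrite mulrC ler_pdivrMr ?exprn_gt0// mulrC.
  have -> : (\sum_(S : {set I}) hit S om om' = \sum_(S : {set I})
      (cabs ((z + \sum_p w p * val (om' p)) + \sum_(p in S) d om om' p) <= r)%R)%N.
    apply: eq_bigr => S _; rewrite /hit -addrA; congr (nat_of_bool (cabs (_ + _) <= r)).
    rewrite [X in _ = _ + X]big_mkcond -big_split /=; apply: eq_bigr => p _.
    by rewrite ffunE /d; case: ifP => _; ring.
  exact: littlewood_offord.
apply: (le_trans avg); rewrite -[leRHS](Ex_cst I mu_sum1); apply: Ex_le => // om'.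
pose t := Num.truncn (m / 4).
have tm : t%:R <= m / 4 by rewrite truncn_le ?divr_ge0 ?ltW.
apply: (@le_trans _ _ (2 / Num.sqrt m + 2 ^+ t * (1 - q / 2) ^+ #|L|)).
  apply: (@le_trans _ _ (Ex (fun om => 2 / Num.sqrt m + 2 ^+ t * (1 / 2) ^+ g om om'))); last first.
    rewrite /Ex; under eq_bigr do rewrite mulrDr.
    rewrite big_split /= -[X in _ <= X + _](Ex_cst I mu_sum1) lerD2l.
    under eq_bigr do rewrite mulrCA.
    rewrite -mulr_sumr ler_wpM2l ?exprn_ge0//; exact: few_long_steps.
  apply: Ex_le => // om.
  have [gt|tg] := leqP (g om om') t.
    rewrite (@le_trans _ _ 1)//.
      by rewrite invf_le1 ?sqrtr_gt0 ?ltr0n// -[leLHS]sqrtr1 ler_wsqrtr// ler1n.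
    apply: ler_wpDl; first by rewrite divr_ge0 ?ltW.
    rewrite -(subnKC gt) exprD mulrAC -exprMn (_ : 2 * (1 / 2) = 1); last by lra.
    by rewrite expr1n mul1r exprn_ege1// ler1n.
  apply: ler_wpDr; first by rewrite mulr_ge0 ?exprn_ge0//; lra.
  have lt : m / 4 < (g om om').+1%:R.
    by rewrite (lt_le_trans (truncnS_gt _))// ler_nat ltnS ltnW.
  rewrite -[leRHS]invrK invf_div lef_pV2 ?posrE ?sqrtr_gt0 ?ltr0n ?divr_gt0//.
  rewrite (_ : Num.sqrt m / 2 = Num.sqrt (m / 4)) ?ler_wsqrtr ?ltW//.
  rewrite (_ : m / 4 = (Num.sqrt m / 2) ^+ 2).
    by rewrite sqrtr_sqr ger0_norm// divr_ge0// ltW.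
  by rewrite expr_div_n sqr_sqrtr ?ltW//; lra.
suff : 2 ^+ t * (1 - q / 2) ^+ #|L| <= 4 / Num.sqrt m.
  rewrite (_ : 6 / Num.sqrt m = 2 / Num.sqrt m + 4 / Num.sqrt m) ?lerD2l//.
  by rewrite -mulrDl; congr (_ / _); lra.
apply: (@le_trans _ _ (expR (m / 4) * expR (- (m / 2)))).
  apply: ler_pM; rewrite ?exprn_ge0//; try lra.
    apply: (@le_trans _ _ (expR 1 ^+ t)).
      by rewrite lerXn2r ?nnegrE ?expR_ge0// (le_trans _ (expR_ge1Dx _)).
    by rewrite -expRM_natl mulr1 ler_expR.
  apply: (@le_trans _ _ (expR (- (q / 2)) ^+ #|L|)).
    by rewrite lerXn2r ?nnegrE ?expR_ge0 ?expR_ge1Dx//; lra.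
  rewrite -expRM_natl ler_expR /m; lra.
rewrite -expRD (_ : m / 4 - m / 2 = - (m / 4)); last by lra.
rewrite expRN; apply: (@le_trans _ _ (m / 4)^-1).
  rewrite lef_pV2 ?posrE ?expR_gt0 ?divr_gt0//.
  by rewrite (le_trans _ (expR_ge1Dx _))// lerDr.
rewrite invf_div ler_wpM2l// lef_pV2 ?posrE//.
have s1 : 1 <= Num.sqrt m.
  by apply: (@le_trans _ _ (Num.sqrt 1)); rewrite ?ler_wsqrtr// sqrtr1.
have : Num.sqrt m ^+ 2 = m by rewrite sqr_sqrtr ?ltW.
by move: s1; nra.
Qed.

End SmallBall.

(** * Almost null vectors and kernels of few rows *)

Section SupNorm.
Variable R : realType.
Notation C := R[i].

Definition supn n (y : 'cV[C]_n) : R := \big[Num.max/0]_j cabs (y j 0).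

Lemma supn_ge n (y : 'cV[C]_n) j : cabs (y j 0) <= supn y.
Proof. exact: (@le_bigmax _ R _ 0 (fun j => cabs (y j 0))). Qed.

Lemma supn_ge0 n (y : 'cV[C]_n) : 0 <= supn y.
Proof. by apply: bigmax_ge_id. Qed.

Lemma supn_le n (y : 'cV[C]_n) c :
  0 <= c -> (forall j, cabs (y j 0) <= c) -> supn y <= c.
Proof. by move=> c0 yc; apply/bigmax_leP; split=> // j _. Qed.

Lemma supn_attained n (y : 'cV[C]_n) : y != 0 ->
  exists j, cabs (y j 0) = supn y.
Proof.
case/cV0Pn => j0 yj0.
exists [arg max_(j > j0) cabs (y j 0)]%O.
by rewrite /supn (@bigmax_eq_arg _ _ _ _ j0)// => j _; exact: cabs_ge0.
Qed.

Lemma supn_gt0 n (y : 'cV[C]_n) : y != 0 -> 0 < supn y.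
Proof.
case/cV0Pn => j0 yj0; apply: lt_le_trans (supn_ge y j0).
by rewrite cabs_gt0.
Qed.

Lemma supnD n (y z : 'cV[C]_n) : supn (y + z) <= supn y + supn z.
Proof.
apply: supn_le => [|j]; first by rewrite addr_ge0 ?supn_ge0.
by rewrite mxE (le_trans (cabsD _ _))// lerD ?supn_ge.
Qed.

Lemma supn0 n : supn (0 : 'cV[C]_n) = 0.
Proof.
apply/le_anti; rewrite supn_ge0 andbT.
by apply: supn_le => // j; rewrite mxE cabs0.
Qed.

Lemma supnZ n a (y : 'cV[C]_n) : supn (a *: y) = cabs a * supn y.
Proof.
case: (eqVneq y 0) => [->|y0].
  by rewrite scaler0 supn0 mulr0.
apply/le_anti/andP; split.
  apply: supn_le => [|j]; first by rewrite mulr_ge0 ?cabs_ge0 ?supn_ge0.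
  by rewrite mxE cabsM ler_wpM2l ?cabs_ge0 ?supn_ge.
have [j <-] := supn_attained y0.
by rewrite -cabsM; have := supn_ge (a *: y) j; rewrite mxE.
Qed.

Lemma supn_mulmx m n (A : 'M[C]_(m, n)) (y : 'cV[C]_n) T :
  0 <= T -> (forall i j, cabs (A i j) <= T) -> supn (A *m y) <= n%:R * T * supn y.
Proof.
move=> T0 AT; apply: supn_le => [|i]; first by rewrite !mulr_ge0 ?supn_ge0.
rewrite mxE (le_trans (cabs_sum _ _ _))//.
apply: (@le_trans _ _ (\sum_(j < n) T * supn y)).
  by apply: ler_sum => j _; rewrite cabsM ler_pM ?cabs_ge0 ?supn_ge.
by rewrite sumr_const card_ord -[leLHS]mulr_natl mulrA.
Qed.

End SupNorm.

Section ThinKernel.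
Import mathcomp.boot.finset.
Variables (R : realType) (n : nat).
Notation C := R[i].
Implicit Types (J S : {set 'I_n}) (x y z : 'cV[C]_n) (M : 'M[C]_n).

Definition supported J x := forall j, j \notin J -> x j 0 = 0.

(** Up to scaling, a vector of this kind is a function of [J] and of the rows
    [S] of [M], and so is independent of the other rows when [M] is random. *)
Definition spans_kernel M S J y :=
  [/\ supported J y, forall i, i \in S -> (M *m y) i 0 = 0 &
    forall z, supported J z -> (forall i, i \in S -> (M *m z) i 0 = 0) ->
      exists c, z = c *: y].

Section Columns.
Variables (M : 'M[C]_n) (J : {set 'I_n}).
Notation g := (fun t : 'I_#|J| => enum_val t).
Notation P := (colsub g (1%:M : 'M[C]_n)).

Lemma embed_val (u : 'cV[C]_#|J|) t : (P *m u) (g t) 0 = u t 0.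
Proof.
rewrite mxE (bigD1 t) //= !mxE eqxx mul1r big1 ?addr0// => s st.
by rewrite !mxE (inj_eq enum_val_inj) eq_sym (negbTE st) mul0r.
Qed.

Lemma embed_supported (u : 'cV[C]_#|J|) : supported J (P *m u).
Proof.
move=> j jJ; rewrite mxE big1// => t _; rewrite !mxE; case: eqP => [e|]; last by rewrite mul0r.
by rewrite e enum_valP in jJ.
Qed.

Lemma supported_embed x : supported J x -> x = P *m rowsub g x.
Proof.
move=> xJ; apply/colP => j; have [jJ|jJ] := boolP (j \in J).
  by rewrite -(enum_rankK_in jJ jJ) embed_val mxE.
by rewrite xJ// embed_supported.
Qed.

Lemma mul_embed (u : 'cV[C]_#|J|) : M *m (P *m u) = colsub g M *m u.
Proof. by rewrite mulmxA mulmx_colsub mulmx1. Qed.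

Definition minor (f : 'I_#|J| -> 'I_n) := rowsub f (colsub g M).

Lemma minor_mul f (u : 'cV[C]_#|J|) : minor f *m u = rowsub f (M *m (P *m u)).
Proof. by rewrite mul_embed mul_rowsub_mx. Qed.

Lemma injective_minor :
  (forall z, supported J z -> M *m z = 0 -> z = 0) ->
  exists f, \det (minor f) != 0.
Proof.
move=> inj.
have full : row_full (colsub g M).
  rewrite /row_full -mxrank_tr; apply: inj_row_free => v v0.
  apply: trmx_inj; rewrite trmx0.
  have : P *m v^T = 0.
      apply: inj; first exact: embed_supported.
      by rewrite mul_embed -[_ *m _]trmxK trmx_mul trmxK v0 trmx0.
  move=> Pv; apply/colP => t; rewrite -embed_val Pv !mxE//.
exists (fullrankfun full).
by rewrite -unitfE -[_ \is a GRing.unit]/(_ \in unitmx) fullrowsub_unit.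
Qed.

End Columns.

(** If [M] is injective on the span of [J], a maximal minor of these columns
    does the job: the columns of its adjugate are kernel vectors, their images
    are again minors, hence bounded by the maximal one, and Cramer's rule bounds
    the latter in terms of the image of [x]. *)
Lemma thin_kernel_injective M J x (t : R) : x != 0 -> supported J x ->
  0 <= t -> supn (M *m x) <= t * supn x ->
  (forall z, supported J z -> M *m z = 0 -> z = 0) ->
  exists S y, [/\ (#|S| < #|J|)%N, y != 0,
    spans_kernel M S J y & supn (M *m y) <= #|J|%:R * t * supn y].
Proof.
move=> x0 xJ t0 Mx inj.
have [f0 f0M] := injective_minor inj.
pose det (f : {ffun 'I_#|J| -> 'I_n}) := cabs (\det (minor M f)).
have [f fmax] : exists f, forall f', det f' <= det f.
  exists [arg max_(f > [ffun a => f0 a]) det f]%O.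
  by case: arg_maxP => // f _ fmax f'; exact: fmax.
pose N := minor M f.
have N0 : \det N != 0.
  rewrite -cabs_gt0 (lt_le_trans _ (fmax [ffun a => f0 a]))// cabs_gt0.
  rewrite (_ : minor _ _ = minor M f0)//.
  by apply/matrixP => a b; rewrite !mxE ffunE.
pose g (a : 'I_#|J|) : 'I_n := enum_val a.
pose P := colsub g (1%:M : 'M[C]_n).
pose x' := rowsub g x.
have xP : x = P *m x' by exact: supported_embed.
have [j xj] := supn_attained x0.
have jJ : j \in J.
  apply: contraTT (supn_gt0 x0) => /xJ e; rewrite -xj e cabs0.
  by rewrite ltxx.
pose t0' := enum_rank_in jJ j.
have gt0' : g t0' = j by rewrite /g enum_rankK_in.
have [l0 l0max] : exists l0, forall l, cabs (\adj N t0' l) <= cabs (\adj N t0' l0).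
  exists [arg max_(l > t0') cabs (\adj N t0' l)]%O.
  by case: arg_maxP => // l _ lmax l'; exact: lmax.
pose y' := col l0 (\adj N).
pose y := P *m y'.
have yg a : y (g a) 0 = \adj N a l0 by rewrite embed_val mxE.
have detle : cabs (\det N) <= #|J|%:R * t * supn y.
  have Nx : \adj N *m (N *m x') = \det N *: x'.
    by rewrite mulmxA mul_adj_mx mul_scalar_mx.
  have e : cabs (\det N) * supn x = cabs ((\adj N *m (N *m x')) t0' 0).
    by rewrite Nx mxE cabsM /x' !mxE gt0' xj.
  rewrite -(ler_pM2r (supn_gt0 x0)) e mxE (le_trans (cabs_sum _ _ _))//.
  apply: (@le_trans _ _ (\sum_(l < #|J|) supn y * (t * supn x))).
    apply: ler_sum => l _; rewrite cabsM ler_pM ?cabs_ge0//.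
      by rewrite (le_trans (l0max l))// -yg supn_ge.
    rewrite minor_mul -xP mxE (le_trans _ Mx)//; exact: supn_ge.
  rewrite sumr_const card_ord -[leLHS]mulr_natl le_eqVlt; apply/orP; left; apply/eqP; ring.
have My i : (M *m y) i 0 = \det (minor M (finfun (fun l => if l == l0 then i else f l))).
  rewrite mul_embed (expand_det_row _ l0) mxE; apply: eq_bigr => a _.
  rewrite !mxE ffunE eqxx; congr (_ * _).
  rewrite /cofactor; congr (_ * \det _); apply/matrixP => b c.
  by rewrite !mxE ffunE eq_sym (negbTE (neq_lift _ _)).
exists (f @: [set~ l0]), y; split.
- rewrite (leq_ltn_trans (leq_imset_card _ _))// cardsC1 card_ord.
  by rewrite prednK ?leqnn// (leq_ltn_trans _ (ltn_ord l0)).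
- apply: contraNneq N0 => y0; rewrite -cabs_eq0; apply/eqP/le_anti.
  rewrite cabs_ge0 andbT (le_trans detle)//.
  by rewrite y0 supn0 mulr0.
- split.
  + exact: embed_supported.
  + move=> i /imsetP[l]; rewrite !inE => ll0 ->.
    have := congr1 (fun A : 'M[C]_(#|J|) => A l l0) (mul_mx_adj N).
    rewrite [RHS]mxE (negbTE ll0) mulr0n mxE => <-.
    rewrite mul_embed mxE; apply: eq_bigr => a _; rewrite !mxE//.
  + move=> z zJ Mz; pose z' := rowsub g z.
    have zP : z = P *m z' by exact: supported_embed.
    exists ((N *m z') l0 0 / \det N); rewrite zP scalemxAr; congr (_ *m _).
    apply: (scalerI N0); rewrite scalerA mulrCA divff// mulr1.
    rewrite -mul_scalar_mx -mul_adj_mx -mulmxA; apply/colP => a.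
    rewrite mxE (bigD1 l0) //= big1 ?addr0.
      by rewrite !mxE mulrC.
    move=> l ll0; rewrite minor_mul -zP [in X in _ * X]mxE Mz ?mulr0//.
    by apply/imsetP; exists l; rewrite ?inE.
- apply: supn_le => [|i]; last by rewrite My (le_trans (fmax _)).
  by rewrite mulr_ge0 ?supn_ge0// mulr_ge0.
Qed.

(** A kernel vector of minimal support is, up to scaling, the only one with
    that support. On the support less one point [M] is injective, so that a
    nonzero minor there singles out the rows [S]. *)
Lemma thin_kernel_singular M J z0 : z0 != 0 -> supported J z0 -> M *m z0 = 0 ->
  exists S J' y, [/\ J' \subset J, (#|S| < #|J|)%N, y != 0,
    spans_kernel M S J' y & M *m y = 0].
Proof.
move=> z00 z0J Mz0.
pose bad (K : {set 'I_n}) := `[< K \subset J /\ exists z, [/\ z != 0, supported K z & M *m z = 0] >].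
have [J1 /asboolP[J1J [y [y0 yJ1 My]]] J1min] : exists2 K, bad K & forall K', bad K' -> (#|K| <= #|K'|)%N.
  have badJ : bad J by apply/asboolP; split=> //; exists z0.
  by case: (arg_minnP (fun K : {set 'I_n} => #|K|) badJ) => K bK Kmin; exists K.
have [j0 yj0] := cV0Pn _ y0.
have j0J : j0 \in J1 by apply: contraNT yj0 => /yJ1->.
have J2inj z : supported (J1 :\ j0) z -> M *m z = 0 -> z = 0.
  move=> zJ Mz; apply/eqP; apply: contraT => zn0.
  have : bad (J1 :\ j0).
    apply/asboolP; split; last by exists z.
    by rewrite (fintype.subset_trans _ J1J)// subsetDl.
  by move/J1min; rewrite (cardsD1 j0) j0J ltnn.
have [f fN] := injective_minor J2inj.
exists (f @: setT), J1, y; split=> //.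
  rewrite (leq_ltn_trans (leq_imset_card _ _))// cardsT card_ord.
  by rewrite (leq_trans _ (subset_leq_card J1J))// [in X in (_ < X)%N](cardsD1 j0) j0J.
split=> //; first by move=> i _; rewrite My mxE.
move=> z zJ Mz; exists (z j0 0 / y j0 0).
apply/eqP; rewrite -subr_eq0; set v := z - _.
have vJ : supported (J1 :\ j0) v.
  move=> j; rewrite !inE negb_and negbK => /orP[/eqP->|jJ].
    by rewrite !mxE divfK// subrr.
  by rewrite !mxE (zJ _ jJ) (yJ1 _ jJ) mulr0 subrr.
rewrite (supported_embed vJ); set v' := rowsub _ _.
suff -> : v' = 0 by rewrite mulmx0.
have : minor M f *m v' = 0.
  rewrite minor_mul -(supported_embed vJ); apply/colP => a.
  rewrite mulmxBr -scalemxAr My scaler0 subr0 !mxE.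
  by have := Mz (f a); rewrite mxE; apply; apply: imset_f.
move/(congr1 (mulmx (\adj (minor M f)))).
rewrite mulmxA mul_adj_mx mul_scalar_mx mulmx0 => /eqP.
by rewrite scaler_eq0 (negbTE fN) => /eqP.
Qed.

(** This takes the place of a net argument. An almost null vector supported on
    a small set can be traded, at the cost of a factor [#|J|], for one that
    belongs to a family indexed by pairs of small sets and whose member is
    determined by few rows. *)
Lemma thin_kernel M J x (t : R) : x != 0 -> supported J x ->
  supn (M *m x) <= t * supn x ->
  exists S J' y, [/\ J' \subset J, (#|S| < #|J|)%N, y != 0,
    spans_kernel M S J' y & supn (M *m y) <= #|J|%:R * t * supn y].
Proof.
move=> x0 xJ Mx.
have t0 : 0 <= t.
  by have := le_trans (supn_ge0 _) Mx; rewrite pmulr_lge0// supn_gt0.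
have [inj|/existsNP[z /not_implyP[zJ /not_implyP[Mz /eqP z0]]]] :=
  pselect (forall z, supported J z -> M *m z = 0 -> z = 0).
  have [S [y [cS y0 yS My]]] := thin_kernel_injective x0 xJ t0 Mx inj.
  by exists S, J, y.
have [S [J' [y [J'J cS y0 yS My]]]] := thin_kernel_singular z0 zJ Mz.
exists S, J', y; split=> //; rewrite My supn0.
by rewrite !mulr_ge0 ?supn_ge0.
Qed.

End ThinKernel.

(** * Improving robustness *)

Section RandomMatrix.
Import mathcomp.boot.finset.
Variables (R : realType) (n : nat) (I V : finType) (mu : V -> R) (val : V -> R[i]).
Hypothesis mu_ge0 : forall v, 0 <= mu v.
Hypothesis mu_sum1 : \sum_v mu v = 1.
(** The entry in position [(i, j)] is driven by the coordinate [phi i j], and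
    [rw] recovers its row; this covers a random matrix and its transpose. *)
Variables (phi : 'I_n -> 'I_n -> I) (rw : I -> 'I_n).
Hypothesis rwE : forall i j, rw (phi i j) = i.
Hypothesis phi_inj : forall i, injective (phi i).
Variables (al : 'I_n -> 'I_n -> R) (b : 'M[R[i]]_n).
Variables (c sigma : R).
Hypothesis sigma_gt0 : 0 < sigma.

Notation C := R[i].
Notation Om := {ffun I -> V}.
Notation Pr := (Pr mu).

Definition rmx (om : Om) : 'M[C]_n :=
  \matrix_(i, j) ((al i j)%:C%C * val (om (phi i j)) + b i j).

Definition nbr i : {set 'I_n} := [set j | sigma <= al i j].

Definition big_coords rho (y : 'cV[C]_n) : {set 'I_n} :=
  [set j | rho * supn y <= cabs (y j 0)].

(** No almost null vector is compressible: this is the property that the proof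
    improves step by step, from one large coordinate to almost all of them. *)
Definition robust tau rho m (M : 'M[C]_n) : bool :=
  `[< forall y : 'cV[C]_n, y != 0 -> supn (M *m y) <= tau * supn y ->
      (m <= #|big_coords rho y|)%N >].

Definition entries_le T (M : 'M[C]_n) : bool :=
  [forall i, forall j, cabs (M i j) <= T].

Definition small_ball_bound m0 p := forall (w : I -> C) (L : {set I}) r0 r z,
  0 < r0 -> (forall i, i \in L -> r0 <= cabs (w i)) -> 2 * r < c * r0 -> 0 <= r ->
  (m0 <= #|L|)%N ->
  Pr (fun om => cabs (z + \sum_i w i * val (om i)) <= r) <= p.

Definition rich_rows m0 (L : {set 'I_n}) : {set 'I_n} :=
  [set i | (m0 <= #|L :&: nbr i|)%N].

Section FixedVector.
Variables (m0 : nat) (p rho tau : R) (y : 'cV[C]_n).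
Hypothesis sbb : small_ball_bound m0 p.
Hypothesis p01 : 0 <= p <= 1.
Hypothesis rho_gt0 : 0 < rho.
Hypothesis tau_ge0 : 0 <= tau.
Hypothesis tau_small : 2 * tau < c * sigma * rho.
Hypothesis y0 : y != 0.

(** Collecting the entries driven by the same coordinate, row [i] of the image
    is a linear form in the coordinates, with large weights at the large
    coordinates of [y] that are neighbours of [i]. *)
Lemma row_event i : i \in rich_rows m0 (big_coords rho y) ->
  Pr (fun om => cabs ((rmx om *m y) i 0) <= tau * supn y) <= p.
Proof.
rewrite inE => Li; have sy := supn_gt0 y0.
pose w k := \sum_(j | phi i j == k) (al i j)%:C%C * y j 0.
have wphi j : w (phi i j) = (al i j)%:C%C * y j 0.
  rewrite /w (big_pred1 j)// => j'; exact: inj_eq.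
pose L := phi i @: (big_coords rho y :&: nbr i).
apply: (le_trans _ (@sbb w L (sigma * (rho * supn y)) (tau * supn y)
  (\sum_j b i j * y j 0) _ _ _ _ _)).
- apply: Pr_le => // om; rewrite mxE.
  under eq_bigr do rewrite mxE mulrDl.
  rewrite big_split /= addrC; congr (is_true (cabs (_ + _) <= _)).
  rewrite (partition_big (phi i) xpredT) //=; apply: eq_bigr => k _.
  by rewrite /w mulr_suml; apply: eq_bigr => j /eqP->; rewrite mulrAC.
- by rewrite !mulr_gt0.
- move=> k /imsetP[j]; rewrite !inE => /andP[yj alj] ->.
  rewrite wphi cabsM cabs_real ger0_norm; last by rewrite (le_trans _ alj)// ltW.
  by rewrite ler_pM// ?ltW// mulr_gt0.
- by rewrite !mulrA ltr_pM2r.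
- by rewrite mulr_ge0// ltW.
- by rewrite card_imset//; exact: phi_inj.
Qed.

Lemma rows_event (G : {set 'I_n}) : G \subset rich_rows m0 (big_coords rho y) ->
  Pr (fun om => [forall (i | i \in G), cabs ((rmx om *m y) i 0) <= tau * supn y])
  <= p ^+ #|G|.
Proof.
have [p0 p1] := andP p01.
move=> GL; apply: (Pr_blocks mu_ge0 mu_sum1 (blk := rw)) => //.
  move=> i om om' iG ee; congr (cabs _ <= _); rewrite !mxE.
  by apply: eq_bigr => j _; rewrite !mxE ee ?rwE.
by move=> i /(fintype.subsetP GL); exact: row_event.
Qed.

End FixedVector.

(** Conditionally on the rows in [S] the vector is fixed, and the rich rows
    outside [S] are independent of it and of each other. *)
Lemma kernel_event m m0 G p rho tau (S : {set 'I_n}) (Y : 'M[C]_n -> 'cV[C]_n) :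
  small_ball_bound m0 p -> 0 <= p <= 1 -> 0 < rho -> 0 <= tau ->
  2 * tau < c * sigma * rho ->
  (forall L : {set 'I_n}, (m <= #|L| -> G <= #|rich_rows m0 L|)%N) ->
  (forall M M' : 'M[C]_n, (forall i j, i \in S -> M i j = M' i j) -> Y M = Y M') ->
  Pr (fun om => let M := rmx om in let y := Y M in
    [&& y != 0, (m <= #|big_coords rho y|)%N & supn (M *m y) <= tau * supn y])
  <= p ^+ (G - #|S|).
Proof.
move=> sbb p01 rho0 tau0 taus rich YS.
have [p0 p1] := andP p01.
apply: (Pr_cond mu_ge0 mu_sum1 (S := [set k | rw k \in S])) => om /=.
set y := Y (rmx om).
have Ye om' : Y (rmx (resample [set k | rw k \in S] om om')) = y.
  by apply: YS => i j iS; rewrite !mxE ffunE inE rwE iS.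
pose ok := (y != 0) && (m <= #|big_coords rho y|)%N.
case: (boolP ok) => [/andP[yn0 /rich Gr]|nok]; last first.
  apply: (@le_trans _ _ (Pr (fun=> false))); last first.
    by rewrite /Pr Ex_cst ?exprn_ge0.
  apply: Pr_le => // om'; rewrite Ye andbA => /andP[].
  by rewrite -/ok (negbTE nok).
pose Gd := rich_rows m0 (big_coords rho y) :\: S.
apply: (@le_trans _ _ (p ^+ #|Gd|)); last first.
  rewrite ler_wiXn2l//.
  rewrite leq_subLR (leq_trans Gr)// -(cardsID S) leq_add2r subset_leq_card//.
  exact: subsetIr.
have GL : Gd \subset rich_rows m0 (big_coords rho y) by apply: subsetDl.
apply: le_trans (rows_event sbb p01 rho0 tau0 taus yn0 GL).
apply: Pr_le => // om'; rewrite Ye => /and3P[_ _ My].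
apply/forallP => i; apply/implyP; rewrite inE => /andP[iS _].
apply: le_trans My; apply: le_trans (supn_ge _ i).
rewrite !mxE le_eqVlt; apply/orP; left; apply/eqP; congr cabs; apply: eq_bigr => j _.
by rewrite !mxE ffunE inE rwE (negbTE iS).
Qed.

Definition few_subsets k := #|[set S : {set 'I_n} | (#|S| <= k)%N]|.

(** The vector is picked by [xget], which sees the rows in [S] only through the
    set of candidates; see [kernel_vector_rows]. *)
Definition kernel_vector (S J : {set 'I_n}) (M : 'M[C]_n) : 'cV[C]_n :=
  xget 0 [set y | y != 0 /\ spans_kernel M S J y]%classic.

Lemma kernel_vector_rows (S J : {set 'I_n}) (M M' : 'M[C]_n) :
  (forall i j, i \in S -> M i j = M' i j) ->
  kernel_vector S J M = kernel_vector S J M'.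
Proof.
move=> MM'; rewrite /kernel_vector; congr xget; apply/funext => y; apply/propext => /=.
have e i z : i \in S -> (M *m z) i 0 = (M' *m z) i 0.
  by move=> iS; rewrite !mxE; apply: eq_bigr => j _; rewrite MM'.
split=> -[y0 [yJ yS yu]]; split=> //; split=> //.
- by move=> i iS; rewrite -e ?yS.
- by move=> z zJ zS; apply: yu => // i iS; rewrite e ?zS.
- by move=> i iS; rewrite e ?yS.
- by move=> z zJ zS; apply: yu => // i iS; rewrite -e ?zS.
Qed.

Lemma supn_scale_le (M : 'M[C]_n) y a t :
  supn (M *m y) <= t * supn y -> supn (M *m (a *: y)) <= t * supn (a *: y).
Proof.
by move=> My; rewrite -scalemxAr !supnZ mulrCA ler_wpM2l ?cabs_ge0.
Qed.

(** Discarding the coordinates of relative size below [rho] moves the image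
    by at most [n T rho]. *)
Lemma truncate_vector (M : 'M[C]_n) (x : 'cV[C]_n) T rho t :
  0 <= T -> entries_le T M -> 0 <= rho <= 1 -> x != 0 ->
  supn (M *m x) <= t * supn x ->
  exists x', [/\ x' != 0, supported (big_coords rho x) x' &
    supn (M *m x') <= (t + n%:R * T * rho) * supn x'].
Proof.
move=> T0 /forallP MT /andP[rho0 rho1] x0 Mx.
pose J := big_coords rho x.
pose x' : 'cV[C]_n := \col_j (if j \in J then x j 0 else 0).
have [j xj] := supn_attained x0.
have jJ : j \in J by rewrite inE xj ler_piMl// supn_ge0.
have sx' : supn x' = supn x.
  apply/le_anti/andP; split.
    apply: supn_le => [|i]; first exact: supn_ge0.
    by rewrite mxE; case: ifP => _; rewrite ?supn_ge// cabs0 supn_ge0.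
  by have := supn_ge x' j; rewrite mxE jJ xj.
exists x'; split.
- by apply: contraTneq (supn_gt0 x0) => e; rewrite -sx' e supn0 ltxx.
- by move=> i iJ; rewrite mxE (negbTE iJ).
have -> : M *m x' = M *m x + M *m (x' - x) by rewrite -mulmxDr addrCA subrr addr0.
rewrite (le_trans (supnD _ _))// mulrDl sx' lerD//.
rewrite (le_trans (supn_mulmx (T := T) _ _ _))//.
  by move=> i k; have /forallP := MT i; apply.
rewrite -[leRHS]mulrA ler_wpM2l ?mulr_ge0//.
apply: supn_le => [|i]; first by rewrite mulr_ge0 ?supn_ge0.
rewrite !mxE; case: ifPn => iJ; first by rewrite subrr cabs0 mulr_ge0 ?supn_ge0.
by rewrite sub0r cabsN ltW//; move: iJ; rewrite inE -ltNge.
Qed.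

(** If robustness fails at the finer scale, truncation gives an almost null
    vector with small support and [thin_kernel] replaces it by the kernel
    vector of a pair of small sets. Robustness at the coarser scale gives that
    vector [m] large coordinates, hence at least [G] rich rows, of which at most [k]
    are used up in its definition. The bound is a union bound over the pairs. *)
Lemma robust_step m m0 G k p T rho tau rho' tau' :
  small_ball_bound m0 p -> 0 <= p <= 1 -> 0 < rho -> 0 <= tau ->
  2 * tau < c * sigma * rho ->
  (forall L : {set 'I_n}, (m <= #|L| -> G <= #|rich_rows m0 L|)%N) ->
  0 <= T -> 0 <= rho' <= 1 -> n%:R * (tau' + n%:R * T * rho') <= tau ->
  Pr (fun om => [&& entries_le T (rmx om), robust tau rho m (rmx om) &
                   ~~ robust tau' rho' k.+1 (rmx om)])
  <= (few_subsets k)%:R ^+ 2 * p ^+ (G - k).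
Proof.
move=> sbb p01 rho0 tau0 taus rich T0 rho'01 tt.
have [p0 p1] := andP p01.
pose ev (SJ : {set 'I_n} * {set 'I_n}) om := let M := rmx om in
  let y := kernel_vector SJ.1 SJ.2 M in
  [&& y != 0, (m <= #|big_coords rho y|)%N & supn (M *m y) <= tau * supn y].
pose sm (SJ : {set 'I_n} * {set 'I_n}) := (#|SJ.1| <= k)%N && (#|SJ.2| <= k)%N.
apply: (@le_trans _ _ (Pr (fun om => [exists (SJ | sm SJ), ev SJ om]))).
  apply: Pr_le => // om; set M := rmx om => /and3P[MT /asboolP rob].
  move=> /asboolPn/existsNP[x /not_implyP[x0 /not_implyP[Mx /negP]]].
  rewrite -ltnNge ltnS => cJ.
  have [x' [x'0 x'J Mx']] := truncate_vector T0 MT rho'01 x0 Mx.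
  have [S [J' [y [J'J cS y0 yS My]]]] := thin_kernel x'0 x'J Mx'.
  apply/existsP; exists (S, J'); apply/andP; split.
    by rewrite /sm /= (leq_trans (ltnW cS) cJ) (leq_trans (subset_leq_card J'J) cJ).
  have [z0 [zJ zS zu]] : kernel_vector S J' M != 0 /\ spans_kernel M S J' (kernel_vector S J' M).
    by have := @xgetPex _ (0 : 'cV[C]_n) [set y | y != 0 /\ spans_kernel M S J' y]%classic; apply; exists y.
  rewrite /ev /= -/M z0 /=; set z := kernel_vector S J' M in z0 zJ zS zu *.
  have [_ _ yu] := yS; have [a za] := yu z zJ zS.
  have Mz : supn (M *m z) <= tau * supn z.
    rewrite za; apply: supn_scale_le; rewrite (le_trans My)//.
    rewrite ler_wpM2r ?supn_ge0// (le_trans _ tt)// ler_wpM2r//.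
      by have := le_trans (supn_ge0 _) Mx'; rewrite pmulr_lge0// supn_gt0.
    by rewrite ler_nat -[X in (_ <= X)%N]card_ord max_card.
  by rewrite Mz andbT rob.
apply: (le_trans (Pr_exists mu_ge0 _ _)).
apply: (@le_trans _ _ (\sum_(SJ | sm SJ) p ^+ (G - k))).
  apply: ler_sum => -[S J] /andP[/= cS cJ].
  apply: (le_trans (kernel_event (m := m) (S := S) (Y := kernel_vector S J)
    sbb p01 rho0 tau0 taus rich _)).
    exact: kernel_vector_rows.
  by rewrite ler_wiXn2l// leq_sub2l.
rewrite sumr_const -[leLHS]mulr_natl -natrX ler_wpM2r ?exprn_ge0// ler_nat.
rewrite -mulnn /few_subsets -cardsX subset_leq_card//.
by apply/fintype.subsetP => -[S J]; rewrite !inE.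
Qed.

End RandomMatrix.

(** * From normals of rows to almost singular matrices *)

Section SingularDirection.
Import mathcomp.boot.finset.
Variables (R : realType) (n : nat).
Notation C := R[i].
Implicit Types M : 'M[C]_n.

Definition almost_singular tau M : bool :=
  `[< exists2 x : 'cV[C]_n, x != 0 & supn (M *m x) <= tau * supn x >].

(** The inverse of [M], if it exists, is large; a row of it containing a large
    entry is an almost null vector of the transpose. *)
Lemma almost_singular_tr M tau :
  almost_singular tau M -> almost_singular (n%:R * tau) M^T.
Proof.
move=> /asboolP[x x0 Mx]; apply/asboolP.
have t0 : 0 <= tau.
  by have := le_trans (supn_ge0 _) Mx; rewrite pmulr_lge0// supn_gt0.
have [uM|] := boolP (M \in unitmx); last first.
  rewrite unitmxE unitfE negbK => /det0P[v v0 vM]; exists v^T.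
    by apply: contraNneq v0 => /(congr1 trmx); rewrite trmxK trmx0 => ->.
  by rewrite -trmx_mul vM trmx0 supn0 !mulr_ge0// supn_ge0.
have [j xj] := supn_attained x0.
pose w : 'cV[C]_n := (row j (invmx M))^T.
have wl l : w l 0 = invmx M j l by rewrite mxE mxE.
have wn : 1 <= n%:R * tau * supn w.
  rewrite -(ler_pM2r (supn_gt0 x0)) mul1r -{1}xj.
  rewrite -{1}(mulKmx uM x) mxE (le_trans (cabs_sum _ _ _))//.
  apply: (@le_trans _ _ (\sum_(l < n) supn w * (tau * supn x))).
    apply: ler_sum => l _; rewrite cabsM ler_pM ?cabs_ge0//.
      by rewrite -wl supn_ge.
    by rewrite (le_trans _ Mx)// supn_ge.
  rewrite sumr_const card_ord -[leLHS]mulr_natl le_eqVlt; apply/orP; left.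
  by apply/eqP; ring.
exists w.
  by apply: contraTneq wn => ->; rewrite supn0 mulr0 ler10.
rewrite (le_trans _ wn)// -trmx_mul -row_mul mulVmx//.
by apply: supn_le => // i; rewrite !mxE; case: (_ == _); rewrite ?cabs1 ?cabs0.
Qed.

Lemma other_rows_kernel M i : exists y : 'cV[C]_n,
  y != 0 /\ forall l, l != i -> (M *m y) l 0 = 0.
Proof.
pose M' := \matrix_(l, j) (if l == i then 0 else M l j).
have : \det M'^T == 0.
  rewrite det_tr (expand_det_row _ i) big1// => j _.
  by rewrite mxE eqxx mul0r.
case/det0P => v v0 vM; exists v^T; split.
  by apply: contraNneq v0 => /(congr1 trmx); rewrite trmxK trmx0 => ->.
move=> l li; have := congr1 (fun A : 'rV[C]_n => A 0 l) vM.
rewrite !mxE => vl; rewrite -[RHS]vl; apply: eq_bigr => j _.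
by rewrite !mxE (negbTE li) mulrC.
Qed.

Definition row_normal i M : 'cV[C]_n :=
  xget 0 [set y | y != 0 /\ forall l, l != i -> (M *m y) l 0 = 0]%classic.

Lemma row_normalP i M :
  row_normal i M != 0 /\ forall l, l != i -> (M *m row_normal i M) l 0 = 0.
Proof.
have [y yP] := other_rows_kernel M i.
by apply: (@xgetPex _ (0 : 'cV[C]_n) [set y | y != 0 /\ forall l, l != i -> (M *m y) l 0 = 0]%classic); exists y.
Qed.

Lemma row_normal_rows i M M' :
  (forall l j, l \in [set~ i] -> M l j = M' l j) -> row_normal i M = row_normal i M'.
Proof.
move=> MM'; rewrite /row_normal; congr xget; apply/funext => y; apply/propext => /=.
have e l z : l != i -> (M *m z) l 0 = (M' *m z) l 0.
  by move=> li; rewrite !mxE; apply: eq_bigr => j _; rewrite MM'// !inE.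
by split=> -[y0 yi]; split=> // l li; [rewrite -e|rewrite e]; rewrite ?yi.
Qed.

(** Pairing with an almost null left vector [w] shows that the distance of row
    [i] to the other rows is small as soon as [w] is not small at [i]. *)
Lemma row_normal_image M i (w : 'cV[C]_n) t rho :
  0 < rho -> w != 0 -> supn (M^T *m w) <= t * supn w -> rho * supn w <= cabs (w i 0) ->
  supn (M *m row_normal i M) <= n%:R * t / rho * supn (row_normal i M).
Proof.
move=> rho0 w0 Mw wi; have [y0 yi] := row_normalP i M; set y := row_normal i M in y0 yi *.
have t0 : 0 <= t.
  by have := le_trans (supn_ge0 _) Mw; rewrite pmulr_lge0// supn_gt0.
have e : w i 0 * (M *m y) i 0 = \sum_j (M^T *m w) j 0 * y j 0.
  have -> : w i 0 * (M *m y) i 0 = (w^T *m (M *m y)) 0 0.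
    rewrite [RHS]mxE (bigD1 i) //= big1 ?addr0 ?mxE// => l li.
    by rewrite yi ?mulr0.
  rewrite mulmxA mxE; apply: eq_bigr => j _; congr (_ * _).
  by rewrite -[w^T *m M]trmxK trmx_mul trmxK mxE.
apply: supn_le => [|l]; first by rewrite !mulr_ge0 ?supn_ge0 ?invr_ge0// ltW.
have [->|li] := eqVneq l i; last first.
  by rewrite yi// cabs0 !mulr_ge0 ?supn_ge0 ?invr_ge0// ltW.
have sw := supn_gt0 w0.
rewrite mulrAC ler_pdivlMr// -(ler_pM2r sw) -mulrA.
rewrite mulrC (le_trans (ler_wpM2r (cabs_ge0 _) wi))// -cabsM e.
rewrite (le_trans (cabs_sum _ _ _))//.
apply: (@le_trans _ _ (\sum_(j < n) (t * supn w) * supn y)).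
  apply: ler_sum => j _; rewrite cabsM ler_pM ?cabs_ge0 ?supn_ge//.
  by rewrite (le_trans _ Mw)// supn_ge.
rewrite sumr_const card_ord -[leLHS]mulr_natl le_eqVlt; apply/orP; left.
by apply/eqP; ring.
Qed.

Section Averaging.
Variables (I V : finType) (mu : V -> R) (val : V -> R[i]).
Hypothesis mu_ge0 : forall v, 0 <= mu v.
Hypothesis mu_sum1 : \sum_v mu v = 1.
Variables (phi : 'I_n -> 'I_n -> I) (rw : I -> 'I_n).
Hypothesis rwE : forall i j, rw (phi i j) = i.
Hypothesis phi_inj : forall i, injective (phi i).
Variables (al : 'I_n -> 'I_n -> R) (b : 'M[R[i]]_n).
Variables (c sigma : R).
Hypothesis sigma_gt0 : 0 < sigma.
Notation Pr := (Pr mu).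
Notation M := (rmx val phi al b).

(** The transpose also has an almost null vector, and [m'] of its coordinates
    are large. For each of them, [row_normal_image] shows that the normal to
    the other rows, which is independent of row [i], is almost annihilated by row
    [i]. Thus [m'] of the [n] events [E i] happen at once, and each has
    probability at most [p]. *)
Lemma averaging m m0 p rho tau m' rho' tau' t :
  small_ball_bound I mu val c m0 p -> 0 <= p <= 1 -> 0 < rho -> 0 <= tau ->
  2 * tau < c * sigma * rho ->
  (forall L : {set 'I_n}, (m <= #|L|)%N -> rich_rows al sigma m0 L = [set: 'I_n]) ->
  (0 < m')%N -> 0 < rho' -> n%:R * t <= tau' -> n%:R * tau' / rho' <= tau ->
  Pr (fun om => [&& almost_singular t (M om), robust tau rho m (M om) &
                  robust tau' rho' m' (M om)^T]) <= n%:R / m'%:R * p.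
Proof.
move=> sbb p01 rho0 tau0 taus rich m'0 rho'0 tt' t'tau.
pose E i om := let A := M om in let y := row_normal i A in
  [&& y != 0, (m <= #|big_coords rho y|)%N & supn (A *m y) <= tau * supn y].
have EP i : Pr (E i) <= p.
  have := kernel_event mu_ge0 mu_sum1 rwE phi_inj b sigma_gt0 (G := n)
    (S := [set~ i]) (Y := row_normal i) sbb p01 rho0 tau0 taus.
  have -> : (n - #|[set~ i]| = 1)%N.
    by rewrite cardsC1 card_ord; case: (n) i => [[]|k _] //=; rewrite subSnn.
  rewrite expr1; apply.
    by move=> L mL; rewrite rich// cardsT card_ord.
  by move=> A A' AA'; apply: row_normal_rows.
rewrite mulrAC ler_pdivlMr ?ltr0n// mulrC.
apply: (@le_trans _ _ (\sum_i Pr (E i))); last first.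
  apply: (@le_trans _ _ (\sum_(i < n) p)); first by apply: ler_sum => i _; apply: EP.
  by rewrite sumr_const card_ord mulr_natl.
rewrite /Pr /Ex exchange_big /= mulr_sumr; apply: ler_sum => om _.
rewrite mulrCA -mulr_sumr ler_wpM2l ?wt_ge0// -natr_sum -natrM ler_nat.
case: (boolP [&& _, _ & _]) => [|_]; last by rewrite muln0.
rewrite muln1 => /and3P[sing /asboolP rob /asboolP robT].
have /asboolP[w w0 Mw] := almost_singular_tr sing.
have Mw' : supn ((M om)^T *m w) <= tau' * supn w.
  by rewrite (le_trans Mw)// ler_wpM2r ?supn_ge0.
rewrite (leq_trans (robT w w0 Mw'))// -sum1_card big_mkcond /=.
apply: leq_sum => i _; case: ifP => // iw.
have wi : rho' * supn w <= cabs (w i 0) by move: iw; rewrite inE.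
have [y0 _] := row_normalP i (M om).
have My : supn (M om *m row_normal i (M om)) <= tau * supn (row_normal i (M om)).
  rewrite (le_trans (row_normal_image rho'0 w0 Mw' wi))// ler_wpM2r ?supn_ge0//.
by rewrite /E y0 My rob.
Qed.

End Averaging.
End SingularDirection.

(** * Counting subsets and rich rows *)

Section FewSubsets.
Import mathcomp.boot.finset.
Variables (R : realType) (n : nat).

(** With weights [th ^ #|S|], the subsets counted weigh at least [th ^ k] each,
    and all subsets together [(1 + th) ^ n]. *)
Lemma few_subsets_le k (th : R) : 0 < th <= 1 ->
  (few_subsets n k)%:R * th ^+ k <= (1 + th) ^+ n.
Proof.
move=> /andP[th0 th1].
have -> : (1 + th) ^+ n = \sum_(S : {set 'I_n}) th ^+ #|S|.
  transitivity (\prod_(i < n) (th + 1)); first by rewrite prodr_const card_ord addrC.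
  rewrite bigA_distr; apply: eq_bigr => S _.
  by rewrite -big_mkcond /= prodr_const.
rewrite mulr_natl -sumr_const [leLHS]big_mkcond /=.
apply: ler_sum => S _; rewrite inE; case: ifP => [cS|_].
  by rewrite ler_wiXn2l// ltW.
by rewrite exprn_ge0// ltW.
Qed.

Lemma few_subsets_le2 k : (few_subsets n k <= 2 ^ n)%N.
Proof.
rewrite -[in X in (_ <= X)%N](card_ord n) -[in X in (_ <= X)%N]cardsT -card_powerset.
by rewrite subset_leq_card//; apply/fintype.subsetP => S _; rewrite inE subsetT.
Qed.

End FewSubsets.

Section RichRows.
Import mathcomp.boot.finset.
Variables (R : realType) (n : nat) (al : 'I_n -> 'I_n -> R) (sigma : R) (d : nat).
Notation nbr := (nbr al sigma).
Notation rich_rows := (rich_rows al sigma).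
Hypothesis d_gt0 : (0 < d)%N.
Hypothesis row_degree : forall i, (8 * d <= #|nbr i|)%N.
Hypothesis col_degree : forall j, (8 * d <= #|[set i | (sigma <= al i j)%R]|)%N.
Hypothesis regular : forall S L : {set 'I_n}, (d < #|S|)%N -> (2 * d < #|L|)%N ->
  (8 * d * #|S| * #|L| <= n * \sum_(i in S) #|L :&: nbr i|)%N.

Lemma rich_one (L : {set 'I_n}) : (0 < #|L|)%N -> (8 * d <= #|rich_rows 1 L|)%N.
Proof.
rewrite card_gt0 => /set0Pn[j jL]; apply: leq_trans (col_degree j) _.
apply: subset_leq_card; apply/fintype.subsetP => i; rewrite !inE => ij.
by rewrite card_gt0; apply/set0Pn; exists j; rewrite !inE jL.
Qed.

(** Double counting of the edges meeting [L]: rows that are not rich carry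
    fewer than [m0] of them each. *)
Lemma rich_many k (L : {set 'I_n}) : (k < #|L|)%N ->
  (4 * d <= #|rich_rows (4 * d * k.+1 %/ n) L|)%N.
Proof.
move=> kL; set m0 := (_ %/ n)%N; have L0 : (0 < #|L|)%N by apply: leq_ltn_trans kL.
have m0n : (n * m0 <= 4 * d * #|L|)%N.
  by rewrite mulnC (leq_trans (leq_divM _ _))// leq_mul2l kL orbT.
have edges : (8 * d * #|L| <= \sum_i #|L :&: nbr i|)%N.
  have -> : (\sum_i #|L :&: nbr i| = \sum_(j in L) #|[set i | (sigma <= al i j)%R]|)%N.
    under eq_bigr do rewrite -sum1_card big_mkcond.
    rewrite exchange_big /= [RHS]big_mkcond /=; apply: eq_bigr => j _.
    rewrite -sum1_card; case: ifP => jL.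
      by rewrite [RHS]big_mkcond; apply: eq_bigr => i _; rewrite !inE jL.
    by rewrite big1// => i _; rewrite !inE jL.
  rewrite mulnC -sum_nat_const; apply: leq_sum => j _; exact: col_degree.
have upper : (\sum_i #|L :&: nbr i| <= #|rich_rows m0 L| * #|L| + n * m0)%N.
  rewrite (bigID (mem (rich_rows m0 L))) /=; apply: leq_add.
    rewrite -sum_nat_const; apply: leq_sum => i _.
    by apply: subset_leq_card; apply: subsetIl.
  apply: (@leq_trans (\sum_(i < n) m0)); last by rewrite sum_nat_const card_ord.
  rewrite [leqLHS]big_mkcond /=; apply: leq_sum => i _.
  by case: ifP => // ; rewrite inE -ltnNge => /ltnW.
have := leq_trans edges upper; rewrite -(leq_pmul2r L0); move: m0n; nia.
Qed.

(** The rows that are not rich span few edges with [L], so regularity forbids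
    them to be more than [d]. *)
Lemma rich_most (L : {set 'I_n}) : (2 * d < #|L|)%N ->
  (n - d <= #|rich_rows (4 * d * (2 * d).+1 %/ n) L|)%N.
Proof.
move=> dL; set m0 := (_ %/ n)%N; have L0 : (0 < #|L|)%N by apply: leq_ltn_trans dL.
have m0n : (n * m0 <= 4 * d * #|L|)%N.
  by rewrite mulnC (leq_trans (leq_divM _ _))// leq_mul2l dL orbT.
rewrite leq_subLR -{1}(card_ord n) -cardsT -(cardsID (rich_rows m0 L) setT) setTI setTD.
rewrite addnC leq_add2r.
rewrite leqNgt; apply/negP => dS; have := regular dS dL; apply/negP; rewrite -ltnNge.
apply: (@leq_ltn_trans (n * (#|~: rich_rows m0 L| * m0))%N).
  rewrite leq_mul2l -sum_nat_const leq_sum ?orbT// => i.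
  by rewrite !inE -ltnNge => /ltnW.
rewrite mulnCA (leq_ltn_trans (leq_mul (leqnn _) m0n))//.
have S0 : (0 < #|~: rich_rows m0 L|)%N by apply: leq_ltn_trans dS.
have := muln_gt0 (#|~: rich_rows m0 L|) #|L|; rewrite S0 L0 /=.
move: d_gt0; nia.
Qed.

(** A row has at least [8 d] neighbours, of which fewer than [4 d] miss [L]. *)
Lemma rich_all (L : {set 'I_n}) : (n - 4 * d < #|L|)%N -> rich_rows (4 * d) L = [set: 'I_n].
Proof.
move=> dL; apply/setP => i; rewrite !inE.
have := cardsUI L (nbr i); have := row_degree i.
have : (#|L :|: nbr i| <= n)%N by rewrite -[X in (_ <= X)%N]card_ord max_card.
lia.
Qed.

End RichRows.

(** * The finite model at a fixed size *)

Section FixedSize.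
Import mathcomp.boot.finset.
Variables (R : realType) (n : nat) (V : finType) (mu : V -> R) (val : V -> R[i]).
Hypothesis mu_ge0 : forall v, 0 <= mu v.
Hypothesis mu_sum1 : \sum_v mu v = 1.
Variables (al : 'I_n -> 'I_n -> R) (b : 'M[R[i]]_n).
Variables (c sigma q T : R) (d k1 : nat).
Hypothesis sigma_gt0 : 0 < sigma.
Hypothesis q01 : 0 < q <= 1.
Hypothesis T_ge1 : 1 <= T.
Hypothesis n_ge2 : (2 <= n)%N.
Hypothesis d_gt0 : (0 < d)%N.
Hypothesis row_degree : forall i, (8 * d <= #|nbr al sigma i|)%N.
Hypothesis col_degree : forall j, (8 * d <= #|[set i | (sigma <= al i j)%R]|)%N.
Hypothesis regular : forall S L : {set 'I_n}, (d < #|S|)%N -> (2 * d < #|L|)%N ->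
  (8 * d * #|S| * #|L| <= n * \sum_(i in S) #|L :&: nbr al sigma i|)%N.

Notation I := ('I_n * 'I_n)%type.
Notation Pr := (@Pr R I V mu).
Notation M := (rmx val (fun i j : 'I_n => (i, j)) al b).

(* Each step multiplies both scales by [kap], which absorbs the losses [n] of
   [thin_kernel] and [n T] of truncation. *)
Let z : R := n%:R^-1.
Let kap : R := z ^+ 5 / T.
Hypothesis n_large : 2 * z ^+ 2 < c * sigma.

Let n_gt0 : 0 < n%:R :> R. Proof. by rewrite ltr0n ltnW. Qed.
Let T_gt0 : 0 < T. Proof. exact: lt_le_trans T_ge1. Qed.
Let z_gt0 : 0 < z. Proof. by rewrite invr_gt0. Qed.
Let z_le : z <= 1 / 2.
Proof. by rewrite /z -[leRHS]invrK lef_pV2 ?posrE// invf_div divr1 ler_nat. Qed.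
Let kap_gt0 : 0 < kap. Proof. by rewrite divr_gt0 ?exprn_gt0. Qed.
Let kap_le : kap <= z / 2.
Proof.
rewrite ler_pdivrMr//; apply: (@le_trans _ _ (z / 2 * 1)).
  rewrite mulr1 exprS ler_pM2l// exprS; apply: (@le_trans _ _ (z * 1)).
    by rewrite ler_pM2l// exprn_ile1 ?ltW//; move: z_le; lra.
  by move: z_le; lra.
by rewrite ler_pM2l// divr_gt0.
Qed.

Lemma rmx_tr om :
  rmx val (fun i j : 'I_n => (j, i)) (fun i j => al j i) b^T om = (M om)^T.
Proof. by apply/matrixP => i j; rewrite !mxE. Qed.

(** The starting point of the iteration: some coordinate is the largest. *)
Lemma robust1 tau (A : 'M[R[i]]_n) : robust tau 1 1 A.
Proof.
apply/asboolP => y y0 _; rewrite card_gt0; apply/set0Pn.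
by have [j yj] := supn_attained y0; exists j; rewrite inE yj mul1r.
Qed.

Lemma scale_step i tau : tau <= z ^+ 2 * kap ^+ i.+1 ->
  n%:R * (tau + n%:R * T * kap ^+ i.+1) <= z ^+ 2 * kap ^+ i.
Proof.
move=> taule.
have nz : n%:R * z = 1 by rewrite divff// gt_eqF.
have Tk : T * kap = z ^+ 5 by rewrite /kap mulrC divfK// gt_eqF.
have -> : n%:R * (tau + n%:R * T * kap ^+ i.+1) = n%:R * tau + z ^+ 3 * kap ^+ i.
  have -> : n%:R * (tau + n%:R * T * kap ^+ i.+1) =
     n%:R * tau + n%:R ^+ 2 * (T * kap) * kap ^+ i by rewrite exprS; ring.
  rewrite Tk; congr (_ + _ * _).
  have -> : n%:R ^+ 2 * z ^+ 5 = (n%:R * z) ^+ 2 * z ^+ 3 by ring.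
  by rewrite nz expr1n mul1r.
have -> : z ^+ 2 * kap ^+ i = z ^+ 2 * kap ^+ i / 2 + z ^+ 2 * kap ^+ i / 2 by lra.
have ki : 0 < kap ^+ i by rewrite exprn_gt0.
have z2 : 0 < z ^+ 2 by rewrite exprn_gt0.
have zk : 0 < z ^+ 2 * kap ^+ i by rewrite mulr_gt0.
apply: lerD.
  apply: (@le_trans _ _ (n%:R * (z ^+ 2 * kap ^+ i.+1))); first by rewrite ler_pM2l.
  have -> : n%:R * (z ^+ 2 * kap ^+ i.+1) = (n%:R * z) * (z * kap) * kap ^+ i.
    by rewrite (exprS kap); ring.
  rewrite nz mul1r (_ : z ^+ 2 * kap ^+ i / 2 = z ^+ 2 / 2 * kap ^+ i); last by rewrite mulrAC.
  by rewrite ler_pM2r// expr2 -mulrA ler_pM2l.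
have -> : z ^+ 3 * kap ^+ i = (z ^+ 2 * kap ^+ i) * z by ring.
by move: z_le; nra.
Qed.

Variables (p2 p3 p4 : R).
Hypothesis p2_01 : 0 <= p2 <= 1.
Hypothesis p3_01 : 0 <= p3 <= 1.
Hypothesis p4_01 : 0 <= p4 <= 1.
Hypothesis sbb1 : small_ball_bound I mu val c 1 (1 - q).
Hypothesis sbb2 : small_ball_bound I mu val c (4 * d * k1.+1 %/ n) p2.
Hypothesis sbb3 : small_ball_bound I mu val c (4 * d * (2 * d).+1 %/ n) p3.
Hypothesis sbb4 : small_ball_bound I mu val c (4 * d) p4.

(** The number of large coordinates of an almost null vector is raised from
    [1] to [k1 + 1], to [2 d + 1] and to [n - 4 d + 1], with failure
    probabilities given by the first terms; the first step is also made for the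
    transpose, whence the factor [2]. From there on every row is rich and
    [averaging] gives the last term. *)
Lemma fixed_size :
  Pr (fun om => entries_le T (M om) && almost_singular (kap ^+ 4 * z ^+ 4) (M om))
  <= (few_subsets n k1)%:R ^+ 2 * (1 - q) ^+ (8 * d - k1) *+ 2
   + (few_subsets n (2 * d))%:R ^+ 2 * p2 ^+ (2 * d)
   + (few_subsets n (n - 4 * d))%:R ^+ 2 * p3 ^+ (3 * d)
   + n%:R / k1.+1%:R * p4.
Proof.
have q1_01 : 0 <= 1 - q <= 1 by move: q01; lra.
have kap01 i : 0 <= kap ^+ i <= 1.
  rewrite exprn_ge0 ?(ltW kap_gt0)//= exprn_ile1 ?(ltW kap_gt0)//.
  by move: kap_le z_le; lra.
have kapg i : 0 < kap ^+ i by rewrite exprn_gt0.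
have tau0 i : 0 <= z ^+ 2 * kap ^+ i by rewrite mulr_ge0 ?exprn_ge0 ?ltW.
have taus i : 2 * (z ^+ 2 * kap ^+ i) < c * sigma * kap ^+ i by rewrite mulrA ltr_pM2r.
have T0 : 0 <= T := ltW T_gt0.
pose step i m m' om := [&& entries_le T (M om),
  robust (z ^+ 2 * kap ^+ i) (kap ^+ i) m (M om) &
  ~~ robust (z ^+ 2 * kap ^+ i.+1) (kap ^+ i.+1) m' (M om)].
have phi_inj (i : 'I_n) : injective (fun j : 'I_n => (i, j)) by move=> j j' [].
have phi_inj' (i : 'I_n) : injective (fun j : 'I_n => (j, i)) by move=> j j' [].
have rich1 := rich_one col_degree.
have nz : n%:R * z = 1 by rewrite divff// gt_eqF.
have s1 : Pr (step 0 1 k1.+1) <= (few_subsets n k1)%:R ^+ 2 * (1 - q) ^+ (8 * d - k1).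
  rewrite /step; apply: (robust_step mu_ge0 mu_sum1 (rw := fst) _ phi_inj b sigma_gt0 _ sbb1) => //.
  exact: scale_step.
have s2 : Pr (step 1 k1.+1 (2 * d).+1) <= (few_subsets n (2 * d))%:R ^+ 2 * p2 ^+ (4 * d - 2 * d).
  rewrite /step; apply: (robust_step mu_ge0 mu_sum1 (rw := fst) _ phi_inj b sigma_gt0 _ sbb2) => //.
    by move=> L kL; apply: (rich_many d_gt0 col_degree).
  exact: scale_step.
have d4n : (4 * d <= n)%N.
  have i0 : 'I_n by exact: (Ordinal n_ge2).
  apply: (@leq_trans (8 * d)%N); first by rewrite leq_mul2r orbT.
  apply: leq_trans (row_degree i0) _; apply: leq_trans (max_card _) _.
  by rewrite card_ord.
have s3 : Pr (step 2 (2 * d).+1 (n - 4 * d).+1) <=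
   (few_subsets n (n - 4 * d))%:R ^+ 2 * p3 ^+ (n - d - (n - 4 * d)).
  rewrite /step; apply: (robust_step mu_ge0 mu_sum1 (rw := fst) _ phi_inj b sigma_gt0 _ sbb3) => //.
    by move=> L kL; apply: (rich_most d_gt0 regular).
  exact: scale_step.
pose tauL := kap ^+ 4 * z ^+ 3.
have tauLle : tauL <= z ^+ 2 * kap ^+ 1.
  rewrite /tauL (_ : _ * _ = z ^+ 2 * kap ^+ 1 * (z * kap ^+ 3)); last by ring.
  rewrite ler_piMr ?(tau0 1%N)//; have /andP[k0 k1'] := kap01 3%N.
  by move: z_le z_gt0 k0 k1'; nra.
pose stepL om := [&& entries_le T (M om)^T, robust (z ^+ 2 * kap ^+ 0) (kap ^+ 0) 1 (M om)^T &
   ~~ robust tauL (kap ^+ 1) k1.+1 (M om)^T].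
have sL : Pr stepL <= (few_subsets n k1)%:R ^+ 2 * (1 - q) ^+ (8 * d - k1).
  pose N om := rmx val (fun i j : 'I_n => (j, i)) (fun i j => al j i) b^T om.
  have NE om : N om = (M om)^T := rmx_tr om.
  apply: (@le_trans _ _ (Pr (fun om => [&& entries_le T (N om),
      robust (z ^+ 2 * kap ^+ 0) (kap ^+ 0) 1 (N om) & ~~ robust tauL (kap ^+ 1) k1.+1 (N om)]))).
    by apply: (Pr_le mu_ge0) => om; rewrite NE.
  have rich1' := @rich_one R n (fun i j => al j i) sigma d row_degree.
  apply: (robust_step (phi := fun i j : 'I_n => (j, i)) (al := fun i j => al j i)
    mu_ge0 mu_sum1 (rw := snd) _ phi_inj' b^T sigma_gt0 k1 sbb1) => //.
  exact: scale_step.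
have sA : Pr (fun om => [&& almost_singular (kap ^+ 4 * z ^+ 4) (M om),
     robust (z ^+ 2 * kap ^+ 3) (kap ^+ 3) (n - 4 * d).+1 (M om) &
     robust tauL (kap ^+ 1) k1.+1 (M om)^T]) <= n%:R / k1.+1%:R * p4.
  apply: (averaging mu_ge0 mu_sum1 (rw := fst) _ phi_inj b sigma_gt0 sbb4) => //.
  - by move=> L; apply: (rich_all d_gt0 row_degree).
  - rewrite /tauL (_ : n%:R * _ = (n%:R * z) * (kap ^+ 4 * z ^+ 3)); last by ring.
    by rewrite nz mul1r.
  - rewrite /tauL ler_pdivrMr// (_ : n%:R * _ = (n%:R * z) * (z ^+ 2 * kap ^+ 3 * kap ^+ 1)).
      by rewrite nz mul1r.
    by ring.
apply: (@le_trans _ _ (Pr (fun om => step 0 1 k1.+1 om || (stepL om ||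
   (step 1 k1.+1 (2 * d).+1 om || (step 2 (2 * d).+1 (n - 4 * d).+1 om ||
    [&& almost_singular (kap ^+ 4 * z ^+ 4) (M om),
     robust (z ^+ 2 * kap ^+ 3) (kap ^+ 3) (n - 4 * d).+1 (M om) &
     robust tauL (kap ^+ 1) k1.+1 (M om)^T])))))).
  apply: (Pr_le mu_ge0) => om /andP[ent sing]; rewrite /step /stepL ent sing !robust1 /=.
  have -> : entries_le T (M om)^T.
    apply/forallP => i; apply/forallP => j; rewrite mxE.
    by have /forallP/(_ j)/forallP := ent; apply.
  by do !case: (robust _ _ _ _).
have e2 : (4 * d - 2 * d = 2 * d)%N by rewrite -mulnBl.
have e3 : (n - d - (n - 4 * d) = 3 * d)%N.
  by move: d4n; clear; lia.
rewrite e2 in s2; rewrite e3 in s3.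
rewrite mulr2n -!addrA.
apply: (le_trans (Pr_or mu_ge0 _ _)); apply: lerD => //.
apply: (le_trans (Pr_or mu_ge0 _ _)); apply: lerD => //.
apply: (le_trans (Pr_or mu_ge0 _ _)); apply: lerD => //.
by apply: (le_trans (Pr_or mu_ge0 _ _)); apply: lerD.
Qed.

End FixedSize.

(** * The finite model *)

Section FiniteModel.
Import mathcomp.boot.finset.
Variable R : realType.

Lemma small_ball_bound_one (I V : finType) (mu : V -> R) (val : V -> R[i]) c q :
  (forall v, 0 <= mu v) -> \sum_v mu v = 1 ->
  (forall z, \sum_v mu v * (cabs (val v - z) < c)%R%:R <= 1 - q) ->
  small_ball_bound I mu val c 1 (1 - q).
Proof.
move=> mu0 mu1 sv w L r0 r z r00 wL rs r_ge0; rewrite card_gt0 => L0.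
exact: (small_ball_one mu0 mu1 sv r00 wL rs r_ge0 z L0).
Qed.

Lemma small_ball_bound_many (I V : finType) (mu : V -> R) (val : V -> R[i]) c q m p :
  (forall v, 0 <= mu v) -> \sum_v mu v = 1 -> 0 < q <= 1 ->
  (forall z, \sum_v mu v * (cabs (val v - z) < c)%R%:R <= 1 - q) ->
  (0 < m)%N -> 6 / Num.sqrt (q * m%:R) <= p ->
  small_ball_bound I mu val c m p.
Proof.
move=> mu0 mu1 q01 sv m0 mp w L r0 r z r00 wL rs r_ge0 mL.
have [q0 q1] := andP q01.
have L0 : L != set0 by rewrite -card_gt0 (leq_trans m0).
apply: (le_trans (small_ball_many mu0 mu1 q01 sv r00 wL rs r_ge0 z L0)).
apply: le_trans mp; rewrite ler_pM2l// lef_pV2 ?posrE ?sqrtr_gt0 ?mulr_gt0 ?ltr0n//.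
  by rewrite ler_wsqrtr// ler_pM2l// ler_nat.
exact: leq_trans mL.
Qed.

Lemma expR_decay (x : R) : 0 < x -> expR (- x) <= x^-1.
Proof.
move=> x0; rewrite expRN lef_pV2 ?posrE ?expR_gt0//.
by rewrite (le_trans _ (expR_ge1Dx _))// lerDr.
Qed.

(** With [th] a small multiple of [q delta], the subsets of size [k] at most
    [n / K] number less than [expR (3 / 2 * th * n)] once [K] is large, while
    the power of [1 - q] is at most [expR (- 7 * th * n)]. *)
Lemma one_step_term (n k d K : nat) (q delta : R) : 0 < q <= 1 -> 0 < delta < 1 ->
  (0 < n)%N -> (k <= d)%N -> (k * K <= n)%N -> delta * n%:R / 16 <= d%:R ->
  (q * delta / 16) ^- 2 <= expR (K%:R * (q * delta / 16)) ->
  (few_subsets n k)%:R ^+ 2 * (1 - q) ^+ (8 * d - k) <= 4 / (q * delta) / n%:R.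
Proof.
move=> /andP[q0 q1] /andP[d0 d1] n0 kd kK dn Kth.
set th := q * delta / 16 in Kth *.
have th0 : 0 < th by rewrite divr_gt0 ?mulr_gt0.
have th1 : th <= 1 by rewrite /th ler_pdivrMr// mul1r; nra.
have nR0 : 0 < n%:R :> R by rewrite ltr0n.
have few : (few_subsets n k)%:R <= expR (th *+ n) * th ^- k.
  rewrite ler_pdivlMr ?exprn_gt0//.
  apply: (le_trans (few_subsets_le n k (th := th) _)); first by rewrite th0.
  rewrite -mulr_natl expRM_natl; apply: lerXn2r; rewrite ?nnegrE ?expR_ge0 ?expR_ge1Dx//.
  by rewrite addr_ge0// ltW.
have few2 : (few_subsets n k)%:R ^+ 2 <= expR (3 * th * n%:R).
  apply: (@le_trans _ _ ((expR (th *+ n) * th ^- k) ^+ 2)).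
    by rewrite lerXn2r ?nnegrE// mulr_ge0 ?expR_ge0 ?invr_ge0 ?exprn_ge0// ltW.
  rewrite exprMn -expRM_natl -exprVn -exprM mulnC exprM exprVn.
  apply: (@le_trans _ _ (expR (2 * (th *+ n)) * expR (K%:R * th) ^+ k)).
    rewrite ler_pM2l ?expR_gt0// lerXn2r ?nnegrE ?expR_ge0//.
    by rewrite invr_ge0 exprn_ge0// ltW.
  rewrite -expRM_natl -expRD ler_expR -mulr_natl.
  have : (k * K)%:R * th <= n%:R * th by rewrite ler_pM2r// ler_nat.
  by rewrite natrM; lra.
have kd7 : (7 * d <= 8 * d - k)%N by move: kd; clear; lia.
have small : (1 - q) ^+ (8 * d - k) <= expR (- (7 * th * n%:R)).
  apply: (@le_trans _ _ ((1 - q) ^+ (7 * d))).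
    by rewrite ler_wiXn2l//; lra.
  apply: (@le_trans _ _ (expR (- q) ^+ (7 * d))).
    by rewrite lerXn2r ?nnegrE ?expR_ge0 ?expR_ge1Dx//; lra.
  rewrite -expRM_natl ler_expR natrM /th.
  have : q * (delta * n%:R / 16) <= q * d%:R by rewrite ler_pM2l.
  by lra.
apply: (@le_trans _ _ (expR (3 * th * n%:R) * expR (- (7 * th * n%:R)))).
  by apply: ler_pM; rewrite ?exprn_ge0//; lra.
rewrite -expRD (_ : _ + _ = - (q * delta / 4 * n%:R)); last by rewrite /th; lra.
apply: (le_trans (expR_decay _)); first by rewrite !mulr_gt0.
by rewrite invfM invf_div.
Qed.

(** Here [2 ^ n] bounds the number of subsets; the small ball probability is so
    small that its power wins all the same. *)
Lemma later_step_term (n k d e : nat) (delta : R) : 0 < delta < 1 -> (0 < n)%N ->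
  delta * n%:R / 16 <= d%:R -> (2 * d <= e)%N ->
  (few_subsets n k)%:R ^+ 2 * expR (- (24 / delta)) ^+ e <= n%:R^-1.
Proof.
move=> /andP[d0 d1] n0 dn de.
have nR0 : 0 < n%:R :> R by rewrite ltr0n.
have few : (few_subsets n k)%:R ^+ 2 <= expR (2 * n%:R) :> R.
  have h : (few_subsets n k)%:R <= 2 ^+ n :> R.
    by rewrite -natrX ler_nat few_subsets_le2.
  apply: (@le_trans _ _ ((2 ^+ n) ^+ 2)).
    by apply: lerXn2r; rewrite ?nnegrE ?exprn_ge0.
  rewrite -exprM mulnC exprM.
  apply: (@le_trans _ _ ((expR 1 ^+ 2) ^+ n)).
    apply: lerXn2r; rewrite ?nnegrE ?exprn_ge0 ?expR_ge0//.
    by rewrite lerXn2r ?nnegrE ?expR_ge0// (le_trans _ (expR_ge1Dx _)).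
  by rewrite -!expRM_natl ler_expR; lra.
have small : expR (- (24 / delta)) ^+ e <= expR (- (3 * n%:R)).
  apply: (@le_trans _ _ (expR (- (24 / delta)) ^+ (2 * d))).
    rewrite ler_wiXn2l ?expR_ge0//.
    by rewrite -expR0 ler_expR oppr_le0 divr_ge0// ltW.
  rewrite -expRM_natl ler_expR natrM mulrN lerN2.
  rewrite (_ : 2 * d%:R * (24 / delta) = 48 * d%:R / delta); last by lra.
  by rewrite ler_pdivlMr//; lra.
apply: (@le_trans _ _ (expR (2 * n%:R) * expR (- (3 * n%:R)))).
  by apply: ler_pM; rewrite ?exprn_ge0 ?expR_ge0.
rewrite -expRD (_ : _ + _ = - n%:R); last by lra.
exact: expR_decay.
Qed.

(** The constant depends neither on [n] nor on the number of values of the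
    atom, which is what discretization requires. The size [n0] is large enough
    for the small ball probabilities in the middle steps to be at most [p]; for
    smaller [n] the bound is made trivial by the choice of [C]. *)
Theorem finite_model (c sigma q delta : R) :
  0 < c -> 0 < sigma -> 0 < q <= 1 -> 0 < delta < 1 ->
  exists C : R, 0 <= C /\
  forall (n : nat) (V : finType) (mu : V -> R) (val : V -> R[i])
    (al : 'I_n -> 'I_n -> R) (b : 'M[R[i]]_n) (T : R),
  (forall v, 0 <= mu v) -> \sum_v mu v = 1 ->
  (forall z, \sum_v mu v * (cabs (val v - z) < c)%R%:R <= 1 - q) ->
  1 <= T -> (2 <= n)%N ->
  (forall i, delta * n%:R <= #|nbr al sigma i|%:R) ->
  (forall j, delta * n%:R <= #|[set i | (sigma <= al i j)%R]|%:R) ->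
  (forall S L : {set 'I_n}, delta / 8 * n%:R <= #|S|%:R -> delta / 8 * n%:R <= #|L|%:R ->
    delta * #|S|%:R * #|L|%:R <= (\sum_(i in S) #|L :&: nbr al sigma i|)%N%:R) ->
  @Pr R ('I_n * 'I_n)%type V mu
    (fun om => let M := rmx val (fun i j : 'I_n => (i, j)) al b om in
       entries_le T M && almost_singular (n%:R ^- 24 / T ^+ 4) M)
  <= C / Num.sqrt n%:R.
Proof.
move=> c0 s0 q01 d01; have [q0 q1] := andP q01; have [d0 d1] := andP d01.
pose th := q * delta / 16.
(* The number of pairs of subsets, at most [4 ^ n], must lose against the
   power [2 d] of [p], where [d] is at least [delta n / 16]. *)
pose p := expR (- (24 / delta)).
have p0 : 0 < p by rewrite expR_gt0.
have p1 : p <= 1 by rewrite -expR0 ler_expR oppr_le0 divr_ge0// ltW.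
have th0 : 0 < th by rewrite divr_gt0 ?mulr_gt0.
(* [K] makes [k1 = n %/ K] at most [d] and the subsets of size [k1] few enough
   for [one_step_term]. *)
pose K := (Num.truncn (16 / delta) + Num.truncn (th ^- 2 / th)).+1.
(* With [Mm] large weights, [small_ball_many] gives a probability at most [p]. *)
pose Mm : R := 36 / (q * p ^+ 2).
pose n0 := (Num.truncn (16 / delta) + Num.truncn ((c * sigma)^-1) +
   Num.truncn ((Mm + 1) * (4 * K%:R / delta))).+1.
pose C := Num.sqrt n0%:R + (8 / (q * delta) + 2 + K%:R * (6 / Num.sqrt (q * delta / 4))).
have truncK (x : R) (m : nat) : (Num.truncn x < m)%N -> x < m%:R.
  move=> xm; apply: (lt_le_trans (truncnS_gt x)); by rewrite ler_nat.
have K1 : 16 / delta < K%:R by apply: truncK; rewrite ltnS leq_addr.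
have K2 : th ^- 2 <= expR (K%:R * th).
  apply: (le_trans _ (expR_ge1Dx _)); rewrite ltW// (@lt_trans _ _ (K%:R * th)) ?ltrDr//.
  by rewrite -ltr_pdivrMr//; apply: truncK; rewrite ltnS leq_addl.
have C1 : 0 <= 8 / (q * delta) + 2 + K%:R * (6 / Num.sqrt (q * delta / 4)).
  by rewrite !addr_ge0// ?mulr_ge0// ?invr_ge0 ?sqrtr_ge0// mulr_ge0// ltW.
exists C; split; first by rewrite addr_ge0.
move=> n V mu val al b T mu0 mu1 sv T1 n2 rowd cold reg.
have nR0 : 0 < n%:R :> R by rewrite ltr0n ltnW.
have sn0 : 0 < Num.sqrt n%:R :> R by rewrite sqrtr_gt0.
have [nn0|n0n] := leqP n n0.
  apply: (le_trans (Pr_le1 mu0 mu1 _)); rewrite ler_pdivlMr// mul1r.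
  by rewrite ler_wpDr// ler_wsqrtr// ler_nat.
have big1 : 16 / delta < n%:R.
  by apply: truncK; apply: leq_ltn_trans n0n; rewrite /n0 leqW// -addnA leq_addr.
have big2 : (c * sigma)^-1 < n%:R.
  apply: truncK; apply: leq_ltn_trans n0n; rewrite /n0 leqW//.
  by rewrite -addnA addnCA leq_addr.
have big3 : (Mm + 1) * (4 * K%:R / delta) < n%:R.
  by apply: truncK; apply: leq_ltn_trans n0n; rewrite /n0 leqW// leq_addl.
pose d := Num.truncn (delta * n%:R / 8).
have dle : d%:R <= delta * n%:R / 8.
  by rewrite truncn_le divr_ge0// mulr_ge0// ltW.
have dgt : delta * n%:R / 8 < d.+1%:R by exact: truncnS_gt.
have dn1 : 1 < delta * n%:R / 16 by rewrite ltr_pdivlMr// mul1r mulrC -ltr_pdivrMr.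
have dge : delta * n%:R / 16 <= d%:R by move: dgt; rewrite -[X in _ < X]natr1; lra.
have d_gt0 : (0 < d)%N by rewrite -(ltr_nat R); lra.
have d8 : (8 * d)%:R <= delta * n%:R by rewrite natrM; lra.
have row8 i : (8 * d <= #|nbr al sigma i|)%N by rewrite -(ler_nat R) (le_trans d8).
have col8 j : (8 * d <= #|[set i | (sigma <= al i j)%R]|)%N.
  by rewrite -(ler_nat R) (le_trans d8).
have reg8 (S L : {set 'I_n}) : (d < #|S|)%N -> (2 * d < #|L|)%N ->
    (8 * d * #|S| * #|L| <= n * \sum_(i in S) #|L :&: nbr al sigma i|)%N.
  move=> dS dL; rewrite -(ler_nat R) !natrM.
  have hS : delta / 8 * n%:R <= #|S|%:R.
    by rewrite mulrAC (le_trans (ltW dgt))// ler_nat.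
  have hL : delta / 8 * n%:R <= #|L|%:R.
    rewrite mulrAC (le_trans (ltW dgt))// ler_nat (leq_trans _ dL)// ltnS.
    by rewrite leq_pmull.
  have h := ler_wpM2l (ltW nR0) (reg S L hS hL).
  apply: le_trans h; rewrite !mulrA; apply: ler_wpM2r => //; apply: ler_wpM2r => //.
  by rewrite -natrM mulrC (le_trans d8)// mulrC.
pose k1 := (n %/ K)%N.
have k1K : (k1 * K <= n)%N by exact: leq_divM.
have nk1 : (n < k1.+1 * K)%N by rewrite ltn_ceil.
have k1d : (k1 <= d)%N.
  rewrite -(ler_nat R); apply: le_trans dge.
  rewrite -(@ler_pM2r _ K%:R) ?ltr0n// -natrM; apply: (@le_trans _ _ n%:R).
    by rewrite ler_nat.
  have KD : 16 <= K%:R * delta by move: K1; rewrite ltr_pdivrMr// => /ltW.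
  by have := ler_wpM2r (ltW nR0) KD; lra.
pose m2 := (4 * d * k1.+1 %/ n)%N.
have m2ge : Mm <= m2%:R.
  have h1 : (4 * d * k1.+1 < m2.+1 * n)%N by rewrite ltn_ceil// ltnW.
  have h2 : (4 * d * n <= 4 * d * k1.+1 * K)%N by rewrite -[leqRHS]mulnA leq_mul2l (ltnW nk1) orbT.
  have h3 : (4 * d < m2.+1 * K)%N.
    rewrite -(ltn_pmul2r (ltnW n2)) (leq_ltn_trans h2)// [ltnRHS]mulnAC ltn_pmul2r//.
  have h4 : Mm + 1 < delta * n%:R / (4 * K%:R).
    rewrite ltr_pdivlMr ?mulr_gt0 ?ltr0n// [ltRHS]mulrC -ltr_pdivrMr//.
    by rewrite -mulrA.
  have h5 : delta * n%:R / (4 * K%:R) < m2.+1%:R.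
    rewrite ltr_pdivrMr ?mulr_gt0 ?ltr0n//.
    have : (4 * d)%:R < (m2.+1 * K)%:R :> R by rewrite ltr_nat.
    by rewrite !natrM; lra.
  by have := lt_trans h4 h5; rewrite -[X in _ < X]natr1; lra.
have Mm0 : 0 < Mm by rewrite divr_gt0 ?mulr_gt0 ?exprn_gt0.
have m2_gt0 : (0 < m2)%N by rewrite -(ltr_nat R) (lt_le_trans Mm0).
have pm (m : nat) : (m2 <= m)%N -> 6 / Num.sqrt (q * m%:R) <= p.
  move=> m2m; have mM : Mm <= m%:R by rewrite (le_trans m2ge)// ler_nat.
  have mp : 0 < Num.sqrt (q * m%:R) by rewrite sqrtr_gt0 mulr_gt0// (lt_le_trans Mm0).
  rewrite ler_pdivrMr//.
  have h6 : 0 <= 6 / p by rewrite divr_ge0// ltW.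
  rewrite mulrC -ler_pdivrMr// -(ger0_norm h6) -sqrtr_sqr; apply: ler_wsqrtr.
  rewrite -ler_pdivrMl// (le_trans _ mM)// /Mm expr_div_n le_eqVlt; apply/orP; left; apply/eqP.
  by field; rewrite (lt0r_neq0 q0) (lt0r_neq0 p0).
have m2m3 : (m2 <= 4 * d * (2 * d).+1 %/ n)%N.
  by rewrite leq_div2r// leq_mul2l ltnS (leq_trans k1d) ?orbT// leq_pmull.
have m2m4 : (m2 <= 4 * d)%N.
  rewrite -(mulnK (4 * d) (ltnW n2)) leq_div2r// leq_mul2l.
  rewrite (leq_trans _ (_ : d.+1 <= n)%N) ?ltnS ?orbT//.
  rewrite -(ltr_nat R) (le_lt_trans dle)//; move: nR0; nra.
pose p4 := 6 / Num.sqrt (q * (4 * d)%:R).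
have p4_01 : 0 <= p4 <= 1.
  by rewrite mulr_ge0 ?invr_ge0 ?sqrtr_ge0//= (le_trans (pm _ m2m4)).
have p01 : 0 <= p <= 1 by rewrite ltW.
have sbb1 := small_ball_bound_one (I := ('I_n * 'I_n)%type) mu0 mu1 sv.
have sbb m := small_ball_bound_many (I := ('I_n * 'I_n)%type) (m := m) mu0 mu1 q01 sv.
have nlarge : 2 * (n%:R^-1) ^+ 2 < c * sigma.
  have x0 : 0 < n%:R^-1 :> R by rewrite invr_gt0.
  have x1 : n%:R^-1 <= 1 / 2 :> R.
    by rewrite -[leRHS]invrK invf_div divr1 lef_pV2 ?posrE// ler_nat.
  apply: (@le_lt_trans _ _ n%:R^-1); first by move: x0 x1; clear; nra.
  by rewrite -[ltRHS]invrK ltf_pV2// posrE invr_gt0 mulr_gt0.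
have := fixed_size mu0 mu1 b s0 q01 T1 n2 d_gt0 row8 col8 reg8 nlarge p01 p01 p4_01
  sbb1 (sbb p _ m2_gt0 (pm _ (leqnn _))) (sbb p _ (leq_trans m2_gt0 m2m3) (pm _ m2m3))
  (sbb p4 _ (leq_trans m2_gt0 m2m4) (lexx _)).
have -> : (n%:R^-1 ^+ 5 / T) ^+ 4 * n%:R^-1 ^+ 4 = n%:R ^- 24 / T ^+ 4.
  by rewrite expr_div_n -exprM mulrAC -exprD exprVn.
move=> H; apply: (le_trans H).
have k1n : n%:R / k1.+1%:R <= K%:R :> R.
  by rewrite ler_pdivrMr ?ltr0n// -natrM ler_nat mulnC ltnW.
set s := (Num.sqrt n%:R)^-1.
have s_gt0 : 0 < s by rewrite invr_gt0.
have n1 : n%:R^-1 <= s.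
  rewrite lef_pV2 ?posrE//.
  have s1 : 1 <= Num.sqrt n%:R :> R.
    by rewrite -[leLHS]sqrtr1 ler_wsqrtr// ler1n ltnW.
  have : Num.sqrt n%:R ^+ 2 = n%:R :> R by rewrite sqr_sqrtr ?ltW.
  by move: s1; clear; nra.
have qd0 : 0 < q * delta by rewrite mulr_gt0.
have t1 : (few_subsets n k1)%:R ^+ 2 * (1 - q) ^+ (8 * d - k1) <= 4 / (q * delta) * s.
  apply: (le_trans (one_step_term q01 d01 (ltnW n2) k1d k1K dge K2)).
  by rewrite ler_wpM2l// divr_ge0// ltW.
have t2 := le_trans (later_step_term (2 * d) d01 (ltnW n2) dge (leqnn _)) n1.
have t3 := le_trans (later_step_term (n - 4 * d) d01 (ltnW n2) dge
  (leq_mul (leqnSn 2) (leqnn d))) n1.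
have t4 : p4 <= 6 / Num.sqrt (q * delta / 4) * s.
  have a0 : 0 < Num.sqrt (q * delta / 4) by rewrite sqrtr_gt0 divr_gt0.
  have b0 : 0 < Num.sqrt (q * (4 * d)%:R).
    by rewrite sqrtr_gt0 mulr_gt0// ltr0n muln_gt0.
  rewrite /p4 -mulrA ler_wpM2l// -invfM lef_pV2 ?posrE ?mulr_gt0//.
  have qd4 : 0 <= q * delta / 4 by rewrite divr_ge0// ltW.
  rewrite -(sqrtrM _ qd4); apply: ler_wsqrtr.
  rewrite (_ : q * delta / 4 * n%:R = q * (delta * n%:R / 4)); last by ring.
  by rewrite ler_pM2l// natrM; move: dge; clear; lra.
apply: (@le_trans _ _ ((8 / (q * delta) + 2 + K%:R * (6 / Num.sqrt (q * delta / 4))) * s)); last first.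
  by rewrite ler_pM2r// lerDr sqrtr_ge0.
have -> : 8 / (q * delta) = 4 / (q * delta) *+ 2.
  by rewrite -[RHS]mulr_natr mulrAC; congr (_ / _); ring.
rewrite mulrDl; apply: lerD; last first.
  rewrite -[leRHS]mulrA; have /andP[p4_ge0 _] := p4_01.
  exact: (ler_pM (divr_ge0 (ler0n _ _) (ler0n _ _)) p4_ge0 k1n t4).
rewrite mulrDl -addrA; apply: lerD; first by rewrite mulrnAl lerMn2r t1 orbT.
by rewrite mulr_natl mulr2n lerD.
Qed.

End FiniteModel.

(** * Variational description of extreme singular values *)

Section SingularValues.
Variable R : realType.
Notation C := R[i].
Local Open Scope sesquilinear_scope.

(** The square of the Euclidean norm, valued in [R]. *)
Definition norm2 n (x : 'cV[C]_n) : R := \sum_i cabs (x i 0) ^+ 2.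

Lemma norm2_ge0 n (x : 'cV[C]_n) : 0 <= norm2 x.
Proof. by apply: sumr_ge0 => i _; rewrite sqr_ge0. Qed.

Lemma cabs_sqrC (z : C) : (cabs z ^+ 2)%:C%C = z^* * z.
Proof. by rewrite rmorphXn /= -cabs_normr normCKC. Qed.

Lemma norm2E n (x : 'cV[C]_n) : (norm2 x)%:C%C = (x ^t* *m x) 0 0.
Proof.
rewrite /norm2 rmorph_sum mxE /=; apply: eq_bigr => i _.
by rewrite cabs_sqrC !mxE.
Qed.

Lemma norm20 n : norm2 (0 : 'cV[C]_n) = 0.
Proof. by apply: big1 => i _; rewrite mxE cabs0 expr0n. Qed.

Lemma norm2_gt0 n (x : 'cV[C]_n) : x != 0 -> 0 < norm2 x.
Proof.
case/cV0Pn => i xi; rewrite /norm2 (bigD1 i) //=.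
rewrite ltr_pwDl ?exprn_gt0 ?cabs_gt0//.
by apply: sumr_ge0 => j _; rewrite sqr_ge0.
Qed.

Lemma trmxC_mul m n p (A : 'M[C]_(m, n)) (B : 'M[C]_(n, p)) :
  (A *m B) ^t* = B ^t* *m A ^t*.
Proof. by rewrite trmx_mul map_mxM. Qed.

Section Spectrum.
Variables (n : nat) (M : 'M[C]_n).
Let H := M ^t* *m M.
Let U := spectralmx H.
Let D := spectral_diag H.

Lemma spectrum_decomposition : H = U ^t* *m diag_mx D *m U.
Proof.
have : H \is normalmx.
  apply/normalmxP; have -> // : H ^t* = H.
  by rewrite /H trmxC_mul trmxCK.
by move/orthomx_spectralP; rewrite invmx_unitary// spectral_unitarymx.
Qed.

Lemma norm2_spectral x : norm2 (M *m x) = \sum_i complex.Re (D 0 i) * cabs ((U *m x) i 0) ^+ 2.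
Proof.
have -> : norm2 (M *m x) = complex.Re (norm2 (M *m x))%:C%C by [].
rewrite norm2E trmxC_mul -mulmxA [M ^t* *m _]mulmxA -/H spectrum_decomposition.
have -> : x ^t* *m (U ^t* *m diag_mx D *m U *m x) = (U *m x) ^t* *m diag_mx D *m (U *m x).
  by rewrite trmxC_mul !mulmxA.
rewrite mul_mx_diag mxE raddf_sum; apply: eq_bigr => i _.
rewrite !mxE mulrAC -cabs_sqrC.
by case: (D 0 i) => a b /=; rewrite mul0r subr0 mulrC.
Qed.

Lemma norm2_unitary x : norm2 (U *m x) = norm2 x.
Proof.
apply: complexI; rewrite !norm2E trmxC_mul -mulmxA [U ^t* *m _]mulmxA.
have /unitarymxP := spectral_unitarymx H; rewrite -/U => UU.
by rewrite (mulmx1C UU) mul1mx.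
Qed.

Lemma eigenvector i : exists x, norm2 x = 1 /\ norm2 (M *m x) = complex.Re (D 0 i).
Proof.
have UU : U *m U ^t* = 1%:M by apply/unitarymxP; exact: spectral_unitarymx.
exists (U ^t* *m delta_mx i 0); split.
  rewrite -norm2_unitary mulmxA UU mul1mx /norm2 (bigD1 i) //= big1 ?addr0.
    by rewrite mxE !eqxx cabs1 expr1n.
  by move=> j ji; rewrite mxE (negbTE ji) cabs0 expr0n.
rewrite norm2_spectral mulmxA UU mul1mx (bigD1 i) //= big1 ?addr0.
  by rewrite mxE !eqxx cabs1 expr1n mulr1.
by move=> j ji; rewrite mxE (negbTE ji) cabs0 expr0n mulr0.
Qed.

Lemma eigenvalue_ge0 i : 0 <= complex.Re (D 0 i).
Proof. by have [x [_ <-]] := eigenvector i; exact: norm2_ge0. Qed.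

Let sv := singular_values M.

Lemma singular_values_sorted : sorted (fun x y : R => y <= x) sv.
Proof. by apply: sort_sorted => x y; exact: le_total. Qed.

Lemma mem_singular_values x :
  (x \in sv) = (x \in [seq Num.sqrt (complex.Re (D 0 i)) | i : 'I_n]).
Proof. by rewrite mem_sort. Qed.

Lemma size_singular_values : size sv = n.
Proof. by rewrite size_sort size_map size_enum_ord. Qed.

Lemma nth_singular_values k : (k < n)%N ->
  exists i, nth 0 sv k = Num.sqrt (complex.Re (D 0 i)).
Proof.
move=> kn; have : nth 0 sv k \in sv by rewrite mem_nth// size_singular_values.
by rewrite mem_singular_values => /mapP[i _ ->]; exists i.
Qed.

Lemma singular_values_bounds i : (0 < n)%N ->
  singular_value M n <= Num.sqrt (complex.Re (D 0 i)) <= opnorm M.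
Proof.
move=> n0; have : Num.sqrt (complex.Re (D 0 i)) \in sv.
  by rewrite mem_singular_values; apply/mapP; exists i; rewrite ?mem_enum.
move/(nthP 0) => [k]; rewrite size_singular_values => kn <-.
have tr : transitive (fun x y : R => y <= x) by move=> y x z xy yz; exact: le_trans xy.
have := sorted_leq_nth tr (fun x => lexx x) 0 singular_values_sorted.
rewrite size_singular_values => h; apply/andP; split; apply: h => //.
  by rewrite inE prednK.
by rewrite -ltnS prednK.
Qed.

Lemma singular_value_ge0 k : 0 <= singular_value M k.
Proof.
rewrite /singular_value; case: (ltnP k.-1 n) => [kn|nk].
  by have [i ->] := nth_singular_values kn; rewrite sqrtr_ge0.
by rewrite nth_default// size_singular_values.
Qed.

Lemma opnormP (u : R) : 0 <= u -> (0 < n)%N ->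
  opnorm M <= u <-> forall x, norm2 (M *m x) <= u ^+ 2 * norm2 x.
Proof.
move=> u0 n0; split=> [Mu x|Mu].
  rewrite norm2_spectral -norm2_unitary mulr_sumr; apply: ler_sum => i _.
  rewrite ler_wpM2r ?sqr_ge0// -(sqr_sqrtr (eigenvalue_ge0 i)).
  rewrite lerXn2r ?nnegrE ?sqrtr_ge0//; apply: le_trans Mu.
  by have /andP[] := singular_values_bounds i n0.
rewrite /opnorm /singular_value /=; have [i ->] := nth_singular_values n0.
have [x [x1 Mx]] := eigenvector i.
by have := Mu x; rewrite x1 mulr1 Mx => /ler_wsqrtr; rewrite sqrtr_sqr ger0_norm.
Qed.

Lemma least_singular_valueP (t : R) : 0 <= t -> (0 < n)%N ->
  singular_value M n <= t <-> exists2 x, x != 0 & norm2 (M *m x) <= t ^+ 2 * norm2 x.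
Proof.
move=> t0 n0; split=> [|[x x0 Mx]].
  have nn : (n.-1 < n)%N by rewrite prednK.
  rewrite /singular_value; have [i ->] := nth_singular_values nn => it.
  have [x [x1 Mx]] := eigenvector i; exists x.
    by apply/eqP => xe; have := oner_neq0 R; rewrite -x1 xe norm20 eqxx.
  rewrite x1 mulr1 Mx -(sqr_sqrtr (eigenvalue_ge0 i)).
  by rewrite lerXn2r ?nnegrE ?sqrtr_ge0.
rewrite -(@ler_pXn2r _ 2) ?nnegrE ?singular_value_ge0// -(ler_pM2r (norm2_gt0 x0)) (le_trans _ Mx)//.
rewrite norm2_spectral -norm2_unitary mulr_sumr; apply: ler_sum => i _.
rewrite ler_wpM2r ?sqr_ge0// -(sqr_sqrtr (eigenvalue_ge0 i)).
rewrite lerXn2r ?nnegrE ?sqrtr_ge0 ?singular_value_ge0//.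
by have /andP[] := singular_values_bounds i n0.
Qed.

End Spectrum.

End SingularValues.

(** * Measurability of extreme singular values *)

Section RationalVectors.
Variable R : realType.
Notation C := R[i].
Local Open Scope classical_set_scope.

(** Convergence of complex sequences, coordinatewise: the form that
    measurability in [R * R] calls for. *)
Definition tends (z : nat -> C) (l : C) :=
  (fun k => complex.Re (z k)) @ \oo --> complex.Re l /\
  (fun k => complex.Im (z k)) @ \oo --> complex.Im l.

Lemma cvg_finite_sum (J : finType) (u : J -> nat -> R) (l : J -> R) :
  (forall j, u j @ \oo --> l j) -> (fun k => \sum_j u j k) @ \oo --> \sum_j l j.
Proof. by move=> ul; apply: cvg_big => //; exact: add_continuous. Qed.

Lemma tends_sum (J : finType) (u : J -> nat -> C) (l : J -> C) :
  (forall j, tends (u j) (l j)) -> tends (fun k => \sum_j u j k) (\sum_j l j).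
Proof.
move=> ul; have ReS (f : J -> C) : complex.Re (\sum_j f j) = \sum_j complex.Re (f j).
  by rewrite (raddf_sum (@complex.Re R)).
have ImS (f : J -> C) : complex.Im (\sum_j f j) = \sum_j complex.Im (f j).
  by rewrite (raddf_sum (@complex.Im R)).
split.
  rewrite ReS; under eq_fun do rewrite ReS.
  by apply: cvg_finite_sum => j; have [] := ul j.
rewrite ImS; under eq_fun do rewrite ImS.
by apply: cvg_finite_sum => j; have [] := ul j.
Qed.

Lemma tendsZ (a : C) (u : nat -> C) (l : C) : tends u l -> tends (fun k => a * u k) (a * l).
Proof.
move=> [ur ui]; have ReM (z : C) : complex.Re (a * z) =
    complex.Re a * complex.Re z - complex.Im a * complex.Im z by case: (a) => ? ?; case: z.
have ImM (z : C) : complex.Im (a * z) =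
    complex.Re a * complex.Im z + complex.Im a * complex.Re z by case: (a) => ? ?; case: z.
split.
  rewrite ReM; under eq_fun do rewrite ReM.
  by apply: cvgB; apply: cvgM => //; exact: cvg_cst.
rewrite ImM; under eq_fun do rewrite ImM.
by apply: cvgD; apply: cvgM => //; exact: cvg_cst.
Qed.

Lemma cvg_norm2 n (y : nat -> 'cV[C]_n) (x : 'cV[C]_n) :
  (forall j, tends (fun k => y k j 0) (x j 0)) ->
  (fun k => norm2 (y k)) @ \oo --> norm2 x.
Proof.
move=> yx; apply: cvg_finite_sum => j; have [yr yi] := yx j.
rewrite cabs_sqr; under eq_fun do rewrite cabs_sqr !expr2.
by rewrite !expr2; apply: cvgD; apply: cvgM.
Qed.

Lemma tends_mulmx n (M : 'M[C]_n) (y : nat -> 'cV[C]_n) (x : 'cV[C]_n) :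
  (forall j, tends (fun k => y k j 0) (x j 0)) ->
  forall i, tends (fun k => (M *m y k) i 0) ((M *m x) i 0).
Proof.
move=> yx i; rewrite mxE.
have -> : (fun k => (M *m y k) i 0) = (fun k => \sum_j M i j * y k j 0).
  by apply/funext => k; rewrite mxE.
by apply: tends_sum => j; exact: tendsZ.
Qed.

Lemma rat_sequence (a : R) : exists q : nat -> rat, (fun k => ratr (q k) : R) @ \oo --> a.
Proof.
have H k : exists q : rat, `|a - ratr q| < k.+1%:R^-1.
  have e0 : 0 < k.+1%:R^-1 :> R by rewrite invr_gt0.
  have [|b0 [/= ab [q _ qb]]] := @dense_rat R (ball a k.+1%:R^-1) _ (ball_open a _).
    by exists a; exact: ballxx.
  by exists q; move: ab; rewrite -qb /ball /=.
have [q qP] := choice H; exists q.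
apply/cvgrPdist_lt => e e0; near=> k; apply: lt_trans (qP k) _.
by near: k; exact: near_infty_natSinv_lt (PosNum e0).
Unshelve. all: by end_near. Qed.

Definition rat_vec n (p : 'cV[rat]_n * 'cV[rat]_n) : 'cV[C]_n :=
  \col_j (Complex (ratr (p.1 j 0)) (ratr (p.2 j 0))).

Lemma rat_vec_dense n (x : 'cV[C]_n) : exists p : nat -> 'cV[rat]_n * 'cV[rat]_n,
  forall j, tends (fun k => rat_vec (p k) j 0) (x j 0).
Proof.
have [qr qrP] := choice (fun j => rat_sequence (complex.Re (x j 0))).
have [qi qiP] := choice (fun j => rat_sequence (complex.Im (x j 0))).
exists (fun k => (\col_j qr j k, \col_j qi j k)) => j; split.
  by under eq_fun do rewrite !mxE /= ?mxE; exact: qrP.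
by under eq_fun do rewrite !mxE /= ?mxE; exact: qiP.
Qed.

(** Strict quadratic inequalities are open, hence are witnessed by rational vectors. *)
Lemma rat_vec_witness n (M : 'M[C]_n) (a b : R) (x : 'cV[C]_n) :
  0 < a * norm2 (M *m x) + b * norm2 x ->
  exists p, 0 < a * norm2 (M *m rat_vec p) + b * norm2 (rat_vec p).
Proof.
move=> x0; have [p px] := rat_vec_dense x.
have cv : (fun k => a * norm2 (M *m rat_vec (p k)) + b * norm2 (rat_vec (p k))) @ \oo -->
    a * norm2 (M *m x) + b * norm2 x.
  apply: cvgD; apply: cvgM; try exact: cvg_cst.
    by apply: cvg_norm2; exact: tends_mulmx.
  exact: cvg_norm2.
have [k _ kP] := cvgr_gt _ cv _ x0.
by exists (p k); apply: (kP k) => /=.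
Qed.

End RationalVectors.

Section Measurability.
Variables (R : realType) (n : nat) (d : measure_display) (T : measurableType d).
Notation C := R[i].
Local Open Scope classical_set_scope.
Variable M : T -> 'M[C]_n.
Hypothesis M_meas : forall i j, complex_rv (fun w => M w i j).
Hypothesis n_gt0 : (0 < n)%N.

Lemma complex_rv_Re (X : T -> C) : complex_rv X -> measurable_fun setT (@complex.Re R \o X).
Proof. by move=> mX; apply: (measurableT_comp measurable_fst mX). Qed.

Lemma complex_rv_Im (X : T -> C) : complex_rv X -> measurable_fun setT (@complex.Im R \o X).
Proof. by move=> mX; apply: (measurableT_comp measurable_snd mX). Qed.

Lemma complex_rvP (X : T -> C) : measurable_fun setT (@complex.Re R \o X) ->
  measurable_fun setT (@complex.Im R \o X) -> complex_rv X.
Proof. by move=> mr mi; exact: measurable_fun_pair. Qed.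

Lemma complex_rv_sum (J : finType) (X : J -> T -> C) :
  (forall j, complex_rv (X j)) -> complex_rv (fun w => \sum_j X j w).
Proof.
move=> mX; apply: complex_rvP.
  rewrite (_ : _ \o _ = fun w => \sum_j complex.Re (X j w)).
    by apply: measurable_sum => j; exact: complex_rv_Re.
  by apply/funext => w /=; rewrite (raddf_sum (@complex.Re R)).
rewrite (_ : _ \o _ = fun w => \sum_j complex.Im (X j w)).
  by apply: measurable_sum => j; exact: complex_rv_Im.
by apply/funext => w /=; rewrite (raddf_sum (@complex.Im R)).
Qed.

Lemma complex_rv_affine (X : T -> C) (a b : C) :
  complex_rv X -> complex_rv (fun w => a * X w + b).
Proof.
move=> mX; have mr := complex_rv_Re mX; have mi := complex_rv_Im mX.
apply: complex_rvP.
  rewrite (_ : _ \o _ = fun w => complex.Re a * complex.Re (X w)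
      - complex.Im a * complex.Im (X w) + complex.Re b); last first.
    by apply/funext => w /=; case: a => ? ?; case: b => ? ?; case: (X w).
  by apply: measurable_funD => //; apply: measurable_funB; apply: measurable_funM.
rewrite (_ : _ \o _ = fun w => complex.Re a * complex.Im (X w)
    + complex.Im a * complex.Re (X w) + complex.Im b); last first.
  by apply/funext => w /=; case: a => ? ?; case: b => ? ?; case: (X w).
by apply: measurable_funD => //; apply: measurable_funD; apply: measurable_funM.
Qed.

Lemma measurable_norm2 (x : 'cV[C]_n) : measurable_fun setT (fun w => norm2 (M w *m x)).
Proof.
apply: measurable_sum => i; under eq_fun do rewrite cabs_sqr.
have mi : complex_rv (fun w => (M w *m x) i 0).
  rewrite (_ : (fun w => _) = fun w => \sum_j (x j 0 * M w i j + 0)).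
    by apply: complex_rv_sum => j; exact: complex_rv_affine.
  by apply/funext => w; rewrite mxE; apply: eq_bigr => j _; rewrite addr0 mulrC.
apply: measurable_funD; apply: measurable_funX.
  exact: (complex_rv_Re mi).
exact: (complex_rv_Im mi).
Qed.

Lemma measurable_norm2_le (x : 'cV[C]_n) s :
  measurable [set w | norm2 (M w *m x) <= s * norm2 x].
Proof.
rewrite -[X in measurable X]setTI.
by apply: measurable_fun_le => //; exact: measurable_norm2.
Qed.

(** A quadratic inequality holds for all vectors as soon as it holds for the
    countably many rational ones. *)
Lemma measurable_opnorm_le u : 0 <= u -> measurable [set w | opnorm (M w) <= u].
Proof.
move=> u0; rewrite (_ : [set w | _] = ~` \bigcup_p
    ~` [set w | norm2 (M w *m rat_vec R p) <= u ^+ 2 * norm2 (rat_vec R p)]).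
  apply: measurableC; apply: countable_bigcupT_measurable; first exact: countableP.
  by move=> p; apply: measurableC; exact: measurable_norm2_le.
apply/seteqP; split=> [w /= /opnormP - /(_ u0 n_gt0) Mu [p _] /=|w /= H].
  by apply; exact: Mu.
apply/(opnormP _ u0 n_gt0) => x; rewrite leNgt; apply/negP => Mx.
have [|p pP] := @rat_vec_witness R n (M w) 1 (- u ^+ 2) x.
  by rewrite mul1r mulNr subr_gt0.
by apply: H; exists p => //=; move: pP; rewrite mul1r mulNr subr_gt0 ltNge => /negP.
Qed.

(** A minimizing vector need not be rational, but for every [k] a rational
    vector satisfies the inequality with margin [1 / (k + 1)]. *)
Lemma measurable_least_singular_value_le t : 0 <= t ->
  measurable [set w | singular_value (M w) n <= t].
Proof.
move=> t0; rewrite (_ : [set w | _] = \bigcap_k \bigcup_(p in [set p | rat_vec R p != 0])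
   [set w | norm2 (M w *m rat_vec R p) <= (t ^+ 2 + k.+1%:R^-1) * norm2 (rat_vec R p)]).
  apply: bigcapT_measurable => k.
  rewrite bigcup_mkcond; apply: countable_bigcupT_measurable; first exact: countableP.
  by move=> p; case: ifP => _; [exact: measurable_norm2_le|exact: measurable0].
apply/seteqP; split=> [w /= wt k _|w /= H].
  have [x x0 Mx] := (least_singular_valueP (M w) t0 n_gt0).1 wt.
  have x2 := norm2_gt0 x0.
  have [|p pP] := @rat_vec_witness R n (M w) (-1) (t ^+ 2 + k.+1%:R^-1) x.
    rewrite mulN1r addrC subr_gt0 (le_lt_trans Mx)// ltr_pM2r// ltrDl.
    by rewrite invr_gt0.
  move: pP; rewrite mulN1r addrC subr_gt0 => pP; exists p => /=; last exact: ltW.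
  by apply: contraTneq pP => ->; rewrite mulmx0 norm20 mulr0 ltxx.
rewrite -(@ler_pXn2r _ 2) ?nnegrE ?singular_value_ge0//.
rewrite leNgt; apply/negP; rewrite -subr_gt0 => e0.
have [k _ kP] := near_infty_natSinv_lt (PosNum e0).
have /= {}kP := kP k (leqnn k).
have [p /= p0 Mp] := H k I.
have tk : 0 <= t ^+ 2 + k.+1%:R^-1 by rewrite addr_ge0 ?sqr_ge0.
have : singular_value (M w) n <= Num.sqrt (t ^+ 2 + k.+1%:R^-1).
  apply/(least_singular_valueP _ (sqrtr_ge0 _) n_gt0); exists (rat_vec R p) => //.
  by rewrite sqr_sqrtr.
move=> h; have h2 : singular_value (M w) n ^+ 2 <= t ^+ 2 + k.+1%:R^-1.
  rewrite -[leRHS](sqr_sqrtr tk); apply: lerXn2r => //.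
    exact: singular_value_ge0.
  exact: sqrtr_ge0.
by move: kP; rewrite ltrBrDl ltNge h2.
Qed.

Lemma opnorm_entries_le (A : 'M[C]_n) u : opnorm A <= u -> entries_le u A.
Proof.
move=> Au; have u0 : 0 <= u by apply: le_trans Au; exact: singular_value_ge0.
apply/forallP => i; apply/forallP => j.
have := (opnormP A u0 n_gt0).1 Au (delta_mx j 0).
have -> : norm2 (delta_mx j 0 : 'cV[C]_n) = 1.
  rewrite /norm2 (bigD1 j) //= big1 ?addr0; first by rewrite mxE !eqxx cabs1 expr1n.
  by move=> k kj; rewrite mxE (negbTE kj) cabs0 expr0n.
rewrite mulr1 -colE /norm2 (bigD1 i) //= mxE => H.
rewrite -(@ler_pXn2r _ 2) ?nnegrE ?cabs_ge0// (le_trans _ H)// lerDl.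
by apply: sumr_ge0 => k _; rewrite sqr_ge0.
Qed.

Lemma least_singular_value_almost_singular (A : 'M[C]_n) t : 0 <= t ->
  singular_value A n <= t -> almost_singular (n%:R * t) A.
Proof.
move=> t0 /(least_singular_valueP A t0 n_gt0)[x x0 Ax]; apply/asboolP; exists x => //.
have nn : 1 <= n%:R :> R by rewrite ler1n.
have xs : norm2 x <= n%:R * supn x ^+ 2.
  apply: (@le_trans _ _ (\sum_(i < n) supn x ^+ 2)); last first.
    by rewrite sumr_const card_ord mulr_natl.
  by apply: ler_sum => i _; rewrite lerXn2r ?nnegrE ?cabs_ge0 ?supn_ge0 ?supn_ge.
apply: supn_le => [|i]; first by rewrite !mulr_ge0 ?supn_ge0.
rewrite -(@ler_pXn2r _ 2) ?nnegrE ?cabs_ge0 ?mulr_ge0 ?supn_ge0//.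
apply: (@le_trans _ _ (norm2 (A *m x))).
  by rewrite /norm2 (bigD1 i) //= lerDl; apply: sumr_ge0 => k _; rewrite sqr_ge0.
apply: (le_trans Ax); apply: (@le_trans _ _ (t ^+ 2 * (n%:R * supn x ^+ 2))).
  by rewrite ler_wpM2l ?sqr_ge0.
rewrite !exprMn mulrCA mulrA; apply: ler_wpM2r; first exact: sqr_ge0.
by rewrite ler_wpM2r ?sqr_ge0// expr2 ler_peMl.
Qed.

End Measurability.

(** * Anti-concentration of a spread atom *)

(** The inequality contradicting [truncation_variance], with [a] the inverse of
    [kappa] and the radius [s] equal to [a ^+ 2 / 30]. *)
Lemma truncation_numbers (R : realFieldType) (a : R) : 0 < a -> a <= 1 ->
  (27 * (a ^+ 2 / 30) + 2 * (a ^+ 3 / 900)) ^+ 2 +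
  (a / 30 + (18 * (a ^+ 2 / 30) + 2 * (a ^+ 3 / 900)) * (a ^+ 2 / 30)) ^+ 2 < a.
Proof.
move=> a0 a1.
have a2 : a ^+ 2 <= a by rewrite expr2 ler_piMr// ltW.
have a3 : a ^+ 3 <= a by rewrite exprS ler_piMr ?(ltW a0)// (le_trans a2).
have a20 : 0 < a ^+ 2 by rewrite exprn_gt0.
have a30 : 0 < a ^+ 3 by rewrite exprn_gt0.
have sq (x y : R) : 0 <= x -> x <= y -> x ^+ 2 <= y ^+ 2.
  by move=> x0 xy; rewrite lerXn2r// nnegrE (le_trans x0).
move: (a ^+ 2) (a ^+ 3) a2 a3 a20 a30 => u v a2 a3 a20 a30.
have b1 : 27 * (u / 30) + 2 * (v / 900) <= 91 / 100 * a by lra.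
have h1 : 18 * (u / 30) + 2 * (v / 900) <= 61 / 100 by lra.
have h2 : 0 <= 18 * (u / 30) + 2 * (v / 900) by lra.
have u30 : 0 <= u / 30 by lra.
have h3 := ler_wpM2r u30 h1.
have h4 := mulr_ge0 h2 u30.
have b2 : a / 30 + (18 * (u / 30) + 2 * (v / 900)) * (u / 30) <= 6 / 100 * a.
  by move: h3; set X := _ * (u / 30); lra.
have c1 : 0 <= 27 * (u / 30) + 2 * (v / 900) by lra.
have c2 : 0 <= a / 30 + (18 * (u / 30) + 2 * (v / 900)) * (u / 30).
  by move: h4; set X := _ * (u / 30); lra.
apply: (le_lt_trans (lerD (sq _ _ c1 b1) (sq _ _ c2 b2))).
have aa : a * a <= a by rewrite ler_piMr// ltW.
by rewrite !expr2; lra.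
Qed.

Section AntiConcentration.
Variables (R : realType) (d : measure_display) (T : measurableType d) (P : probability T R).
Notation C := R[i].
Local Open Scope classical_set_scope.

Definition integrableR (f : T -> R) := P.-integrable setT (EFin \o f).
Definition mean (f : T -> R) : R := Rintegral P setT f.

Lemma mean_expectation (f : T -> R) : mean f = fine ('E_P[f])%E.
Proof. by rewrite /mean /Rintegral unlock. Qed.

Lemma integrableR_cst a : integrableR (cst a).
Proof. exact: finite_measure_integrable_cst. Qed.

Lemma integrableR_add (f g : T -> R) :
  integrableR f -> integrableR g -> integrableR (fun w => f w + g w).
Proof. by move=> fi gi; exact: (integrableD measurableT fi gi). Qed.

Lemma integrableR_scale k (f : T -> R) : integrableR f -> integrableR (fun w => k * f w).
Proof. by move=> fi; exact: (integrableZl measurableT k fi). Qed.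

Lemma integrableR_le (f g : T -> R) : measurable_fun setT f ->
  (forall w, `|f w| <= g w) -> integrableR g -> integrableR f.
Proof.
move=> mf fg; apply: le_integrable => //; first exact/measurable_EFinP.
by move=> w _ /=; rewrite lee_fin (le_trans (fg w))// ler_norm.
Qed.

(** The common shape of the estimates below: a bound on an event of large
    probability, a cruder one off it, and an integrable correction. *)
Lemma mean_bound (g f : T -> R) (A : set T) (a b : R) :
  integrableR g -> integrableR f -> measurable A ->
  (forall w, g w <= a + b * \1_A w + f w) -> mean g <= a + b * fine (P A) + mean f.
Proof.
move=> ig iff mA gf.
have iA : integrableR (\1_A : T -> R) by exact: integrable_indic.
have ibA : integrableR (fun w => b * \1_A w) by exact: integrableR_scale.
have ia := integrableR_cst a.
have iab : integrableR (fun w => a + b * \1_A w) by exact: integrableR_add.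
have iabf : integrableR (fun w => a + b * \1_A w + f w) by exact: integrableR_add.
apply: (@le_trans _ _ (mean (fun w => a + b * \1_A w + f w))).
  by apply: le_Rintegral.
rewrite /mean RintegralD// RintegralD// Rintegral_cst//.
rewrite (_ : fine (P setT) = 1) ?mulr1; last by rewrite (congr1 fine (probability_setT P)).
rewrite RintegralZl//= lerD2r lerD2l /Rintegral integral_indic// setIT//.
Qed.

Variables (xi : T -> C) (kappa : R).
Hypothesis xi_atom : atom_variable P xi.
Hypothesis xi_spread : spread P kappa xi.

Let mRe : measurable_fun setT (fun w => complex.Re (xi w)).
Proof. by have [m _ _] := xi_atom; exact: (complex_rv_Re m). Qed.

Let mIm : measurable_fun setT (fun w => complex.Im (xi w)).
Proof. by have [m _ _] := xi_atom; exact: (complex_rv_Im m). Qed.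

Lemma measurable_cabs_sqr (X : T -> C) :
  complex_rv X -> measurable_fun setT (fun w => cabs (X w) ^+ 2).
Proof.
move=> mX; under eq_fun do rewrite cabs_sqr.
apply: measurable_funD; apply: measurable_funX.
  exact: (complex_rv_Re mX).
exact: (complex_rv_Im mX).
Qed.

Lemma cabs_leE (z : C) r : 0 <= r -> (cabs z <= r) = (cabs z ^+ 2 <= r ^+ 2).
Proof. by move=> r0; rewrite ler_pXn2r ?nnegrE ?cabs_ge0. Qed.

Lemma cabs_ltE (z : C) r : 0 <= r -> (cabs z < r) = (cabs z ^+ 2 < r ^+ 2).
Proof. by move=> r0; rewrite ltr_pXn2r ?nnegrE ?cabs_ge0. Qed.

Lemma integrable_sqr : integrableR (fun w => cabs (xi w) ^+ 2).
Proof.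
have [m _ e1] := xi_atom; apply/integrableP; split.
  by apply/measurable_EFinP; exact: measurable_cabs_sqr.
move: e1; rewrite unlock => e1.
rewrite (_ : (\int[P]_x _)%E = 1%E) ?ltry// -[RHS]e1.
by apply: eq_integral => w _ /=; rewrite ger0_norm ?sqr_ge0.
Qed.

Lemma mean_sqr : mean (fun w => cabs (xi w) ^+ 2) = 1.
Proof. by have [_ _ e1] := xi_atom; rewrite mean_expectation e1. Qed.

Lemma integrable_part (f : C -> R) :
  measurable_fun setT (f \o xi) -> (forall z, `|f z| <= cabs z) -> integrableR (f \o xi).
Proof.
move=> mf fz; apply: (integrableR_le (g := fun w => 1 + cabs (xi w) ^+ 2)) => //.
  move=> w /=; apply: (le_trans (fz _)); have := cabs_ge0 (xi w); nra.
by apply: integrableR_add; [exact: integrableR_cst|exact: integrable_sqr].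
Qed.

Lemma mean_Re : mean (fun w => complex.Re (xi w)) = 0.
Proof.
by have [_ e0 _] := xi_atom; rewrite mean_expectation; case: e0.
Qed.

Lemma mean_Im : mean (fun w => complex.Im (xi w)) = 0.
Proof.
by have [_ e0 _] := xi_atom; rewrite mean_expectation; case: e0.
Qed.

Lemma mean_scale k (f : T -> R) : integrableR f -> mean (fun w => k * f w) = k * mean f.
Proof. by move=> fi; rewrite /mean RintegralZl. Qed.

Section Ball.
Variables (z : C) (s : R).
Hypothesis s_gt0 : 0 < s.
Let B := [set w | cabs (xi w - z) < s].
Let p := fine (P (~` B)).
Hypothesis p_small : p <= s ^+ 2.

Lemma measurable_ball : measurable B.
Proof.
have [m _ _] := xi_atom.
have mz : complex_rv (fun w => xi w - z).
  rewrite (_ : (fun w => _) = fun w => 1 * xi w + (- z)).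
    exact: complex_rv_affine.
  by apply/funext => w; rewrite mul1r.
rewrite (_ : B = setT `&` [set w | cabs (xi w - z) ^+ 2 < s ^+ 2]).
  rewrite (_ : [set w | _] = ~` [set w | s ^+ 2 <= cabs (xi w - z) ^+ 2]); last first.
    by apply/seteqP; split=> w /=; rewrite leNgt => h; [apply/negP; rewrite negbK|move/negP: h; rewrite negbK].
  rewrite setTI; apply: measurableC; rewrite -[X in measurable X]setTI.
  apply: measurable_fun_le => //; last exact: measurable_cabs_sqr.
by rewrite setTI; apply/seteqP; split=> w; rewrite /B /= cabs_ltE// ltW.
Qed.

Let mBc : measurable (~` B). Proof. exact/measurableC/measurable_ball. Qed.

(** Since [f] has mean [0], bounding it below near [z] bounds [f z] above. Off
    the disc the loss is [cabs z + cabs xi], and the linear term in [xi] is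
    absorbed by the second moment. *)
Lemma part_bound (f : C -> R) : measurable_fun setT (f \o xi) ->
  (forall v, `|f v| <= cabs v) -> (forall u v, f (u - v) = f u - f v) ->
  mean (fun w => f (xi w)) = 0 -> f z <= 2 * s + s ^+ 2 * cabs z.
Proof.
move=> mf fle fB f0; have iff := integrable_part mf fle.
have bound : mean (fun w => -1 * f (xi w)) <=
    (s - f z) + (cabs z + (2 * s)^-1) * p + mean (fun w => (s / 2) * cabs (xi w) ^+ 2).
  apply: mean_bound => //; [exact: integrableR_scale|exact: integrableR_scale integrable_sqr|].
  move=> w; rewrite mulN1r indicE; have c0 := cabs_ge0 (xi w).
  have [wB|wB] := boolP (w \in ~` B); last first.
    have h4 : 0 <= s / 2 * cabs (xi w) ^+ 2 by rewrite mulr_ge0 ?sqr_ge0// divr_ge0// ltW.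
    have wB' : cabs (xi w - z) < s.
      by move: wB; rewrite notin_setE /B /= => /contrapT.
    have := fle (xi w - z); rewrite fB => /ler_normlP[h _].
    by rewrite mulr0 addr0; move: h wB' h4; lra.
  have h1 : - f (xi w) <= cabs (xi w) by rewrite (le_trans _ (fle _))// -normrN ler_norm.
  have h2 : f z <= cabs z by rewrite (le_trans _ (fle _))// ler_norm.
  have h3 : cabs (xi w) <= (2 * s)^-1 + s / 2 * cabs (xi w) ^+ 2.
    have s2 : 0 < 2 * s by rewrite mulr_gt0.
    rewrite -(ler_pM2l s2) mulrDr divff ?lt0r_neq0//.
    have -> : 2 * s * (s / 2 * cabs (xi w) ^+ 2) = (s * cabs (xi w)) ^+ 2 by field.
    by have := sqr_ge0 (s * cabs (xi w) - 1); rewrite !expr2; lra.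
  by rewrite mulr1; move: h1 h2 h3 s_gt0; lra.
have f0' : mean (f \o xi) = 0 := f0.
move: bound; rewrite (mean_scale (-1) iff) f0' mulr0 (mean_scale _ integrable_sqr) mean_sqr.
have pm : (cabs z + (2 * s)^-1) * p <= (cabs z + (2 * s)^-1) * s ^+ 2.
  by rewrite ler_wpM2l// addr_ge0 ?cabs_ge0// invr_ge0 mulr_ge0// ltW.
have e : (2 * s)^-1 * s ^+ 2 = s / 2 by field; rewrite lt0r_neq0.
have pm' : (cabs z + (2 * s)^-1) * p <= cabs z * s ^+ 2 + s / 2.
  by apply: (le_trans pm); rewrite mulrDl e.
by move: pm'; set X := _ * p; lra.
Qed.

(** The four directions [Re], [Im] and their opposites, in [part_bound], bound
    the modulus of [z] by a multiple of [s] plus a small part of itself. *)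
Lemma center_small : s <= 1 / 30 -> cabs z <= 8 * s.
Proof.
move=> s30; have ReB (u v : C) : complex.Re (u - v) = complex.Re u - complex.Re v by case: u; case: v.
have ImB (u v : C) : complex.Im (u - v) = complex.Im u - complex.Im v by case: u; case: v.
have r1 := part_bound mRe (@Re_le_cabs R) ReB mean_Re.
have i1 := part_bound mIm (@Im_le_cabs R) ImB mean_Im.
have r2 : - complex.Re z <= 2 * s + s ^+ 2 * cabs z.
  apply: (part_bound (f := fun v => - complex.Re v)).
  - by apply: measurableT_comp mRe.
  - by move=> v; rewrite normrN Re_le_cabs.
  - by move=> u v; rewrite ReB opprB opprK addrC.
  - have := mean_scale (-1) (integrable_part mRe (@Re_le_cabs R)).
    rewrite mean_Re mulr0 => h; rewrite -[RHS]h; congr mean.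
    by apply/funext => w; rewrite mulN1r.
have i2 : - complex.Im z <= 2 * s + s ^+ 2 * cabs z.
  apply: (part_bound (f := fun v => - complex.Im v)).
  - by apply: measurableT_comp mIm.
  - by move=> v; rewrite normrN Im_le_cabs.
  - by move=> u v; rewrite ImB opprB opprK addrC.
  - have := mean_scale (-1) (integrable_part mIm (@Im_le_cabs R)).
    rewrite mean_Im mulr0 => h; rewrite -[RHS]h; congr mean.
    by apply/funext => w; rewrite mulN1r.
have rr : `|complex.Re z| <= 2 * s + s ^+ 2 * cabs z by rewrite ler_norml; lra.
have ii : `|complex.Im z| <= 2 * s + s ^+ 2 * cabs z by rewrite ler_norml; lra.
have := cabs_le_ReIm z; have := cabs_ge0 z.
have : s ^+ 2 <= 1 / 4 by move: s30 s_gt0; nra.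
by move: rr ii; nra.
Qed.

Let zeta := truncation (cexpectation P xi) kappa xi.

Let zetaE w : zeta w = if cabs (xi w) <= kappa then xi w else 0.
Proof. by have [_ e0 _] := xi_atom; rewrite /zeta /truncation e0 subr0. Qed.

Lemma kappa_ge1 : 1 <= kappa. Proof. by have [] := xi_spread. Qed.

Let k0 : 0 <= kappa. Proof. exact: le_trans kappa_ge1. Qed.

Lemma truncation_rv : complex_rv zeta.
Proof.
have [m _ _] := xi_atom.
have mc : measurable_fun setT (fun w => cabs (xi w) <= kappa).
  rewrite (_ : (fun w => _) = fun w => cabs (xi w) ^+ 2 <= kappa ^+ 2).
    apply: measurable_fun_ler; first exact: measurable_cabs_sqr.
    exact: measurable_cst.
  by apply/funext => w; rewrite cabs_leE.
apply: complex_rvP.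
  rewrite (_ : _ \o _ = fun w => if cabs (xi w) <= kappa then complex.Re (xi w) else 0).
    by apply: measurable_fun_ifT => //; exact: measurable_cst.
  by apply/funext => w /=; rewrite zetaE; case: ifP.
rewrite (_ : _ \o _ = fun w => if cabs (xi w) <= kappa then complex.Im (xi w) else 0).
  by apply: measurable_fun_ifT => //; exact: measurable_cst.
by apply/funext => w /=; rewrite zetaE; case: ifP.
Qed.

Hypothesis s_small : s <= 1 / 30.

(** The truncated variable is small on the disc because the disc is near the
    origin, by [center_small]. *)
Lemma truncation_bound w : cabs (zeta w) <= 9 * s + kappa * \1_(~` B) w.
Proof.
rewrite indicE; have [wB|wB] := boolP (w \in ~` B).
  rewrite mulr1; apply: ler_wpDl; first by rewrite mulr_ge0// ltW.
  by rewrite zetaE; case: ifP => // _; rewrite cabs0.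
have wB' : cabs (xi w - z) < s by move: wB; rewrite notin_setE /B /= => /contrapT.
have := cabsD (xi w - z) z; rewrite subrK; have := center_small s_small.
rewrite mulr0 addr0 zetaE; case: ifP => _; last first.
  by rewrite cabs0 => _ _; rewrite mulr_ge0// ltW.
by move: wB'; lra.
Qed.

Lemma truncation_le w : cabs (zeta w) <= kappa.
Proof. by rewrite zetaE; case: ifP => // _; rewrite cabs0. Qed.

Lemma truncation_part_mean (f : C -> R) : measurable_fun setT (f \o zeta) ->
  (forall v, `|f v| <= cabs v) -> (forall v, f (- v) = - f v) ->
  `|mean (f \o zeta)| <= 9 * s + kappa * s ^+ 2.
Proof.
move=> mf fle fN.
have iff : integrableR (f \o zeta).
  apply: (integrableR_le (g := cst kappa)) => //; last exact: integrableR_cst.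
  by move=> w /=; rewrite (le_trans (fle _))// truncation_le.
have m0 : mean (cst 0) = 0 by rewrite /mean Rintegral_cst// mul0r.
have kp : kappa * p <= kappa * s ^+ 2 by rewrite ler_wpM2l.
have up : mean (f \o zeta) <= 9 * s + kappa * p + mean (cst 0).
  apply: mean_bound => //; first exact: integrableR_cst.
  move=> w /=; rewrite addr0; apply: le_trans (truncation_bound w).
  by rewrite (le_trans _ (fle _))// ler_norm.
have lo : mean (fun w => -1 * (f \o zeta) w) <= 9 * s + kappa * p + mean (cst 0).
  apply: mean_bound => //; [exact: integrableR_scale|exact: integrableR_cst|].
  move=> w /=; rewrite addr0 mulN1r; apply: le_trans (truncation_bound w).
  by rewrite (le_trans _ (fle _))// -normrN ler_norm.
move: up lo; rewrite (mean_scale (-1) iff) m0 ler_norml; move: kp; lra.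
Qed.

(** The truncated atom is of order [s] on the disc and at most [kappa] off it,
    an event of probability at most [s ^+ 2]; so is its distance to its mean. *)
Lemma truncation_variance :
  kappa^-1 <= (27 * s + 2 * kappa * s ^+ 2) ^+ 2 +
    (kappa + 18 * s + 2 * kappa * s ^+ 2) ^+ 2 * s ^+ 2.
Proof.
pose c := cexpectation P zeta.
have mz := truncation_rv.
have cle : cabs c <= 18 * s + 2 * kappa * s ^+ 2.
  have r := truncation_part_mean (f := @complex.Re R) (complex_rv_Re mz) (@Re_le_cabs R)
    (fun v => match v with Complex a b => erefl end).
  have i := truncation_part_mean (f := @complex.Im R) (complex_rv_Im mz) (@Im_le_cabs R)
    (fun v => match v with Complex a b => erefl end).
  move: r i; rewrite !mean_expectation => r i.
  by have := cabs_le_ReIm c; rewrite /c /cexpectation /=; move: r i; rewrite /=; lra.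
have mzc : complex_rv (fun w => zeta w - c).
  rewrite (_ : (fun w => _) = fun w => 1 * zeta w + (- c)); first exact: complex_rv_affine.
  by apply/funext => w; rewrite mul1r.
have zc w : cabs (zeta w - c) <= cabs (zeta w) + cabs c.
  by rewrite (le_trans (cabsD _ _))// cabsN.
have iv : integrableR (fun w => cabs (zeta w - c) ^+ 2).
  apply: (integrableR_le (g := cst ((kappa + cabs c) ^+ 2))); last exact: integrableR_cst.
    exact: measurable_cabs_sqr.
  move=> w /=; rewrite ger0_norm ?sqr_ge0// lerXn2r ?nnegrE ?cabs_ge0//.
    by rewrite addr_ge0 ?cabs_ge0.
  by rewrite (le_trans (zc w))// lerD2r truncation_le.
have vk : kappa^-1 <= mean (fun w => cabs (zeta w - c) ^+ 2).
  have [_] := xi_spread; rewrite /cvariance -/zeta -/c.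
  rewrite mean_expectation -lee_fin fineK// unlock; exact: integrable_fin_num.
apply: (le_trans vk).
pose Mc := 18 * s + 2 * kappa * s ^+ 2.
have m0 : mean (cst 0) = 0 by rewrite /mean Rintegral_cst// mul0r.
have Mc0 : 0 <= Mc by apply: le_trans cle; exact: cabs_ge0.
have : mean (fun w => cabs (zeta w - c) ^+ 2) <=
    (9 * s + Mc) ^+ 2 + (kappa + Mc) ^+ 2 * p + mean (cst 0).
  apply: mean_bound => //; first exact: integrableR_cst.
  move=> w /=; rewrite addr0 indicE; have := truncation_bound w; rewrite indicE.
  have [wB|wB] := boolP (w \in ~` B) => zw.
    rewrite mulr1; apply: ler_wpDl; first exact: sqr_ge0.
    apply: lerXn2r; rewrite ?nnegrE ?cabs_ge0 ?(addr_ge0 k0 Mc0)//.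
    by apply: (le_trans (zc w)); apply: lerD => //; exact: truncation_le.
  have s90 : 0 <= 9 * s by rewrite mulr_ge0// ltW.
  rewrite mulr0 addr0; apply: lerXn2r; rewrite ?nnegrE ?cabs_ge0 ?(addr_ge0 s90 Mc0)//.
  apply: (le_trans (zc w)); apply: lerD => //.
  by move: zw; rewrite mulr0 addr0.
have : (kappa + Mc) ^+ 2 * p <= (kappa + Mc) ^+ 2 * s ^+ 2 by rewrite ler_wpM2l ?sqr_ge0.
rewrite m0 addr0.
rewrite (_ : 27 * s + 2 * kappa * s ^+ 2 = 9 * s + Mc); last by rewrite /Mc; lra.
rewrite (_ : kappa + 18 * s + 2 * kappa * s ^+ 2 = kappa + Mc); last by rewrite /Mc; lra.
lra.
Qed.

End Ball.

(** If a small disc had almost full mass, the vanishing mean would put it near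
    the origin, and the truncated atom would keep less variance than [spread]
    requires. *)
Lemma anti_concentration z (s := (30 * kappa ^+ 2)^-1) :
  fine (P [set w | cabs (xi w - z) < s]) <= 1 - s ^+ 2.
Proof.
have k1 := kappa_ge1.
have k0 : 0 < kappa by exact: lt_le_trans k1.
pose a := kappa^-1.
have a0 : 0 < a by rewrite invr_gt0.
have a1 : a <= 1 by rewrite invf_le1.
have ka : kappa * a = 1 by rewrite divff// gt_eqF.
have sa : s = a ^+ 2 / 30 by rewrite /s invfM exprVn mulrC.
have s0 : 0 < s by rewrite sa divr_gt0// exprn_gt0.
have s30 : s <= 1 / 30 by rewrite sa; move: a0 a1; nra.
rewrite leNgt; apply/negP => Pbig.
have mB := measurable_ball z s0.
have p_small : fine (P (~` [set w | cabs (xi w - z) < s])) <= s ^+ 2.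
  have Pf : P [set w | cabs (xi w - z) < s] \is a fin_num by exact: fin_num_measure.
  by rewrite (probability_setC P mB) fineB//=; move: Pbig; lra.
have := truncation_variance s0 p_small s30; apply/negP; rewrite -ltNge -/a.
have ks : kappa * s ^+ 2 = a ^+ 3 / 900.
  have gen (x y : R) : x * y = 1 -> x * (y ^+ 2 / 30) ^+ 2 = y ^+ 3 / 900.
    move=> xy; have -> : x * (y ^+ 2 / 30) ^+ 2 = (x * y) * (y ^+ 3 / 900) by field.
    by rewrite xy mul1r.
  by rewrite sa gen.
have k2 : (kappa + 18 * s + 2 * kappa * s ^+ 2) ^+ 2 * s ^+ 2 =
    (a / 30 + (18 * s + 2 * (a ^+ 3 / 900)) * s) ^+ 2.
  rewrite -exprMn; congr (_ ^+ 2); rewrite -(mulrA 2) ks.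
  have -> : a / 30 = kappa * s.
    rewrite sa; have -> : kappa * (a ^+ 2 / 30) = (kappa * a) * (a / 30) by ring.
    by rewrite ka mul1r.
  by ring.
rewrite k2 -(mulrA 2) ks sa.
exact: truncation_numbers.
Qed.

End AntiConcentration.

(** * Discretization of the atom *)

Section FiniteValued.
Variables (R : realType) (d : measure_display) (T : measurableType d) (P : probability T R).
Local Open Scope classical_set_scope.

Lemma probability_mem (V : eqType) (X : T -> V) (r : seq V) : uniq r ->
  (forall v, measurable [set w | X w = v]) ->
  measurable [set w | X w \in r] /\
  P [set w | X w \in r] = (\sum_(v <- r) P [set w | X w = v])%E.
Proof.
move=> + mX; elim: r => [_|v r IH /= /andP[vr /IH[mr er]]].
  rewrite big_nil (_ : [set w | _] = set0) ?measure0//.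
  by apply/seteqP; split=> w.
have e : [set w | X w \in v :: r] = [set w | X w = v] `|` [set w | X w \in r].
  apply/seteqP; split=> w /=; rewrite inE.
    by move=> /orP[/eqP|]; [left|right].
  by move=> [->|->]; rewrite ?eqxx ?orbT.
rewrite e; split; first exact: measurableU.
rewrite measureU// ?big_cons -?er//.
by apply/seteqP; split=> w //= [-> xr]; move: vr; rewrite xr.
Qed.

Lemma union_bound (J : Type) (r : seq J) (F : J -> set T) :
  (forall j, measurable (F j)) ->
  measurable (\big[setU/set0]_(j <- r) F j) /\
  (P (\big[setU/set0]_(j <- r) F j) <= \sum_(j <- r) P (F j))%E.
Proof.
move=> mF; elim: r => [|j r [mr er]]; first by rewrite !big_nil measure0.
rewrite !big_cons; split; first exact: measurableU.
by apply: (le_trans (measureU2 _ _ _)) => //; rewrite leeD2l.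
Qed.

End FiniteValued.

Section Discretization.
Variables (R : realType) (eta : R) (N : nat).
Hypothesis eta_gt0 : 0 < eta.
Local Open Scope classical_set_scope.
Notation C := R[i].
Notation cellT := ('I_(2 * N) * 'I_(2 * N))%type.
Notation V := (option cellT).

Let H := N%:R * eta.

Definition corner (a : nat) : R := a%:R * eta - H.

Definition in_cell (ab : cellT) (u : R * R) : bool :=
  [&& corner ab.1 <= u.1, u.1 < corner ab.1.+1, corner ab.2 <= u.2 & u.2 < corner ab.2.+1].

(** Rounding to a grid of mesh [eta] covering the square of half-side [N * eta];
    points outside the square are sent to [None]. *)
Definition disc (u : R * R) : V := [pick ab | in_cell ab u].

Definition cell_value (v : V) : C :=
  if v is Some ab then Complex (corner ab.1) (corner ab.2) else 0.

Lemma cornerS a : corner a.+1 = corner a + eta.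
Proof. by rewrite /corner -natr1 mulrDl mul1r addrAC. Qed.

Lemma corner_unique (a b : nat) x :
  corner a <= x -> x < corner a.+1 -> corner b <= x -> x < corner b.+1 -> a = b.
Proof.
have h (m k : nat) : corner m < corner k -> (m < k)%N.
  by rewrite /corner ltrD2r ltr_pM2r// ltr_nat.
move=> a1 a2 b1 b2.
have ab := h _ _ (le_lt_trans a1 b2).
have ba := h _ _ (le_lt_trans b1 a2).
by apply/eqP; rewrite eqn_leq -ltnS ab -ltnS ba.
Qed.

Lemma discP u ab : (disc u = Some ab) <-> in_cell ab u.
Proof.
rewrite /disc; case: pickP => [cd cdu|none]; last by split=> // ; rewrite none.
split=> [[<-]//|/and4P[a1 a2 b1 b2]]; congr Some.
have /and4P[c1 c2 d1 d2] := cdu.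
case: ab a1 a2 b1 b2 => a b /= a1 a2 b1 b2; case: cd c1 c2 d1 d2 {cdu} => c e /= c1 c2 d1 d2.
by congr pair; apply/val_inj/corner_unique; eassumption.
Qed.

Lemma disc_close (u : R * R) ab : disc u = Some ab ->
  cabs (Complex u.1 u.2 - cell_value (disc u)) <= 2 * eta.
Proof.
move=> du; rewrite du /=; have /discP/and4P[a1 a2 b1 b2] := du.
apply: (le_trans (cabs_le_ReIm _)) => /=.
rewrite !ger0_norm ?subr_ge0//.
by move: a2 b2; rewrite !cornerS; lra.
Qed.

Lemma corner_index x : - H <= x -> x < H ->
  exists a : 'I_(2 * N), corner a <= x /\ x < corner a.+1.
Proof.
move=> x1 x2; pose a := Num.truncn ((x + H) / eta).
have x0 : 0 <= (x + H) / eta by apply: divr_ge0; [lra|exact: ltW].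
have a1 : a%:R <= (x + H) / eta by rewrite truncn_le.
have a2 : (x + H) / eta < a.+1%:R by exact: truncnS_gt.
have aN : (a < 2 * N)%N.
  rewrite -(ltr_nat R) (le_lt_trans a1)// ltr_pdivrMr//.
  have -> : (2 * N)%:R * eta = H + H by rewrite /H natrM; ring.
  by rewrite ltrD2r.
exists (Ordinal aN); rewrite /corner /=; split.
  by move: a1; rewrite ler_pdivlMr// lerBlDr.
by move: a2; rewrite ltr_pdivrMr// ltrBrDr.
Qed.

Lemma disc_None u : disc u = None -> H <= `|u.1| \/ H <= `|u.2|.
Proof.
move=> du; have [h1|h1] := leP H `|u.1|; first by left.
have [h2|h2] := leP H `|u.2|; first by right.
move: h1 h2; rewrite !ltr_norml => /andP[x1 x2] /andP[y1 y2].
have [a [a1 a2]] := corner_index (ltW x1) x2.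
have [b [b1 b2]] := corner_index (ltW y1) y2.
have : in_cell (a, b) u by rewrite /in_cell /= a1 a2 b1 b2.
by move/discP; rewrite du.
Qed.

Lemma measurable_disc v : measurable [set u : R * R | disc u = v].
Proof.
have mcell ab : measurable [set u : R * R | disc u = Some ab].
  rewrite (_ : [set u | _] = (fst @^-1` `[corner ab.1, corner ab.1.+1[) `&`
      (snd @^-1` `[corner ab.2, corner ab.2.+1[)).
    apply: measurableI; rewrite -[X in measurable X]setTI.
      by apply: measurable_fst => //; exact: measurable_itv.
    by apply: measurable_snd => //; exact: measurable_itv.
  apply/seteqP; split=> u /=; rewrite !in_itv /=.
    by move=> /discP/and4P[-> -> -> ->].
  by move=> [/andP[h1 h2] /andP[h3 h4]]; apply/discP; rewrite /in_cell h1 h2 h3 h4.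
case: v => [ab|]; first exact: mcell.
rewrite (_ : [set u | _] = ~` \bigcup_ab [set u | disc u = Some ab]).
  by apply: measurableC; apply: countable_bigcupT_measurable => //; exact: countableP.
apply/seteqP; split=> u /=; first by move=> h [ab _ /=]; rewrite h.
by case du: (disc u) => [ab|//] H1; case: H1; exists ab.
Qed.

End Discretization.

(** * Transfer to the finite model *)

Section Law.
Variables (R : realType) (d : measure_display) (T : measurableType d) (P : probability T R).
Variables (X : T -> R[i]) (V : finType) (D : R * R -> V).
Hypothesis X_rv : complex_rv X.
Hypothesis D_meas : forall v, measurable [set u | D u = v]%classic.
Local Open Scope classical_set_scope.

Definition law v : R := fine (P (cevent X [set u | D u = v])).

Lemma measurable_cevent (E : set (R * R)) : measurable E -> measurable (cevent X E).
Proof. by move=> mE; have := X_rv measurableT mE; rewrite setTI. Qed.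

Lemma lawE v : (law v)%:E = P (cevent X [set u | D u = v]).
Proof. by rewrite fineK// fin_num_measure//; exact: measurable_cevent. Qed.

Lemma law_ge0 v : 0 <= law v.
Proof. by rewrite fine_ge0. Qed.

Lemma law_mem (S : pred V) :
  measurable [set w | S (D (cpair (X w)))] /\
  \sum_v law v * (S v)%:R = fine (P [set w | S (D (cpair (X w)))]).
Proof.
have [mS eS] := @probability_mem R d T P V (fun w => D (cpair (X w))) (enum S)
  (enum_uniq S) (fun v => measurable_cevent (D_meas v)).
have e : [set w | D (cpair (X w)) \in enum S] = [set w | S (D (cpair (X w)))].
  by apply/seteqP; split=> w /=; rewrite mem_enum.
rewrite -e; split=> //; rewrite eS.
rewrite (eq_bigr (fun v => (law v)%:E)); last by move=> v _; rewrite lawE.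
rewrite sumEFin /= big_enum [RHS]big_mkcond /=; apply: eq_bigr => v _.
by rewrite unfold_in; case: (S v); rewrite ?mulr1 ?mulr0.
Qed.

Lemma law_sum : \sum_v law v = 1.
Proof.
have [_] := law_mem predT; rewrite (_ : [set w | _] = setT).
  by rewrite probability_setT /= => <-; apply: eq_bigr => v _; rewrite mulr1.
by apply/seteqP; split.
Qed.

End Law.

Section Transfer.
Variables (R : realType) (d d' : measure_display) (T : measurableType d)
  (T' : measurableType d') (P : probability T R) (P' : probability T' R).
Variables (I V : finType) (X : I -> T -> R[i]) (xi : T' -> R[i]) (D : R * R -> V).
Hypothesis X_rv : forall p, complex_rv (X p).
Hypothesis xi_rv : complex_rv xi.
Hypothesis X_ind : mutually_independent P X.
Hypothesis X_law : forall p, same_law P P' (X p) xi.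
Hypothesis D_meas : forall v, measurable [set u | D u = v]%classic.
Local Open Scope classical_set_scope.

(** The matrices of discretized entries are finite in number, and independence
    gives each of them its weight in the product space. The value [v0], which
    stands for the points off the grid, is dealt with by a union bound. *)
Lemma law_transfer (E : set T) (v0 : V) (bad : {ffun I -> V} -> bool) :
  measurable E ->
  (forall w, E w -> (exists p, D (cpair (X p w)) = v0) \/
                    bad [ffun p => D (cpair (X p w))]) ->
  (P E <= (#|I|%:R * law P' xi D v0 + Pr (law P' xi D) bad)%:E)%E.
Proof.
move=> mE Ecover.
pose level p v := cevent (X p) [set u | D u = v].
have mlevel p v : measurable (level p v) by exact: measurable_cevent.
have Plevel p v : P (level p v) = (law P' xi D v)%:E by rewrite lawE// X_law.
pose cyl (om : {ffun I -> V}) := [set w | forall p, p \in [set: I]%SET -> level p (om p) w].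
have Pcyl om : P (cyl om) = (wt (law P' xi D) om)%:E.
  rewrite (X_ind _ (fun p => D_meas (om p))) /wt -prodEFin.
  by apply: eq_big => [p|p _]; rewrite ?inE// -/(level _ _) Plevel.
have mcyl om : measurable (cyl om).
  rewrite (_ : cyl om = \bigcap_p level p (om p)).
    by apply: fin_bigcap_measurable => //; exact: finite_finset.
  by apply/seteqP; split=> w /= h p; [move=> _; apply: h; rewrite inE|move=> _; exact: h].
have [mA PA] := union_bound P (enum I) (fun p => mlevel p v0).
have [mB PB] := union_bound P (enum bad) mcyl.
apply: (@le_trans _ _ (P ((\big[setU/set0]_(p <- enum I) level p v0) `|`
                          (\big[setU/set0]_(om <- enum bad) cyl om)))).
  apply: le_measure; rewrite ?inE//; first exact: measurableU.
  move=> w /Ecover[[p pv]|wbad]; [left|right].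
    by rewrite -bigcup_seq; exists p => //=; rewrite mem_enum.
  rewrite -bigcup_seq; exists [ffun p => D (cpair (X p w))] => /=; first by rewrite mem_enum.
  by move=> p _; rewrite /level /cevent /= ffunE.
apply: (le_trans (measureU2 _ mA mB)); rewrite EFinD; apply: leeD.
  apply: (le_trans PA); rewrite big_enum (eq_bigr (fun=> (law P' xi D v0)%:E)) => [|p _].
    by rewrite sumEFin lee_fin sumr_const mulr_natl.
  by rewrite Plevel.
apply: (le_trans PB); rewrite big_enum (eq_bigr (fun om => (wt (law P' xi D) om)%:E)) => [|om _].
  rewrite sumEFin lee_fin big_mkcond /=; apply: ler_sum => om _.
  by rewrite unfold_in; case: (bad om); rewrite ?mulr1 ?mulr0.
by rewrite Pcyl.
Qed.

End Transfer.

(** Integrate [1 <= cabs xi ^+ 2 / h ^+ 2] over the event. *)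
Lemma chebyshev_modulus (R : realType) (d : measure_display) (T : measurableType d)
    (P : probability T R) (xi : T -> R[i]) (h : R) :
  atom_variable P xi -> 0 < h ->
  measurable [set w | h <= cabs (xi w)]%classic /\
  fine (P [set w | h <= cabs (xi w)]%classic) <= h ^- 2.
Proof.
move=> xi_atom h0; set A := [set w | _]%classic.
have mA : measurable A.
  rewrite (_ : A = ~` [set w | cabs (xi w - 0) < h])%classic.
    by apply: measurableC; have m := measurable_ball xi_atom 0 h0; exact m.
  by apply/seteqP; split=> w; rewrite /A /= subr0 leNgt => /negP.
split=> //.
have ch : mean P (cst 0) <= 0 + - h ^+ 2 * fine (P A) + mean P (fun w => cabs (xi w) ^+ 2).
  apply: mean_bound => //; [exact: integrableR_cst|exact: integrable_sqr|].
  move=> w; rewrite add0r indicE.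
  have [/set_mem wA|_] := boolP (w \in A).
    by rewrite mulr1 addrC subr_ge0 ler_pXn2r// ?nnegrE ?cabs_ge0// ltW.
  by rewrite mulr0 add0r sqr_ge0.
move: ch; rewrite (mean_sqr xi_atom) /mean Rintegral_cst// mul0r add0r.
by rewrite mulNr addrC subr_ge0 -ler_pdivlMl ?exprn_gt0// mulr1.
Qed.

Section Perturbation.
Variable R : realType.
Notation C := R[i].

(** The vector is kept; the sup norm of its image moves by at most [n e]. *)
Lemma almost_singular_perturb n (M M' : 'M[C]_n) tau e : 0 <= e ->
  (forall i j, cabs (M' i j - M i j) <= e) ->
  almost_singular tau M -> almost_singular (tau + n%:R * e) M'.
Proof.
move=> e0 close /asboolP[x x0 Mx]; apply/asboolP; exists x => //.
have -> : M' *m x = M *m x + (M' - M) *m x by rewrite -mulmxDl addrC subrK.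
rewrite mulrDl (le_trans (supnD _ _))// lerD//.
by apply: supn_mulmx => // i j; rewrite !mxE.
Qed.

(** With [x = n] and [a = n ^ gamma], this says that the least singular value
    in question and the rounding error together stay below the threshold of
    the finite model. *)
Lemma scale_comparison (x a eta : R) : 2 <= x -> 1 <= a ->
  eta <= x ^- 24 / (a + 1) ^+ 4 / (4 * x) ->
  x * (x ^+ 30 * a ^+ 4)^-1 + x * (2 * eta) <= x ^- 24 / (a + 1) ^+ 4.
Proof.
move=> x2 a1; set tau := x ^- 24 / _ => he.
have x0 : 0 < x by lra.
have a0 : 0 < a by lra.
have h1 : x * (2 * eta) <= tau / 2.
  apply: (@le_trans _ _ (x * (2 * (tau / (4 * x))))).
    by rewrite ler_pM2l// ler_pM2l.
  by rewrite le_eqVlt; apply/orP; left; apply/eqP; field; lra.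
have -> : x * (x ^+ 30 * a ^+ 4)^-1 = x ^- 24 * (x ^+ 5 * a ^+ 4)^-1.
  by field; rewrite !gt_eqF.
have h2 : x ^- 24 * (x ^+ 5 * a ^+ 4)^-1 <= tau / 2.
  rewrite /tau -mulrA ler_pM2l ?invr_gt0 ?exprn_gt0// -invfM lef_pV2 ?posrE; last 2 first.
  - by rewrite mulr_gt0 ?exprn_gt0.
  - by rewrite mulr_gt0 ?exprn_gt0//; lra.
  have x5 : (2 : R) ^+ 5 <= x ^+ 5 by rewrite ler_pXn2r ?nnegrE//; lra.
  have a4 : (a + 1) ^+ 4 <= (2 * a) ^+ 4 by rewrite ler_pXn2r ?nnegrE//; lra.
  have b0 : 0 < a ^+ 4 by rewrite exprn_gt0.
  have h32 : (2 : R) ^+ 5 = 32 by ring.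
  rewrite h32 in x5.
  have h16 : (2 * a) ^+ 4 = 16 * a ^+ 4 by ring.
  rewrite h16 in a4.
  have : 32 * a ^+ 4 <= x ^+ 5 * a ^+ 4 by rewrite ler_pM2r.
  by lra.
by lra.
Qed.

End Perturbation.

Section DiscreteAtom.
Variables (R : realType) (d : measure_display) (T : measurableType d) (P : probability T R).
Variables (xi : T -> R[i]) (kappa eta : R) (N : nat).
Hypothesis xi_atom : atom_variable P xi.
Hypothesis xi_spread : spread P kappa xi.
Hypothesis eta_gt0 : 0 < eta.
Local Notation D := (@disc R eta N).
Local Notation s := (30 * kappa ^+ 2)^-1.

Lemma cpairK (z : R[i]) : Complex (cpair z).1 (cpair z).2 = z.
Proof. by case: z. Qed.

Let xi_rv : complex_rv xi. Proof. by have [] := xi_atom. Qed.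

Lemma law_None : 0 < N%:R * eta -> law P xi D None <= (N%:R * eta) ^- 2.
Proof.
move=> H0; have [mA PA] := chebyshev_modulus xi_atom H0.
apply: le_trans PA; apply: fine_le; rewrite ?fin_num_measure//.
  exact: (measurable_cevent xi_rv (measurable_disc eta_gt0 None)).
apply: le_measure; rewrite ?inE//.
  exact: (measurable_cevent xi_rv (measurable_disc eta_gt0 None)).
move=> w /= /(disc_None eta_gt0)[|] h; apply: (le_trans h).
  exact: Re_le_cabs.
exact: Im_le_cabs.
Qed.

(** Rounding moves points by less than half the radius, except with the small
    probability of falling off the grid. *)
Lemma disc_spread (z : R[i]) : 2 * eta <= s / 2 -> 2 / s <= N%:R * eta ->
  \sum_v law P xi D v * (cabs (cell_value eta v - z) < s / 2)%R%:R <= 1 - s ^+ 2 / 2.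
Proof.
move=> es Hs.
have k0 : 0 < kappa by apply: lt_le_trans (kappa_ge1 xi_spread).
have s0 : 0 < s by rewrite invr_gt0 mulr_gt0 ?exprn_gt0.
have H0 : 0 < N%:R * eta by apply: lt_le_trans Hs; rewrite divr_gt0.
have mD := measurable_disc (N := N) eta_gt0.
pose S := fun v => cabs (@cell_value R eta N v - z) < s / 2.
have [mS ->] := law_mem P xi_rv mD S.
have mB := measurable_ball xi_atom z s0.
have mN := measurable_cevent xi_rv (mD None).
have anti := anti_concentration xi_atom xi_spread z.
have none : law P xi D None <= s ^+ 2 / 2.
  apply: (le_trans (law_None H0)).
  apply: (@le_trans _ _ ((2 / s) ^- 2)).
    have ds0 : 0 < 2 / s by exact: divr_gt0.
    rewrite lef_pV2 ?posrE; [|exact: exprn_gt0|exact: exprn_gt0].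
    by rewrite ler_pXn2r ?nnegrE//; exact: ltW.
  have -> : (2 / s) ^- 2 = s ^+ 2 / 4 by field; rewrite gt_eqF.
  by have := sqr_ge0 s; lra.
suff : fine (P [set w | S (D (cpair (xi w)))]%classic) <=
    fine (P [set w | cabs (xi w - z) < s]%classic) + law P xi D None.
  by move: anti none; cbv zeta; lra.
rewrite -lee_fin EFinD lawE// !fineK ?fin_num_measure//.
apply: le_trans (measureU2 _ mB mN).
apply: le_measure; rewrite ?inE//; first exact: measurableU.
move=> w; rewrite /S /= => Sw.
case Dw: (D (cpair (xi w))) => [ab|]; [left|by right].
have := disc_close eta_gt0 Dw; rewrite cpairK => cl.
have -> : xi w - z = (xi w - cell_value eta (D (cpair (xi w)))) +
    (cell_value eta (D (cpair (xi w))) - z) by ring.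
apply: le_lt_trans (cabsD _ _) _.
by move: Sw cl es; lra.
Qed.

End DiscreteAtom.

(** * From the structured matrix to the finite model *)

Section Regularity.
Import mathcomp.boot.finset.
Variables (R : realType) (n : nat) (A : 'M[R]_n) (sigma : R).
Hypothesis sigma_gt0 : 0 < sigma.

Lemma cutoff_gt0 i j : (0 < cutoff A sigma i j) = (sigma <= A i j).
Proof.
rewrite mxE; case: (leP sigma (A i j)) => h; last by rewrite ltxx.
exact: lt_le_trans h.
Qed.

Lemma row_nbhd_cutoff i : row_nbhd (cutoff A sigma) i = nbr (fun i j => A i j) sigma i.
Proof. by apply/setP => j; rewrite !inE cutoff_gt0. Qed.

Lemma row_nbhd_cutoff_tr j : row_nbhd (cutoff A sigma)^T j = [set i | sigma <= A i j].
Proof. by apply/setP => i; rewrite !inE mxE cutoff_gt0. Qed.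

Lemma edge_count_cutoff (S L : {set 'I_n}) : edge_count (cutoff A sigma) S L =
  (\sum_(i in S) #|L :&: nbr (fun i j => A i j) sigma i|)%N.
Proof.
rewrite /edge_count -sum1_card.
under [RHS]eq_bigr do rewrite -sum1_card.
rewrite pair_big_dep /=; apply: eq_bigl => -[i j].
rewrite [in RHS]inE [in RHS]inE -cutoff_gt0.
by apply/asboolP/idP.
Qed.

End Regularity.

Section FixedSize.
Variables (R : realType) (n : nat) (A : 'M[R]_n) (B : 'M[R[i]]_n).
Variables (d d' : measure_display) (T : measurableType d) (T' : measurableType d').
Variables (P : probability T R) (P' : probability T' R).
Variables (X : 'I_n * 'I_n -> T -> R[i]) (xi : T' -> R[i]).
Hypothesis n_gt1 : (1 < n)%N.
Hypothesis A01 : forall i j, 0 <= A i j <= 1.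
Hypothesis xi_atom : atom_variable P' xi.
Hypothesis X_iid : iid_entries P P' X xi.
Notation M := (structured_matrix A B X).

Let n_gt0 : (0 < n)%N := ltnW n_gt1.

Lemma measurable_bad_event (t u : R) : 0 <= t -> 0 <= u ->
  measurable [set w | singular_value (M w) n <= t /\ opnorm (M w) <= u]%classic.
Proof.
move=> t0 u0.
have mM i j : complex_rv (fun w => M w i j).
  rewrite (_ : (fun w => _) = (fun w => (A i j)%:C%C * X (i, j) w + B i j)).
    by apply: complex_rv_affine; have [] := X_iid.
  by apply/funext => w; rewrite mxE.
rewrite (_ : [set w | _]%classic =
    ([set w | singular_value (M w) n <= t] `&` [set w | opnorm (M w) <= u])%classic).
  apply: measurableI.
    exact: (measurable_least_singular_value_le mM n_gt0 t0).
  exact: (measurable_opnorm_le mM n_gt0 u0).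
by apply/seteqP; split.
Qed.

(** If no entry falls off the grid, rounding changes each entry of the matrix
    by at most [2 * eta], and the two constraints survive in sup-norm form. *)
Lemma discretized_bound (eta t u tau : R) (N : nat) : 0 < eta -> 2 * eta <= 1 ->
  0 <= t -> 0 <= u -> n%:R * t + n%:R * (2 * eta) <= tau ->
  let mu := law P' xi (@disc R eta N) in
  (P [set w | (singular_value (M w) n <= t)%R /\ (opnorm (M w) <= u)%R]%classic <=
   ((n ^ 2)%N%:R * mu None +
     Pr mu (fun om => let M := rmx (@cell_value R eta N) (fun i j => (i, j))
                                (fun i j => A i j) B om in
            entries_le (u + 1) M && almost_singular tau M))%R%:E)%E.
Proof.
move=> eta0 eta1 t0 u0 htau /=.
have [X_rv X_ind X_law] := X_iid.
have xi_rv : complex_rv xi by have [] := xi_atom.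
have -> : (n ^ 2)%:R = #|{: 'I_n * 'I_n}|%:R :> R.
  by rewrite card_prod card_ord mulnn.
apply: (law_transfer X_rv xi_rv X_ind X_law (measurable_disc eta0)).
  exact: measurable_bad_event.
move=> w [sw uw].
have [/existsP[p /eqP pN]|noN] := boolP [exists p, disc eta N (cpair (X p w)) == None].
  by left; exists p.
right; set om := [ffun p => _].
set M' := rmx _ _ _ _ _.
have close i j : cabs (M' i j - M w i j) <= 2 * eta.
  rewrite !mxE ffunE; set z := X (i, j) w.
  have : disc eta N (cpair z) != None.
    by apply: contra noN => h; apply/existsP; exists (i, j).
  case Dz: (disc eta N (cpair z)) => [ab|//] _.
  have := disc_close eta0 Dz; rewrite cpairK Dz => cl.
  have -> : (A i j)%:C%C * cell_value eta (Some ab) + B i j - ((A i j)%:C%C * z + B i j) =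
      (A i j)%:C%C * (cell_value eta (Some ab) - z) by ring.
  have /andP[a0 a1] := A01 i j.
  rewrite cabsM cabs_real ger0_norm// cabsB.
  by apply: le_trans cl; rewrite ler_piMl// cabs_ge0.
apply/andP; split.
  have /forallP Mu := opnorm_entries_le n_gt0 uw.
  apply/forallP => i; apply/forallP => j.
  have /forallP/(_ j) Mij := Mu i.
  have -> : M' i j = M w i j + (M' i j - M w i j) by rewrite addrC subrK.
  by rewrite (le_trans (cabsD _ _))// lerD// (le_trans (close i j)).
have e0 : 0 <= 2 * eta by rewrite mulr_ge0// ltW.
have /asboolP[x x0 Mx] := almost_singular_perturb e0 close
  (least_singular_value_almost_singular n_gt0 t0 sw).
apply/asboolP; exists x => //; apply: (le_trans Mx).
by rewrite ler_wpM2r// supn_ge0.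
Qed.

End FixedSize.

(** * The least singular value of a structured matrix *)

Lemma powR_scale (R : realType) (x g : R) : 2 <= x ->
  x `^ (- (4 * g + 30)) = (x ^+ 30 * (x `^ g) ^+ 4)^-1.
Proof.
move=> x2; have x0 : 0 < x by lra.
rewrite powRN; congr (_^-1); rewrite powRD; last by apply/implyP => _; exact: lt0r_neq0.
rewrite mulrC (mulrC 4) powRrM !powR_mulrn ?powR_ge0//.
exact: ltW.
Qed.

Lemma inv_sqrt_le_sqrt_log (R : realType) (a : R) (n : nat) : 0 <= a -> (2 <= n)%N ->
  a / Num.sqrt n%:R <= a / Num.sqrt (ln 2) * Num.sqrt (ln n%:R / n%:R).
Proof.
move=> a0 n2; have l2 : 0 < ln (2 : R) by rewrite ln_gt0// ltr1n.
have n0 : 0 < n%:R :> R by rewrite ltr0n ltnW.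
have ln2n : ln 2 <= ln (n%:R : R) by rewrite ler_ln ?posrE// ler_nat.
have ln0 : 0 <= ln (n%:R : R) by apply: ltW; apply: lt_le_trans ln2n.
rewrite sqrtrM// (sqrtrV (ltW n0)) mulrA ler_wpM2r ?invr_ge0 ?sqrtr_ge0//.
rewrite -mulrA ler_peMr// mulrC ler_pdivlMr ?sqrtr_gt0// mul1r.
by rewrite ler_sqrt.
Qed.

Lemma mesh_scales (R : realType) (x a s : R) : 2 <= x -> 1 <= a -> 0 < s -> s <= 1 ->
  let y := x ^- 24 / (a + 1) ^+ 4 / (4 * x) in
  [/\ 0 < y * s, 2 * (y * s) <= s / 2 & y * s <= y].
Proof.
move=> x2 a1 s0 s1; set t := x ^- 24 / _; cbv zeta; set y := t / _.
have x0 : 0 < x by lra.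
have a0 : 0 < a + 1 by lra.
have t0 : 0 < t by rewrite divr_gt0 ?invr_gt0 ?exprn_gt0.
have t1 : t <= 1.
  rewrite ler_pdivrMr ?exprn_gt0// mul1r.
  apply: (@le_trans _ _ 1); last by rewrite exprn_ege1; lra.
  by rewrite invf_le1 ?exprn_gt0// exprn_ege1; lra.
have y0 : 0 < y by rewrite divr_gt0// mulr_gt0.
have y8 : y <= 1 / 8 by rewrite ler_pdivrMr ?mulr_gt0//; lra.
split; first exact: mulr_gt0.
  have : y * s <= 1 / 8 * s by rewrite ler_wpM2r// ltW.
  by move: s0; clear; lra.
by rewrite ler_piMr// ltW.
Qed.

Local Open Scope classical_set_scope.

Theorem theorem1p24 (R : realType) :
  exists c1 K : R, 0 < c1 /\ 0 < K /\
  forall gamma : R, 1 / 2 <= gamma ->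
  exists beta : R, `|beta| <= K * gamma ^+ 2 /\
  forall delta sigma0 kappa0 : R,
    0 < delta < 1 -> 0 < sigma0 < 1 -> 1 <= kappa0 ->
  exists C : R,
  forall (n : nat) (A : 'M[R]_n) (B : 'M[complex R]_n) (eps : R)
    (d : measure_display) (T : measurableType d) (P : probability T R)
    (d' : measure_display) (T' : measurableType d') (P' : probability T' R)
    (X : 'I_n * 'I_n -> T -> complex R) (xi : T' -> complex R),
    (2 <= n)%N ->
    (forall i j, 0 <= A i j <= 1) ->
    atom_variable P' xi ->
    spread P' kappa0 xi ->
    iid_entries P P' X xi ->
    0 < eps < c1 * delta * sigma0 ^+ 2 ->
    super_regular delta eps (cutoff A sigma0) ->
    (P [set w | (singular_value (structured_matrix A B X w) n
                   <= n%:R `^ (- beta))%R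
              /\ (opnorm (structured_matrix A B X w) <= n%:R `^ gamma)%R]
     <= (C * Num.sqrt (ln n%:R / n%:R))%:E)%E.
Proof.
exists (1 / 8), 128; split; [lra|split; first lra] => gamma gamma_ge.
(* With [T = n ^ gamma + 1], the threshold [n ^- 24 / T ^+ 4] of the finite
   model is of order [n ^ (- (4 gamma + 24))]; the six further powers of [n] pay
   for the passage to the sup norm and for the constants. *)
exists (4 * gamma + 30); split; first by rewrite ger0_norm; nra.
move=> delta sigma0 kappa delta01 /andP[sigma0_gt0 sigma0_lt1] kappa1.
have kappa2 : 1 <= kappa ^+ 2 by rewrite exprn_ege1.
pose s := (30 * kappa ^+ 2)^-1.
have s_gt0 : 0 < s by rewrite invr_gt0; lra.
have s_le1 : s <= 1 by rewrite invf_le1; lra.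
have q01 : 0 < s ^+ 2 / 2 <= 1.
  by apply/andP; split; [rewrite divr_gt0 ?exprn_gt0|nra].
have [C0 [C0_ge0 model]] :=
  finite_model (divr_gt0 s_gt0 (ltr0Sn R 1)) sigma0_gt0 q01 delta01.
(* One unit of [C0 + 1] is for the entries off the grid. *)
exists ((C0 + 1) / Num.sqrt (ln 2)) => n A B eps d T P d' T' P' X xi.
move=> n_gt1 A01 xi_atom xi_spread X_iid /andP[eps_gt0 eps_lt] [_ _ rowA colA edgesA].
have eps_le : eps <= delta / 8.
  have /andP[d0 d1] := delta01; apply: (le_trans (ltW eps_lt)).
  have -> : delta / 8 = 1 / 8 * delta * 1 by field.
  by rewrite ler_wpM2l ?exprn_ile1 ?ltW// mulr_gt0// divr_gt0.
pose x : R := n%:R; pose a := x `^ gamma.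
have x_ge2 : 2 <= x by rewrite ler_nat.
have a_ge1 : 1 <= a by rewrite -(powRr0 x) ler_powR; lra.
pose tau := x ^- 24 / (a + 1) ^+ 4.
(* The mesh is fine enough for the threshold [tau] and for the radius [s], and
   the grid so wide that an entry is off it with probability at most [n ^- 4]. *)
pose eta := tau / (4 * x) * s.
have [eta_gt0 eta_s eta_tau] := mesh_scales x_ge2 a_ge1 s_gt0 s_le1.
rewrite -/tau -/eta in eta_gt0 eta_s eta_tau.
pose N := (Num.truncn ((x ^+ 2 + 2 / s) / eta)).+1.
have N_big : x ^+ 2 + 2 / s <= N%:R * eta.
  by rewrite -ler_pdivrMr// ltW// truncnS_gt.
have s2_gt0 : 0 < 2 / s by rewrite divr_gt0.
have x2_gt0 : 0 < x ^+ 2 by rewrite exprn_gt0; lra.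
pose mu := law P' xi (@disc R eta N).
have xi_rv : complex_rv xi by have [] := xi_atom.
have disc_meas := @measurable_disc R eta N eta_gt0.
have := model n _ mu (@cell_value R eta N) (fun i j => A i j) B (a + 1).
set bad := Pr mu _ => bad_le.
have {bad_le} : bad <= C0 / Num.sqrt n%:R.
  apply: bad_le => //.
  - exact: law_ge0.
  - exact: law_sum.
  - move=> z; apply: (disc_spread xi_atom xi_spread eta_gt0 z eta_s).
    by apply: le_trans N_big; rewrite lerDr ltW.
  - by rewrite lerDr (le_trans ler01).
  - by move=> i; rewrite -row_nbhd_cutoff.
  - by move=> j; rewrite -row_nbhd_cutoff_tr.
  move=> S L SL LL; rewrite -edge_count_cutoff//; apply: edgesA.
    by apply: le_trans SL; rewrite ler_wpM2r.
  by apply: le_trans LL; rewrite ler_wpM2r.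
have none_le : (n ^ 2)%:R * mu None <= 1 / Num.sqrt n%:R.
  have N_gt0 : 0 < N%:R * eta by apply: lt_le_trans N_big; exact: addr_gt0.
  have h1 : mu None <= x ^- 4.
    apply: (le_trans (law_None xi_atom eta_gt0 N_gt0)).
    rewrite (_ : x ^- 4 = (x ^+ 2) ^- 2); last by rewrite -exprM.
    rewrite lef_pV2 ?posrE; [|exact: exprn_gt0|exact: exprn_gt0].
    rewrite ler_pXn2r ?nnegrE ?(ltW x2_gt0) ?(ltW N_gt0)//.
    by apply: le_trans N_big; rewrite lerDl ltW.
  apply: (@le_trans _ _ (x ^+ 2 * x ^- 4)).
    by rewrite natrX ler_wpM2l// ltW.
  have -> : x ^+ 2 * x ^- 4 = (x ^+ 2)^-1 by field; lra.
  rewrite mul1r lef_pV2 ?posrE ?sqrtr_gt0 ?ltr0n ?(ltnW n_gt1)//.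
  have x_ge0 : 0 <= x by exact: ler0n.
  have x_lex2 : x <= x ^+ 2.
    by rewrite expr2 ler_peMl//; apply: le_trans x_ge2; rewrite ler1n.
  apply: le_trans x_lex2.
  rewrite -[leRHS](ger0_norm x_ge0) -sqrtr_sqr ler_wsqrtr// expr2 ler_peMl//.
  by apply: le_trans x_ge2; rewrite ler1n.
move=> bad_le.
rewrite powR_scale//.
have eta_half : 2 * eta <= 1.
  by apply: (le_trans eta_s); rewrite ler_pdivrMr// mul1r (le_trans s_le1)// ler1n.
have t_ge0 : 0 <= (x ^+ 30 * a ^+ 4)^-1.
  by rewrite invr_ge0 mulr_ge0 ?exprn_ge0// (le_trans ler01).
have a_ge0 : 0 <= a := le_trans ler01 a_ge1.
have tau_ge := scale_comparison x_ge2 a_ge1 eta_tau.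
have discretized := discretized_bound B n_gt1 A01 xi_atom X_iid N eta_gt0
  eta_half t_ge0 a_ge0 tau_ge.
apply: (le_trans discretized).
rewrite lee_fin; have C1_ge0 : 0 <= C0 + 1 by rewrite addr_ge0.
apply: le_trans (inv_sqrt_le_sqrt_log C1_ge0 n_gt1).
by rewrite mulrDl addrC; exact: lerD.
Qed.
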